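(* Let $\varphi:\mathcal{K}(\mathbb{R}^n)\to\mathbb{C}$ be a continuous polynomial valuation and let $(U_\alpha)_{\alpha\in\mathcal{A}}$ be an open cover of $\mathbb{S}^{n-1}$. Then there exist $M\in\mathbb{N}$ and continuous polynomial valuations $\varphi_1,\dots,\varphi_M:\mathcal{K}(\mathbb{R}^n)\to\mathbb{C}$ such that the vertical supports $\operatorname{v-supp}\varphi_j$, $1\le j\le M$, are subordinate to the cover $(U_\alpha)_{\alpha\in\mathcal{A}}$ (i.e. for every $j$ there is $\alpha\in\mathcal{A}$ with $\operatorname{v-supp}\varphi_j\subset U_\alpha$) and such that $$\varphi=\varphi_1+\dots+\varphi_M.$$
   Context: $\mathcal{K}(\mathbb{R}^n)$ is the set of all nonempty compact convex subsets of $\mathbb{R}^n$ with the Hausdorff metric. A map $\varphi:\mathcal{K}(\mathbb{R}^n)\to\mathbb{C}$ is a valuation if $\varphi(K\cup L)+\varphi(K\cap L)=\varphi(K)+\varphi(L)$ whenever $K,L,K\cup L\in\mathcal{K}(\mathbb{R}^n)$. It is a polynomial valuation if there is $d\in\mathbb{N}_0$ such that for every $K\in\mathcal{K}(\mathbb{R}^n)$ the map $x\mapsto\varphi(K+x)$ is a polynomial in $x\in\mathbb{R}^n$ of degree at most $d$. $\mathrm{PVal}_r(\mathbb{R}^n)$ denotes the space of continuous polynomial valuations that are $r$-homogeneous, i.e. $\varphi(tK)=t^r\varphi(K)$ for $t\ge0$. Every continuous polynomial valuation of degree at most $d$ decomposes uniquely as $\varphi=\sum_{r=0}^{d+n}\varphi_r$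 with $\varphi_r\in\mathrm{PVal}_r(\mathbb{R}^n)$. Vertical support. The support function of $K$ is $h_K(y)=\sup_{x\in K}\langle y,x\rangle$, regarded as a function on $\mathbb{S}^{n-1}$. For $r\ge1$ and $\varphi\in\mathrm{PVal}_r(\mathbb{R}^n)$, let $\bar\varphi:\mathcal{K}(\mathbb{R}^n)^r\to\mathbb{C}$ be its polarization, i.e. the unique continuous symmetric map, Minkowski additive in each argument, such that for all $m$, all $K_i\in\mathcal{K}(\mathbb{R}^n)$ and $\lambda_i\ge0$, $\varphi(\lambda_1K_1+\dots+\lambda_mK_m)=\sum_{r_1+\dots+r_m=r}\binom{r}{r_1,\dots,r_m}\lambda_1^{r_1}\cdots\lambda_m^{r_m}\bar\varphi(K_1[r_1],\dots,K_m[r_m])$, where $K_i[r_i]$ means $K_i$ repeated $r_i$ times. The Goodey–Weil distribution $\mathrm{GW}(\varphi)$ is the unique distribution on $(\mathbb{S}^{n-1})^r$ with $\mathrm{GW}(\varphi)[h_{K_1}\otimes\dots\otimes h_{K_r}]=\bar\varphi(K_1,\dots,K_r)$ for all smooth convex bodies $K_1,\dots,K_r$ with strictly positive Gauss curvature; its support lies in the diagonal. With $\Delta_r:\mathbb{S}^{n-1}\to(\mathbb{S}^{n-1})^r$ the diagonal embedding, $\operatorname{v-supp}\varphi:=\Delta_r^{-1}(\operatorname{supp}\mathrm{GW}(\varphi))$. For a general continuous polynomial valuation $\varphi=\sum_{r=0}^{d+n}\varphi_r$, $\operatorname{v-supp}\varphi:=\bigcup_{r=1}^{d+n}\operatorname{v-supp}\varphi_r$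 (in particular the vertical support of a $0$-homogeneous valuation is empty). Equivalently, $\operatorname{v-supp}\varphi$ is the smallest closed set $A\subset\mathbb{S}^{n-1}$ such that $\varphi(K)=\varphi(L)$ whenever $h_K=h_L$ on a neighborhood of $A$. *)

(* Defs.v *)
From HB Require Import structures.
From mathcomp Require Import all_boot all_order all_algebra all_fingroup.
From mathcomp Require Import all_classical all_reals all_analysis.
From mathcomp Require Import complex.
From mathcomp Require mpoly.
Import (coercions, canonicals) mpoly.

Set Implicit Arguments.
Unset Strict Implicit.
Unset Printing Implicit Defensive.

Import Order.TTheory GRing.Theory Num.Theory.
Import numFieldNormedType.Exports.

Local Open Scope classical_set_scope.
Local Open Scope ring_scope.
Local Open Scope complex_scope.

(** The norm of the library on ['rV_n] is the sup norm; the Euclidean structure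
    of R^n is the following one. *)
Definition dotp (R : realType) (n : nat) (x y : 'rV[R]_n) : R :=
  \sum_(i < n) x 0 i * y 0 i.

Definition enorm (R : realType) (n : nat) (x : 'rV[R]_n) : R :=
  Num.sqrt (dotp x x).

Definition usphere (R : realType) (n : nat) : set 'rV[R]_n :=
  [set x | enorm x = 1].

Record convex_body (R : realType) (n : nat) := ConvexBody {
  body_set : set 'rV[R]_n ;
  body_neq0 : body_set !=set0 ;
  body_compact : compact body_set ;
  body_convex : convex_set body_set }.

Lemma convex_body_eq (R : realType) (n : nat) (K L : convex_body R n) :
  body_set K = body_set L -> K = L.
Proof.
case: K L => [K K1 K2 K3] [L L1 L2 L3] /= KL; subst L.
by congr ConvexBody; exact: Prop_irrelevance.
Qed.

Section body_operations.
Context (R : realType) (n : nat).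
Implicit Types (K L : convex_body R n) (x : 'rV[R]_n) (t : R).

Lemma convex_rVP (A : set 'rV[R]_n) :
  convex_set A <->
  (forall x y t, A x -> A y -> 0 <= t -> t <= 1 -> A (t *: x + (1 - t) *: y)).
Proof.
split=> [cA x y t Ax Ay t0 t1|cA].
  by have := cA x y (Itv01 t0 t1); rewrite !inE => /(_ Ax Ay).
move=> x y l; rewrite !inE => Ax Ay.
exact: cA.
Qed.

Definition body_add_set K L : set 'rV[R]_n :=
  [set z | exists x y, [/\ body_set K x, body_set L y & z = x + y]].

Lemma body_add_neq0 K L : body_add_set K L !=set0.
Proof.
have [x Kx] := body_neq0 K; have [y Ly] := body_neq0 L.
by exists (x + y), x, y.
Qed.

Lemma body_add_compact K L : compact (body_add_set K L).
Proof.
have -> : body_add_set K L = (fun z => z.1 + z.2) @` (body_set K `*` body_set L).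
  apply/seteqP; split => [z [x [y [Kx Ly ->]]]|z [[x y] [Kx Ly] <-]].
    by exists (x, y).
  by exists x, y.
apply: continuous_compact; last exact: compact_setX (@body_compact _ _ K) (@body_compact _ _ L).
by apply: continuous_subspaceT => z; exact: add_continuous.
Qed.

Lemma body_add_convex K L : convex_set (body_add_set K L).
Proof.
apply/convex_rVP => z z' t [x [y [Kx Ly ->]]] [x' [y' [Kx' Ly' ->]]] t0 t1.
exists (t *: x + (1 - t) *: x'), (t *: y + (1 - t) *: y'); split.
- by have /convex_rVP := @body_convex _ _ K; apply.
- by have /convex_rVP := @body_convex _ _ L; apply.
- by rewrite !scalerDr addrACA.
Qed.

Definition body_add K L : convex_body R n :=
  ConvexBody (body_add_neq0 K L) (@body_add_compact K L) (@body_add_convex K L).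

Definition body_scale_set t K : set 'rV[R]_n := [set t *: x | x in body_set K].

Lemma body_scale_neq0 t K : body_scale_set t K !=set0.
Proof. by have [x Kx] := body_neq0 K; exists (t *: x), x. Qed.

Lemma body_scale_compact t K : compact (body_scale_set t K).
Proof.
apply: continuous_compact; last exact: body_compact.
by apply: continuous_subspaceT => z; exact: scaler_continuous.
Qed.

Lemma body_scale_convex t K : convex_set (body_scale_set t K).
Proof.
apply/convex_rVP => _ _ s [x Kx <-] [y Ky <-] s0 s1.
exists (s *: x + (1 - s) *: y).
  by have /convex_rVP := @body_convex _ _ K; apply.
by rewrite scalerDr !scalerA ![t * _]mulrC.
Qed.

Definition body_scale t K : convex_body R n :=
  ConvexBody (body_scale_neq0 t K) (@body_scale_compact t K) (@body_scale_convex t K).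

Lemma point_neq0 x : [set x] !=set0. Proof. by exists x. Qed.

Lemma point_convex x : convex_set [set x].
Proof.
by apply/convex_rVP => _ _ t -> -> _ _ /=; rewrite -scalerDl addrC subrK scale1r.
Qed.

Definition point_body x : convex_body R n :=
  ConvexBody (point_neq0 x) (@compact_set1 _ x) (@point_convex x).

Definition hausdorff K L : R :=
  inf [set e | [/\ 0 <= e,
    forall x, body_set K x -> exists2 y, body_set L y & enorm (x - y) <= e &
    forall y, body_set L y -> exists2 x, body_set K x & enorm (x - y) <= e]].

Definition support_fun K (y : 'rV[R]_n) : R := sup [set dotp y x | x in body_set K].

End body_operations.

Section valuations.
Context (R : realType) (n : nat).
Local Notation body := (convex_body R n).
Implicit Types (phi : body -> R[i]) (r d : nat).

(** If the union of two convex bodies is convex, then they intersect, so that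
    the body [I] below always exists. *)
Definition valuation phi :=
  forall K L U I : body,
    body_set U = body_set K `|` body_set L ->
    body_set I = body_set K `&` body_set L ->
    phi U + phi I = phi K + phi L.

Definition polynomial_of_degree_le d phi :=
  forall K : body, exists p : mpoly.mpoly n R[i],
    (mpoly.msize p <= d.+1)%N /\
    forall x : 'rV[R]_n,
      phi (body_add K (point_body x)) = mpoly.meval (fun i => (x 0 i)%:C) p.

Definition hausdorff_continuous phi :=
  forall (K : body) (e : R), 0 < e ->
    exists2 delta : R, 0 < delta &
      forall L : body, hausdorff K L < delta -> Normc.normc (phi L - phi K) < e.

Definition cont_poly_val_le d phi :=
  [/\ valuation phi, hausdorff_continuous phi & polynomial_of_degree_le d phi].

Definition cont_poly_val phi := exists d, cont_poly_val_le d phi.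

Definition PVal r phi :=
  cont_poly_val phi /\
  forall (t : R) (K : body), 0 <= t -> phi (body_scale t K) = t%:C ^+ r * phi K.

Definition homogeneous_decomposition d phi (phis : nat -> body -> R[i]) :=
  [/\ cont_poly_val_le d phi,
      forall r, (r <= d + n)%N -> PVal r (phis r) &
      forall K, phi K = \sum_(0 <= r < (d + n).+1) phis r K].

Definition minkowski_comb m (l : 'I_m -> R) (K : 'I_m -> body) : body :=
  \big[@body_add R n/point_body 0]_(i < m) body_scale (l i) (K i).

(** The [r]-tuple [(K_0[rho_0], ..., K_(m-1)[rho_(m-1)])] when [rho] sums up
    to [r]. *)
Definition repeated m r (K : 'I_m -> body) (rho : {ffun 'I_m -> 'I_r.+1}) :
    'I_r -> body :=
  fun j => nth (point_body 0) (flatten [seq nseq (rho i) (K i) | i : 'I_m]) j.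

Definition replace_at r (K : 'I_r -> body) (i : 'I_r) (A : body) : 'I_r -> body :=
  fun j => if j == i then A else K j.

Definition polarization r phi (psi : ('I_r -> body) -> R[i]) :=
  [/\ (forall (K : 'I_r -> body) (e : R), 0 < e ->
         exists2 delta : R, 0 < delta &
           forall L : 'I_r -> body,
             (forall i, hausdorff (K i) (L i) < delta) ->
             Normc.normc (psi L - psi K) < e),
      (forall (s : {perm 'I_r}) (K : 'I_r -> body), psi (K \o s) = psi K),
      (forall (i : 'I_r) (K : 'I_r -> body) (A B : body),
         psi (replace_at K i (body_add A B)) =
         psi (replace_at K i A) +
         psi (replace_at K i B)) &
      (forall m (K : 'I_m -> body) (l : 'I_m -> R), (forall i, 0 <= l i) ->
         phi (minkowski_comb l K) =
         \sum_(rho : {ffun 'I_m -> 'I_r.+1} | (\sum_(i < m) rho i == r)%N)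
           (r`! %/ \prod_(i < m) (rho i)`!)%N%:R *
           (\prod_(i < m) l i ^+ rho i)%:C *
           psi (repeated K rho))].

End valuations.

Section smoothness.
Context (R : realType).

Fixpoint Ck_on (V : normedModType R) (O : set V) (k : nat) (f : V -> R) : Prop :=
  (forall x, O x -> {for x, continuous f}) /\
  if k is k'.+1 then
    forall v : V, (forall x, O x -> derivable f x v) /\
                  Ck_on O k' (fun x => 'D_v f x)
  else True.

(** Meant for [O] open. *)
Definition smooth_on (V : normedModType R) (O : set V) (f : V -> R) :=
  forall k, Ck_on O k f.

Definition grad n (g : 'rV[R]_n -> R) (x : 'rV[R]_n) : 'rV[R]_n :=
  \row_j 'D_(delta_mx 0 j) g x.

Definition hessian n (g : 'rV[R]_n -> R) (x : 'rV[R]_n) : 'M[R]_n :=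
  \matrix_(i, j) 'D_(delta_mx 0 i) (fun y => 'D_(delta_mx 0 j) g y) x.

(** Product of the principal curvatures at [x] of the level set of [g] through
    [x], with the sign for which the boundary of a ball [g <= 0] has positive
    curvature: the second fundamental form is then the restriction of
    [hessian g x / |grad g x|] to the orthogonal complement of [grad g x], and
    the determinant of this restriction is given by the adjugate. *)
Definition level_gauss_curvature n (g : 'rV[R]_n -> R) (x : 'rV[R]_n) : R :=
  (grad g x *m \adj (hessian g x) *m (grad g x)^T) 0 0 / enorm (grad g x) ^+ n.+1.

(** Near each boundary point, [K] is the sublevel set of a smooth function
    without critical points (hence the boundary is a smooth hypersurface), and
    the Gauss curvature is positive. *)
Definition smooth_positively_curved n (K : convex_body R n) :=
  forall p, body_set K p -> ~ interior (body_set K) p ->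
    exists (O : set 'rV[R]_n) (g : 'rV[R]_n -> R),
      [/\ open O, O p, smooth_on O g,
          forall x, O x -> grad g x != 0 /\ (body_set K x <-> g x <= 0) &
          0 < level_gauss_curvature g p].

End smoothness.

(** A function on the product of [r] copies of the unit sphere is encoded by a
    function of the [r x n] matrices, the [i]-th row being the [i]-th point; only
    its values on [sphere_pow] matter. *)
Section sphere_distributions.
Context (R : realType) (n r : nat).
Local Notation mat := 'M[R]_(r, n).

Definition sphere_pow : set mat :=
  [set X | forall i, usphere (row i X)].

Definition normalize_rows (X : mat) : mat :=
  \matrix_(i, j) (X i j / enorm (row i X)).

(** Extension of [f] restricted to [sphere_pow], homogeneous of degree 0 in each
    row. *)
Definition radial_ext (f : mat -> R) : mat -> R := f \o normalize_rows.

Definition sphere_smooth (f : mat -> R) :=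
  smooth_on [set X : mat | forall i, row i X != 0] (radial_ext f).

Definition iter_partial (s : seq ('I_r * 'I_n)) (f : mat -> R) : mat -> R :=
  foldr (fun ij (g : mat -> R) X => 'D_(delta_mx ij.1 ij.2) g X) f s.

(** Complex-valued distributions, as real-linear functionals on real-valued test
    functions (equivalently, complex-linear functionals on complex-valued test
    functions). The values of [T] on non-smooth functions are irrelevant.
    Continuity for the usual Frechet topology is the existence of a bound by
    finitely many sup norms of derivatives; since [radial_ext f] only depends on
    the restriction of [f] to [sphere_pow], so does [T f]. *)
Definition distribution (T : (mat -> R) -> R[i]) :=
  (forall (a : R) f g, sphere_smooth f -> sphere_smooth g ->
     T (fun X => a * f X + g X) = a%:C * T f + T g) /\
  exists (k : nat) (C : R), forall (f : mat -> R) (M : R), sphere_smooth f ->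
    (forall s X, (size s <= k)%N -> sphere_pow X ->
       `|iter_partial s (radial_ext f) X| <= M) ->
    Normc.normc (T f) <= C * M.

Definition dist_supp (T : (mat -> R) -> R[i]) : set mat :=
  [set X | sphere_pow X /\
    forall O : set mat, open O -> O X ->
      exists f : mat -> R,
        [/\ sphere_smooth f,
            closure [set Y | sphere_pow Y /\ f Y != 0] `<=` O &
            T f != 0]].

Definition support_tensor (K : 'I_r -> convex_body R n) : mat -> R :=
  fun X => \prod_(i < r) support_fun (K i) (row i X).

Definition goodey_weil (phi : convex_body R n -> R[i]) (T : (mat -> R) -> R[i]) :=
  distribution T /\
  exists psi : ('I_r -> convex_body R n) -> R[i],
    polarization phi psi /\
    forall K : 'I_r -> convex_body R n,
      (forall i, smooth_positively_curved (K i)) ->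
      T (support_tensor K) = psi K.

Definition diag_embedding (u : 'rV[R]_n) : mat := \matrix_(i, j) u 0 j.

(** The Goodey-Weil distribution of an element of [PVal r], [r >= 1], exists and
    is unique on test functions, so that quantifying over [T] amounts to
    selecting it. *)
Definition v_supp_hom (phi : convex_body R n -> R[i]) : set 'rV[R]_n :=
  [set u | usphere u /\
    exists2 T, goodey_weil phi T & dist_supp T (diag_embedding u)].

End sphere_distributions.

(** The homogeneous components exist and are unique (and those of index above
    [d + n] vanish), so that the existential quantification selects them. *)
Definition v_supp (R : realType) (n : nat) (phi : convex_body R n -> R[i]) :
    set 'rV[R]_n :=
  [set u | exists (d : nat) (phis : nat -> convex_body R n -> R[i]),
    homogeneous_decomposition d phi phis /\
    exists2 r : nat, (1 <= r <= d + n)%N & v_supp_hom r (phis r) u].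

Definition sphere_open (R : realType) (n : nat) (U : set 'rV[R]_n) :=
  exists2 O : set 'rV[R]_n, open O & U = O `&` @usphere R n.

(* Main.v *)
(** By polarization, a component of degree [r] is [K |-> M (h_K, ..., h_K)], with
    [M] multilinear on differences of support functions. This space is stable
    under multiplication by a smooth nonnegative function [w] on the sphere,
    since [w h_K + C |.|] is sublinear for [C] large. A smooth partition of unity
    [(w_l)] then splits the component into the pieces
    [chi_c K = M (w_(c 0) h_K, ..., w_(c (r-1)) h_K)].

    By the polarization identity, [chi_c] is a combination of diagonal pieces
    [M (w h_K, ..., w h_K)], the values at [t = 0] of the polynomials
    [t |-> M (w h_K + t |.|, ...)]; for [t] large these evaluate the component at
    a body whose support function depends on [h_K] compatibly with maxima and
    minima, hence with unions and intersections.

    The Goodey-Weil distribution of [chi_c] kills the tensor products of smooth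
    functions vanishing where [w_(c 0)] lives, because each smooth function is,
    up to scaling and up to [|.|], the support function of a smooth positively
    curved body. Bernstein approximation of iterated partial derivatives shows
    that such tensor products approximate all the test functions concentrated
    near a point of the diagonal. *)
Require Import Defs.
From HB Require Import structures.
From mathcomp Require Import all_boot all_order all_algebra all_fingroup.
From mathcomp Require Import all_classical all_reals all_analysis.
From mathcomp Require Import complex.
From mathcomp Require Import ring lra.
From mathcomp Require mpoly.
Import (coercions, canonicals) mpoly.
Set Implicit Arguments.
Unset Strict Implicit.
Unset Printing Implicit Defensive.
Import Order.TTheory GRing.Theory Num.Theory.
Import numFieldNormedType.Exports.
Local Open Scope classical_set_scope.
Local Open Scope ring_scope.
Local Open Scope complex_scope.

(** * Smooth functions *)

(** [v_supp] and [goodey_weil] quantify existentially over the homogeneous decomposition, the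
    polarization and the distribution. Where a witness is missing, the support concerned is empty
    and the valuation is its own piece; otherwise the witness supplies the polarization behind [M].
    Since [w h_K] is in general no support function, neither continuity nor the valuation property
    passes directly to the pieces. The constant making [w h_K + C |.|] sublinear depends only on [w]
    and on a bound for [K], so that one [C] serves two bodies, their union and intersection, or all
    bodies near [K]; multilinearity then undoes the shift by [C |.|]. One cutoff is enough to
    localize a piece: in each term of the symmetrized [M], the slot carrying [w_(c 0)] receives a
    difference that vanishes on its cap. A distribution has a finite but arbitrary order, so test
    functions must be approximated together with many derivatives. Division by a product of bumps
    that vanish on the expected support, before the approximation, and multiplication by it
    afterwards turn every monomial into a tensor product killed by the distribution. *)

Section line_derivative.
Context (R : realType) (V : normedModType R).
Implicit Types (f g : V -> R) (x v : V) (a t : R).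

Lemma is_derive_line f x v t (d : R) :
  is_derive (x + t *: v) v f d -> is_derive t (1 : R) (fun s : R => f (x + s *: v)) d.
Proof.
have E : (fun h : R => h^-1 *: (((fun s : R => f (x + s *: v)) \o shift t) (h *: 1) -
     f (x + t *: v))) =
  (fun h => h^-1 *: ((f \o shift (x + t *: v)) (h *: v) - f (x + t *: v))).
  apply/funext => h /=; congr (_ *: (f _ - _)).
  by rewrite [h *: 1]mulr1 scalerDl addrCA.
case=> df <-; split; first by rewrite /derivable E.
by rewrite /derive E.
Qed.

Lemma mvt_line f x v :
  (forall t : R, 0 <= t <= 1 -> derivable f (x + t *: v) v) ->
  exists2 c : R, 0 <= c <= 1 & f (x + v) - f x = 'D_v f (x + c *: v).
Proof.
move=> df; pose g (s : R) := f (x + s *: v).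
have dg (t : R) : 0 <= t <= 1 -> is_derive t (1 : R) g ('D_v f (x + t *: v)).
  by move=> t01; apply: is_derive_line; apply: derivableP; exact: df.
have [||c c01] := @MVT_segment R g (fun t => 'D_v f (x + t *: v)) 0 1 ler01.
- by move=> t; rewrite in_itv /= => /andP[t0 t1]; apply: dg; rewrite !ltW.
- apply: derivable_within_continuous => t; rewrite in_itv /= => t01.
  by have [] := dg t t01.
rewrite subr0 mulr1 /g scale1r scale0r addr0 => E.
by exists c => //; move: c01; rewrite in_itv.
Qed.

Lemma derivableZdir f x v a : derivable f x v -> derivable f x (a *: v).
Proof.
have [->|a0] := eqVneq a 0; first by rewrite scale0r => _; exact: derivable0.
move=> /derivable1P df; apply/derivable1P.
have -> : (fun h : R => f (h *: (a *: v) + x)) = (fun h : R => f (h *: v + x)) \o ( *%R^~ a).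
  by apply/funext => h /=; rewrite scalerA.
apply/derivable1_diffP; apply: differentiable_comp => //.
by apply/derivable1_diffP; rewrite /= mul0r.
Qed.

Lemma deriveZdir f x v a : derivable f x v -> 'D_(a *: v) f x = a * 'D_v f x.
Proof.
move=> df; have [->|a0] := eqVneq a 0; first by rewrite scale0r derive0 mul0r.
have [dg eg] : is_derive (0 : R) (1 : R) (fun s : R => f (x + s *: v)) ('D_v f x).
  by apply: is_derive_line; rewrite scale0r addr0; exact: derivableP.
have := @is_derive1_comp R (fun s => f (x + s *: v)) (fun s => s * a) 0 ('D_v f x) a.
rewrite mul0r => /(_ (DeriveDef dg eg)) H.
have dm : is_derive (0 : R) (1 : R) (fun s : R => s * a) a.
  have -> : (fun s : R => s * a) = a *: id.
    by apply/funext => s; rewrite mulrC.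
  by apply: is_derive_eq; rewrite [LHS]mulr1.
have {H} [d1 e1] := H dm; rewrite mulrC -e1.
rewrite /derive /=; congr (lim _); apply: (congr1 (fun F => F @ _)).
apply/funext => h; rewrite /= mul0r scale0r addr0 [x + _]addrC.
by rewrite [h *: 1]mulr1 scalerA addr0.
Qed.

Lemma is_derive_comp1 (th : R -> R) f x v (df dth : R) :
  is_derive x v f df -> is_derive (f x) (1 : R) th dth ->
  is_derive x v (th \o f) (dth * df).
Proof.
move=> dfx dthx.
have dl : is_derive (0 : R) (1 : R) (fun s : R => f (x + s *: v)) df.
  by apply: is_derive_line; rewrite scale0r addr0.
have := @is_derive1_comp R th (fun s : R => f (x + s *: v)) 0 dth df.
rewrite /= scale0r addr0 => /(_ dthx dl) [d1 e1].
have E : (fun h : R => h^-1 *: (((th \o f) \o shift x) (h *: v) - (th \o f) x)) =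
   (fun h => h^-1 *: (((th \o (fun s : R => f (x + s *: v))) \o shift (0:R)) (h *: 1) -
     (th \o (fun s : R => f (x + s *: v))) 0)).
  apply/funext => h /=; rewrite scale0r addr0 [h *: 1]mulr1 addr0.
  by rewrite [x + _]addrC.
by split; [rewrite /derivable E | rewrite /derive E].
Qed.

End line_derivative.

Section smooth_calculus.
Context (R : realType) (V : normedModType R).
Implicit Types (f g : V -> R) (O : set V) (k : nat).

Lemma Ck_on_continuous O k f : Ck_on O k f -> forall x, O x -> {for x, continuous f}.
Proof. by case: k => [|k] []. Qed.

Lemma Ck_on_derivable O k f : Ck_on O k.+1 f -> forall x v, O x -> derivable f x v.
Proof. by move=> /= -[_ H] x v Ox; have [/(_ x Ox)] := H v. Qed.

Lemma Ck_on_D O k f v : Ck_on O k.+1 f -> Ck_on O k ('D_v f : V -> R).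
Proof. by move=> /= -[_ H]; have [] := H v. Qed.

Lemma Ck_on_le O k f : Ck_on O k.+1 f -> Ck_on O k f.
Proof.
elim: k f => [|k IH] f [cf H]; split => // v.
by have [df dk] := H v; split => //; exact: IH.
Qed.

(** Every clause of [Ck_on] is continuity or derivability at a point with respect to the whole space
    [V], not relative to the subset; any set [P] through the point therefore transfers it. *)
Lemma Ck_on_local O k f :
  (forall x, O x -> exists2 P : set V, P x & Ck_on P k f) -> Ck_on O k f.
Proof.
elim: k f => [|k IH] f H.
  by split => // x /H[P Px /Ck_on_continuous]; apply.
split=> [x /H[P Px /Ck_on_continuous]|v]; first exact.
split=> [x /H[P Px /Ck_on_derivable]|]; first exact.
by apply: IH => x /H[P Px /Ck_on_D]; exists P.
Qed.

Lemma Ck_on_sub O P k f : P `<=` O -> Ck_on O k f -> Ck_on P k f.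
Proof. by move=> PO cf; apply: Ck_on_local => x /PO Ox; exists O. Qed.

Lemma Ck_on_ext O k f g : open O -> (forall x, O x -> f x = g x) ->
  Ck_on O k f -> Ck_on O k g.
Proof.
move=> oO; elim: k f g => [|k IH] f g fg.
  move=> -[cf _]; split => // x Ox.
  have nfg : {near x, f =1 g} by apply: filterS (open_nbhs_nbhs (conj oO Ox)).
  rewrite /prop_for /continuous_at -(fg x Ox).
  exact: (cvg_trans (near_eq_cvg nfg) (cf x Ox)).
move=> -[cf H]; split=> [x Ox|v].
  have nfg : {near x, f =1 g} by apply: filterS (open_nbhs_nbhs (conj oO Ox)).
  rewrite /prop_for /continuous_at -(fg x Ox).
  exact: (cvg_trans (near_eq_cvg nfg) (cf x Ox)).
have [df ck] := H v; split.
  move=> x Ox; apply: near_eq_derivable (df x Ox).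
  by apply: filterS (open_nbhs_nbhs (conj oO Ox)).
apply: IH ck => x Ox; apply: near_eq_derive.
by apply: filterS (open_nbhs_nbhs (conj oO Ox)).
Qed.

(** The introduction rule for inductions on [k]: the regularity of the derivative is checked on an
    explicit formula [g]. *)
Lemma Ck_onS O k f : open O -> (forall x, O x -> {for x, continuous f}) ->
  (forall v, exists2 g, (forall x, O x -> is_derive x v f (g x)) & Ck_on O k g) ->
  Ck_on O k.+1 f.
Proof.
move=> oO cf H; split => // v; have [g dg cg] := H v; split.
  by move=> x /dg[].
by apply: Ck_on_ext cg => // x /dg[_ ->].
Qed.

Lemma Ck_on_derive O k f x v : Ck_on O k.+1 f -> O x -> is_derive x v f ('D_v f x).
Proof. by move=> /Ck_on_derivable cf Ox; apply: derivableP; exact: cf. Qed.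

Lemma Ck_on_cst O k (c : R) : open O -> Ck_on O k (fun _ => c).
Proof.
move=> oO; elim: k c => [|k IH] c.
  by split => // x _; exact: cst_continuous.
apply: Ck_onS => // [x _|v]; first exact: cst_continuous.
by exists (fun=> 0) => // x Ox; exact: is_derive_cst.
Qed.

Lemma Ck_onD O k f g : open O -> Ck_on O k f -> Ck_on O k g ->
  Ck_on O k (fun x => f x + g x).
Proof.
move=> oO; elim: k f g => [|k IH] f g cf cg.
  split=> // x Ox; apply: continuousD; [exact: Ck_on_continuous cf _ _|exact: Ck_on_continuous cg _ _].
apply: Ck_onS => // [x Ox|v].
  by apply: continuousD; [exact: Ck_on_continuous cf _ _|exact: Ck_on_continuous cg _ _].
exists (fun x => 'D_v f x + 'D_v g x); last by apply: IH; exact: Ck_on_D.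
by move=> x Ox; apply: is_deriveD; [exact: Ck_on_derive cf Ox|exact: Ck_on_derive cg Ox].
Qed.

Lemma Ck_onM O k f g : open O -> Ck_on O k f -> Ck_on O k g ->
  Ck_on O k (fun x => f x * g x).
Proof.
move=> oO; elim: k f g => [|k IH] f g cf cg.
  split=> // x Ox; apply: continuousM; [exact: Ck_on_continuous cf _ _|exact: Ck_on_continuous cg _ _].
apply: Ck_onS => // [x Ox|v].
  by apply: continuousM; [exact: Ck_on_continuous cf _ _|exact: Ck_on_continuous cg _ _].
exists (fun x => f x * 'D_v g x + g x * 'D_v f x).
  move=> x Ox; apply: is_deriveM; [exact: Ck_on_derive cf Ox|exact: Ck_on_derive cg Ox].
by apply: Ck_onD => //; apply: IH; by [exact: Ck_on_D|exact: Ck_on_le].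
Qed.

(** The outer function is given as the sequence [th] of its successive derivatives on [D], so that
    the induction on [k], with [j] general, stays inside the same family. Inverse, square root and
    bump are all instances. *)
Lemma Ck_on_comp1 O k (th : nat -> R -> R) (D : set R) f j : open O ->
  (forall i t, D t -> is_derive t (1 : R) (th i) (th i.+1 t)) ->
  (forall x, O x -> D (f x)) ->
  Ck_on O k f -> Ck_on O k (th j \o f).
Proof.
move=> oO dth fD; elim: k j => [|k IH] j cf.
  split=> // x Ox; apply: continuous_comp; first exact: Ck_on_continuous cf _ _.
  apply: differentiable_continuous; apply/derivable1_diffP.
  by have [] := dth j _ (fD _ Ox).
apply: Ck_onS => // [x Ox|v].
  apply: continuous_comp; first exact: Ck_on_continuous cf _ _.
  apply: differentiable_continuous; apply/derivable1_diffP.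
  by have [] := dth j _ (fD _ Ox).
exists (fun x => th j.+1 (f x) * 'D_v f x).
  move=> x Ox; apply: is_derive_comp1; first exact: Ck_on_derive cf Ox.
  exact: dth (fD _ Ox).
apply: Ck_onM => //; last exact: Ck_on_D.
by apply: IH; exact: Ck_on_le.
Qed.

Lemma Ck_on_linear O k (f : {linear V -> R}) : open O -> continuous f -> Ck_on O k f.
Proof.
move=> oO cf; case: k => [|k]; first by split => // x _; exact: cf.
apply: Ck_onS => // [x _|v]; first exact: cf.
exists (fun=> f v); last exact: Ck_on_cst.
move=> x _; have df := linear_differentiable x cf.
by split; [exact: diff_derivable|rewrite deriveE // diff_lin].
Qed.

Lemma smooth_on_ext O f g : open O -> (forall x, O x -> f x = g x) ->
  smooth_on O f -> smooth_on O g.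
Proof. by move=> oO fg cf k; exact: Ck_on_ext (cf k). Qed.

Lemma smooth_on_cst O (c : R) : open O -> smooth_on O (fun _ => c).
Proof. by move=> oO k; exact: Ck_on_cst. Qed.

Lemma smooth_onD O f g : open O -> smooth_on O f -> smooth_on O g ->
  smooth_on O (fun x => f x + g x).
Proof. by move=> oO cf cg k; exact: Ck_onD. Qed.

Lemma smooth_onM O f g : open O -> smooth_on O f -> smooth_on O g ->
  smooth_on O (fun x => f x * g x).
Proof. by move=> oO cf cg k; exact: Ck_onM. Qed.

Lemma smooth_onZ O c f : open O -> smooth_on O f -> smooth_on O (fun x => c * f x).
Proof. by move=> oO cf; apply: smooth_onM => //; exact: smooth_on_cst. Qed.

Lemma smooth_onN O f : open O -> smooth_on O f -> smooth_on O (fun x => - f x).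
Proof.
move=> oO cf; apply: (@smooth_on_ext _ (fun x => (-1) * f x)) => //.
  by move=> x _; rewrite mulN1r.
exact: smooth_onZ.
Qed.

Lemma smooth_onB O f g : open O -> smooth_on O f -> smooth_on O g ->
  smooth_on O (fun x => f x - g x).
Proof. by move=> oO cf cg; apply: smooth_onD => //; exact: smooth_onN. Qed.

Lemma smooth_on_sum O I (r : seq I) (P : pred I) (F : I -> V -> R) : open O ->
  (forall i, P i -> smooth_on O (F i)) ->
  smooth_on O (fun x => \sum_(i <- r | P i) F i x).
Proof.
move=> oO H; elim: r => [|i r IH].
  apply: (@smooth_on_ext _ (fun=> 0)) => //; last exact: smooth_on_cst.
  by move=> x _; rewrite big_nil.
have [Pi|nPi] := boolP (P i); last first.
  by apply: smooth_on_ext IH => // x _; rewrite big_cons (negbTE nPi).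
apply: (@smooth_on_ext _ (fun x => F i x + \sum_(i <- r | P i) F i x)) => //.
  by move=> x _; rewrite big_cons Pi.
by apply: smooth_onD => //; exact: H.
Qed.

Lemma smooth_on_prod O I (r : seq I) (P : pred I) (F : I -> V -> R) : open O ->
  (forall i, P i -> smooth_on O (F i)) ->
  smooth_on O (fun x => \prod_(i <- r | P i) F i x).
Proof.
move=> oO H; elim: r => [|i r IH].
  apply: (@smooth_on_ext _ (fun=> 1)) => //; last exact: smooth_on_cst.
  by move=> x _; rewrite big_nil.
have [Pi|nPi] := boolP (P i); last first.
  by apply: smooth_on_ext IH => // x _; rewrite big_cons (negbTE nPi).
apply: (@smooth_on_ext _ (fun x => F i x * \prod_(i <- r | P i) F i x)) => //.
  by move=> x _; rewrite big_cons Pi.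
by apply: smooth_onM => //; exact: H.
Qed.

Lemma smooth_on_exp O f n : open O -> smooth_on O f -> smooth_on O (fun x => f x ^+ n).
Proof.
move=> oO cf; elim: n => [|n IH].
  by apply: smooth_on_cst.
apply: (@smooth_on_ext _ (fun x => f x * f x ^+ n)) => //.
  by move=> x _; rewrite exprS.
exact: smooth_onM.
Qed.

Lemma smooth_on_comp1 O (th : nat -> R -> R) (D : set R) f : open O ->
  (forall i t, D t -> is_derive t (1 : R) (th i) (th i.+1 t)) ->
  (forall x, O x -> D (f x)) ->
  smooth_on O f -> smooth_on O (fun x => th 0%N (f x)).
Proof. by move=> oO dth fD cf k; exact: Ck_on_comp1 dth fD (cf k). Qed.

Lemma smooth_on_linear O (f : {linear V -> R}) :
  open O -> continuous f -> smooth_on O f.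
Proof. by move=> oO cf k; exact: Ck_on_linear. Qed.

Lemma smooth_on_sub O P f : P `<=` O -> smooth_on O f -> smooth_on P f.
Proof. by move=> PO cf k; exact: Ck_on_sub (cf k). Qed.

Lemma smooth_on_local O f :
  (forall x, O x -> exists2 P : set V, P x & smooth_on P f) -> smooth_on O f.
Proof. by move=> H k; apply: Ck_on_local => x /H[P Px cf]; exists P. Qed.

Lemma smooth_on_D O f v : smooth_on O f -> smooth_on O ('D_v f : V -> R).
Proof. by move=> cf k; exact: Ck_on_D (cf k.+1). Qed.

Lemma smooth_on_continuous O f x : smooth_on O f -> O x -> {for x, continuous f}.
Proof. by move=> cf; exact: Ck_on_continuous (cf 0%N) x. Qed.

Lemma smooth_on_derivable O f x v : smooth_on O f -> O x -> derivable f x v.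
Proof. by move=> cf; exact: Ck_on_derivable (cf 1%N) x v. Qed.

Lemma smooth_on_derive O f x v : smooth_on O f -> O x -> is_derive x v f ('D_v f x).
Proof. by move=> cf Ox; apply: derivableP; exact: smooth_on_derivable cf Ox. Qed.

End smooth_calculus.

(** * Differentiability and the chain rule on matrix spaces *)

Lemma differentiable_linear_estimate (R : realType) (V W : normedModType R)
    (f : V -> W) (df : {linear V -> W}) (x : V) : continuous df ->
  (forall e : R, 0 < e -> \forall w \near (0 : V), `|f (x + w) - f x - df w| <= e * `|w|) ->
  differentiable f x.
Proof.
move=> dfc Hf.
have H : f \o shift x = cst (f x) + df +o_ 0 id.
  apply/eqaddoP => e e0; rewrite near_simpl /=.
  near=> w.
  rewrite /= opprD -![(_ + _ : _ -> _) _]/(_ + _) -![(- _ : _ -> _) _]/(- _) /cst /= addrA.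
  by rewrite [w + x]addrC; near: w; exact: Hf.
have E := diff_unique dfc H.
by apply/diff_locallyP; rewrite E; split.
Unshelve. all: by end_near. Qed.

Section matrix_domain.
Context (R : realType) (p q : nat).
Local Notation mat := 'M[R]_(p, q).
Implicit Types (f g : mat -> R) (O : set mat) (w x : mat).

Lemma ler_mxentry w i j : `|w i j| <= `|w|.
Proof.
rewrite [leRHS]/Num.Def.normr/= mx_normrE.
exact: (le_bigmax _ (fun ij : 'I_p * 'I_q => `|w ij.1 ij.2|) (i, j)).
Qed.

Lemma mx_norm_le w (a : R) : 0 <= a -> (forall i j, `|w i j| <= a) -> `|w| <= a.
Proof.
by move=> a0 wa; rewrite /Num.Def.normr/= mx_normrE (bigmax_le _ a0).
Qed.

Lemma norm_delta_mx i j : `|delta_mx i j : mat| <= 1.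
Proof.
apply: mx_norm_le => // i' j'; rewrite mxE; case: (_ && _) => /=.
  by rewrite normr1.
by rewrite normr0.
Qed.

Definition entries : seq ('I_p * 'I_q) := enum {: 'I_p * 'I_q}.

Lemma matrix_sum_entries w :
  w = \sum_(ij <- entries) w ij.1 ij.2 *: delta_mx ij.1 ij.2.
Proof.
rewrite {1}[w]matrix_sum_delta /entries big_enum /= pair_bigA /=.
by apply: eq_bigr => -[].
Qed.

(** The entries in [s] are moved one at a time. Each move is an axis-parallel segment, where the
    mean value theorem and the continuity of one partial derivative apply. *)
Lemma increment_estimate f O x (s : seq ('I_p * 'I_q)) (e : R) :
  open O -> Ck_on O 1 f -> O x -> 0 < e ->
  exists2 d : R, 0 < d & forall w, `|w| < d ->
    `|f (x + \sum_(ij <- s) w ij.1 ij.2 *: delta_mx ij.1 ij.2) - f x -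
      \sum_(ij <- s) w ij.1 ij.2 * 'D_(delta_mx ij.1 ij.2) f x| <= e * `|w|.
Proof.
move=> oO cf Ox; elim: s e => [|[i j] s IH] e e0.
  exists 1 => // w _; rewrite !big_nil addr0 subrr subr0 normr0.
  by rewrite mulr_ge0// ltW.
have e2 : 0 < e / 2 by rewrite divr_gt0.
have [d d0 Hd] := IH _ e2.
(* Each entry of the list moves by at most [|w|], so the whole path stays within distance [N * |w|]
   of [x]. *)
set N : R := (size s).+1%:R.
have N0 : 0 < N by rewrite ltr0n.
have [r r0 Or] : exists2 r : R, 0 < r & forall y, `|y| < r -> O (x + y).
  have /nbhs_ballP[r /= r0 Hr] := open_nbhs_nbhs (conj oO Ox).
  exists r => // y yr; apply: Hr; rewrite -ball_normE /ball_ /=.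
  by rewrite opprD addNKr normrN.
pose D : mat -> R := 'D_(delta_mx i j) f.
have [r' r'0 Dr'] : exists2 r' : R, 0 < r' & forall y, `|y| < r' ->
    `|D (x + y) - D x| <= e / 2.
  have cD : {for x, continuous D}.
    exact: (Ck_on_continuous (Ck_on_D (delta_mx i j) cf) Ox).
  move/cvgrPdist_le : cD => /(_ _ e2) /nbhs_ballP[r' /= r'0 Hr].
  exists r' => // y yr; rewrite distrC; apply: Hr; rewrite -ball_normE /ball_ /=.
  by rewrite opprD addNKr normrN.
pose m := Num.min (Num.min r r') 1 / N.
exists (Num.min d m).
  by rewrite lt_min d0 divr_gt0// !lt_min r0 r'0 /=.
move=> w; rewrite lt_min => /andP[wd wm].
have wN : N * `|w| < Num.min r r'.
  move: wm; rewrite ltr_pdivlMr// mulrC => /lt_le_trans; apply.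
  by rewrite ge_min lexx.
rewrite !big_cons /=.
set S := \sum_(ij <- s) _ *: _; set T := \sum_(ij <- s) _ * _.
have Ssize : `|S| <= (size s)%:R * `|w|.
  rewrite /S; elim: (s) => [|ij s' IH'].
    by rewrite big_nil normr0 mul0r.
  rewrite big_cons (le_trans (ler_normD _ _))// -natr1 mulrDl mul1r addrC lerD//.
  rewrite normrZ -[leRHS]mulr1 ler_pM// ?ler_mxentry//.
  exact: norm_delta_mx.
have near_S (t : R) : 0 <= t <= 1 -> `|S + t *: (w i j *: delta_mx i j)| <= N * `|w|.
  move=> /andP[t0 t1]; rewrite (le_trans (ler_normD _ _))//.
  rewrite /N -natr1 mulrDl mul1r lerD// !normrZ ger0_norm//.
  rewrite -[leRHS]mul1r ler_pM// ?mulr_ge0//.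
  by rewrite -[leRHS]mulr1 ler_pM// ?ler_mxentry ?norm_delta_mx.
have Oin (t : R) : 0 <= t <= 1 -> O (x + S + t *: (w i j *: delta_mx i j)).
  move=> t01; rewrite -addrA; apply: Or; apply: le_lt_trans (near_S _ t01) _.
  by apply: lt_le_trans wN _; rewrite ge_min lexx.
have [|c c01] := @mvt_line R mat f (x + S) (w i j *: delta_mx i j).
  move=> t t01; apply: derivableZdir; apply: Ck_on_derivable cf _ _ _.
  exact: Oin.
rewrite deriveZdir; last by apply: Ck_on_derivable cf _ _ _; exact: Oin.
rewrite -/(D _) => Ef.
rewrite [_ *: _ + S]addrC addrA.
have -> : f (x + S + w i j *: delta_mx i j) - f x - (w i j * D x + T) =
  (f (x + S) - f x - T) +
  w i j * (D (x + S + c *: (w i j *: delta_mx i j)) - D x).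
  by rewrite mulrBr -Ef /=; ring.
rewrite (splitr e) mulrDl (le_trans (ler_normD _ _))// lerD ?Hd//.
rewrite normrM mulrC ler_pM ?ler_mxentry//.
rewrite -addrA; apply: Dr'; apply: le_lt_trans (near_S _ c01) _.
by apply: lt_le_trans wN _; rewrite ge_min lexx orbT.
Qed.

Lemma smooth_on_coord O i j : open O -> smooth_on O (fun w : mat => w i j).
Proof.
move=> oO.
have @c : {linear mat -> R}.
  by exists (fun N : mat => N i j); do 2![eexists]; do ?[constructor];
     rewrite ?mxE// => ? *; rewrite ?mxE//; move=> ?; rewrite !mxE.
rewrite (_ : (fun _ => _) = c) //.
by apply: smooth_on_linear => //; exact: coord_continuous.
Qed.

Lemma Ck1_differentiable O f x : open O -> Ck_on O 1 f -> O x -> differentiable f x.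
Proof.
move=> oO cf Ox.
pose df (w : mat) := \sum_(ij <- entries) w ij.1 ij.2 * 'D_(delta_mx ij.1 ij.2) f x.
have df_lin : linear df.
  move=> a u v; rewrite /df [in RHS]/GRing.scale /= mulr_sumr -big_split /=.
  by apply: eq_bigr => ij _; rewrite !mxE; ring.
pose dfL : {linear mat -> R} := HB.pack df (GRing.isLinear.Build _ _ _ _ _ df_lin).
have dfc : continuous dfL.
  move=> w; apply: (@smooth_on_continuous _ _ setT) => //.
  apply: smooth_on_sum => [|ij _]; first exact: openT.
  apply: smooth_onM; [exact: openT|exact: (smooth_on_coord _ _ openT)|].
  exact: (smooth_on_cst _ openT).
apply: (@differentiable_linear_estimate _ _ _ _ dfL) => // e e0.
have [d d0 Hd] := increment_estimate entries oO cf Ox e0.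
apply/nbhs_ballP; exists d => // w; rewrite -ball_normE /ball_ /= sub0r normrN => wd.
by have := Hd w wd; rewrite -matrix_sum_entries.
Qed.

End matrix_domain.

Section matrix_chain_rule.
Context (R : realType) (V : normedModType R) (p q : nat).
Local Notation mat := 'M[R]_(p, q).
Implicit Types (f : mat -> R) (Phi : V -> mat) (O : set mat).

Lemma continuous_entries Phi x :
  (forall i j, {for x, continuous (fun y => Phi y i j)}) -> {for x, continuous Phi}.
Proof.
move=> H; apply/cvgrPdist_le => /= e e0; near=> y.
apply: mx_norm_le (ltW e0) _ => i j.
rewrite !mxE.
have -> : `|Phi x i j - Phi y i j| = `|Phi x (i, j).1 (i, j).2 - Phi y (i, j).1 (i, j).2| by [].
move: (i, j); near: y; apply: filter_forall => -[{}i {}j] /=.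
exact: ((cvgrPdist_le _ _).1 (H i j)).
Unshelve. all: by end_near. Qed.

(** Only the curve [h |-> Phi (x + h v)] matters. It is not straight, hence Frechet
    differentiability of [f], while a directional derivative is all that is asked of [Phi]. *)
Lemma is_derive_comp_mx f Phi x v :
  differentiable f (Phi x) -> (forall i j, derivable (fun y => Phi y i j) x v) ->
  is_derive x v (f \o Phi)
    (\sum_(ij <- entries p q) 'D_(delta_mx ij.1 ij.2) f (Phi x) *
                             'D_v (fun y => Phi y ij.1 ij.2) x).
Proof.
move=> df dP.
have dPhi : derivable Phi x v by apply/derivable_mxP.
pose gam (h : R) : mat := Phi (h *: v + x).
have dgam : derivable gam 0 1 := (derivable1P Phi x v).1 dPhi.
have dgam' : differentiable gam 0 := (derivable1_diffP gam 0).1 dgam.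
have gam0 : gam 0 = Phi x by rewrite /gam scale0r add0r.
have df' : differentiable f (gam 0) by rewrite gam0.
have dfg : differentiable (f \o gam) 0 by exact: differentiable_comp.
have E : 'D_v (f \o Phi) x = 'D_1 (f \o gam) 0.
  rewrite /derive /=; congr (lim _); apply: (congr1 (fun F => F @ _)).
  by apply/funext => h /=; rewrite gam0 /gam [h *: 1]mulr1 addr0.
have E2 : 'D_1 gam 0 = 'D_v Phi x.
  rewrite /derive /=; congr (lim _); apply: (congr1 (fun F => F @ _)).
  by apply/funext => h /=; rewrite gam0 /gam [h *: 1]mulr1 addr0.
split.
  exact: ((derivable1P (f \o Phi) x v).2 ((derivable1_diffP (f \o gam) 0).2 dfg)).
have E3 : 'd gam 0 1 = 'D_v Phi x by rewrite -E2 deriveE.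
have E4 : 'D_1 (f \o gam) 0 = 'd (f \o gam) 0 1 by exact: deriveE.
rewrite E E4 (diff_comp dgam' df') /= E3 (derive_mx dPhi) gam0.
rewrite [X in 'd f (Phi x) X]matrix_sum_entries linear_sum /=.
apply: eq_bigr => ij _; rewrite linearZ /= mxE mulrC; congr (_ * _).
by rewrite (deriveE _ df).
Qed.

Lemma Ck_on_comp_mx (O' : set V) O f Phi k : open O -> open O' ->
  (forall x, O' x -> O (Phi x)) ->
  Ck_on O k f -> (forall i j, Ck_on O' k (fun y => Phi y i j)) ->
  Ck_on O' k (f \o Phi).
Proof.
move=> oO oO' PO.
have cont f' : (forall y, O y -> {for y, continuous f'}) ->
    (forall i j, Ck_on O' k (fun y => Phi y i j)) ->
    forall x, O' x -> {for x, continuous (f' \o Phi)}.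
  move=> cf cP x O'x; apply: continuous_comp; last exact: cf (PO _ O'x).
  by apply: continuous_entries => i j; exact: Ck_on_continuous (cP i j) _ O'x.
move=> cf cP; have {cont} cont : forall x, O' x -> {for x, continuous (f \o Phi)}.
  by apply: cont => //; exact: Ck_on_continuous cf.
elim: k f cf cP cont => [|k IH] f cf cP cont; first by split.
apply: (Ck_onS oO' cont) => v.
exists (fun x => \sum_(ij <- entries p q) 'D_(delta_mx ij.1 ij.2) f (Phi x) *
                             'D_v (fun y => Phi y ij.1 ij.2) x).
  move=> x O'x; apply: is_derive_comp_mx.
    apply: (@Ck1_differentiable _ _ _ O) => //; last exact: PO.
    by elim: (k) cf => // k' IHk /Ck_on_le.
  by move=> i j; exact: Ck_on_derivable (cP i j) _ _ O'x.
have Ck_sum (s : seq ('I_p * 'I_q)) (F : 'I_p * 'I_q -> V -> R) :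
    (forall ij, Ck_on O' k (F ij)) -> Ck_on O' k (fun x => \sum_(ij <- s) F ij x).
  move=> cF; elim: s => [|ij s IHs].
    apply: (@Ck_on_ext _ _ _ _ (fun=> 0)) => //; last exact: Ck_on_cst.
    by move=> x _; rewrite big_nil.
  apply: (@Ck_on_ext _ _ _ _ (fun x => F ij x + \sum_(ij <- s) F ij x)) => //.
    by move=> x _; rewrite big_cons.
  exact: Ck_onD.
apply: Ck_sum => -[i j] /=.
apply: Ck_onM => //; last exact: Ck_on_D.
have cP' : forall i j, Ck_on O' k (fun y => Phi y i j) by move=> *; exact: Ck_on_le.
apply: (IH ('D_(delta_mx i j) f : mat -> R)) => //; first exact: Ck_on_D.
move=> x O'x; apply: continuous_comp.
  by apply: continuous_entries => i' j'; exact: Ck_on_continuous (cP' i' j') _ O'x.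
exact: Ck_on_continuous (Ck_on_D _ cf) _ (PO _ O'x).
Qed.

Lemma smooth_on_comp_mx (O' : set V) O f Phi : open O -> open O' ->
  (forall x, O' x -> O (Phi x)) ->
  smooth_on O f -> (forall i j, smooth_on O' (fun y => Phi y i j)) ->
  smooth_on O' (f \o Phi).
Proof.
move=> oO oO' PO cf cP k; by apply: (Ck_on_comp_mx oO oO' PO (cf k)) => i j; exact: cP.
Qed.

End matrix_chain_rule.

(** * Symmetry of second derivatives *)

Section schwarz.
Context (R : realType) (V : normedModType R).

(** The mean value theorem is used twice: along [u] for [y |-> f (y + v) - f y], then along [v] for
    ['D_u f]. *)
Lemma second_difference (f : V -> R) (O : set V) x (u v : V) :
  Ck_on O 2 f -> (forall s t : R, 0 <= s <= 1 -> 0 <= t <= 1 -> O (x + s *: u + t *: v)) ->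
  exists s t : R, [/\ 0 <= s <= 1, 0 <= t <= 1 &
    f (x + u + v) - f (x + u) - f (x + v) + f x =
    'D_v ('D_u f : V -> R) (x + s *: u + t *: v)].
Proof.
move=> cf Ox.
have O1 (s : R) : 0 <= s <= 1 -> O (x + s *: u).
  by move=> s01; have := Ox s 0 s01; rewrite scale0r addr0 lexx ler01; apply.
have O2 (s : R) : 0 <= s <= 1 -> O (x + v + s *: u).
  by move=> s01; have := Ox s 1 s01; rewrite scale1r addrAC lexx ler01; apply.
pose g (y : V) := f (y + v) - f y.
have dshift y w : derivable f (y + v) w -> is_derive y w (fun y => f (y + v)) ('D_w f (y + v)).
  have E : (fun h : R => h^-1 *: (((fun y => f (y + v)) \o shift y) (h *: w) - f (y + v)))
     = (fun h => h^-1 *: ((f \o shift (y + v)) (h *: w) - f (y + v))).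
    by apply/funext => h /=; rewrite addrA.
  by move=> df; split; [rewrite /derivable E | rewrite /derive E].
have dg (s : R) : 0 <= s <= 1 ->
    is_derive (x + s *: u) u g ('D_u f (x + s *: u + v) - 'D_u f (x + s *: u)).
  move=> s01; apply: is_deriveB.
    by apply: dshift; apply: Ck_on_derivable cf _ _ _; rewrite addrAC; exact: O2.
  exact: Ck_on_derive cf (O1 _ s01).
have [|s s01 Es] := @mvt_line R V g x u.
  by move=> t /dg[].
have [|t t01 Et] := @mvt_line R V ('D_u f : V -> R) (x + s *: u) v.
  move=> t t01; apply: Ck_on_derivable (Ck_on_D u cf) _ _ _; exact: Ox.
exists s, t; split => //; rewrite -Et; have [_ <-] := dg s s01.
by rewrite -Es /g; ring.
Qed.

(** The second difference is symmetric in the two increments [a u] and [a v]. Both mixed derivatives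
    thus take a common value, at two points close to [x], and continuity concludes. *)
Lemma schwarz (f : V -> R) (O : set V) x (u v : V) : open O -> Ck_on O 2 f -> O x ->
  'D_v ('D_u f : V -> R) x = 'D_u ('D_v f : V -> R) x.
Proof.
move=> oO cf Ox.
suff H e : 0 < e -> `|'D_v ('D_u f : V -> R) x - 'D_u ('D_v f : V -> R) x| <= e + e.
  apply/eqP; rewrite -subr_eq0 -normr_le0; apply/ler_addgt0Pl => e e0.
  by rewrite addr0 (splitr e) H// divr_gt0.
move=> e0.
have c1 : {for x, continuous ('D_v ('D_u f : V -> R) : V -> R)}.
  exact: Ck_on_continuous (Ck_on_D v (Ck_on_D u cf)) _ Ox.
have c2 : {for x, continuous ('D_u ('D_v f : V -> R) : V -> R)}.
  exact: Ck_on_continuous (Ck_on_D u (Ck_on_D v cf)) _ Ox.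
move/cvgrPdist_le : c1 => /(_ _ e0) /nbhs_ballP[r1 /= r10 H1].
move/cvgrPdist_le : c2 => /(_ _ e0) /nbhs_ballP[r2 /= r20 H2].
have /nbhs_ballP[r3 /= r30 H3] := open_nbhs_nbhs (conj oO Ox).
pose r := Num.min r1 (Num.min r2 r3).
have r0 : 0 < r by rewrite !lt_min r10 r20.
pose N : R := `|u| + `|v| + 1.
have N0 : 0 < N by rewrite ltr_wpDl// addr_ge0.
pose a := r / N.
have a0 : 0 < a by rewrite divr_gt0.
have aE : a = r / N by [].
clearbody a.
have inb (s t : R) : 0 <= s <= 1 -> 0 <= t <= 1 ->
    `|s *: (a *: u) + t *: (a *: v)| < r.
  move=> /andP[s0 s1] /andP[t0 t1]; rewrite (le_lt_trans (ler_normD _ _))//.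
  rewrite !normrZ !(ger0_norm s0) !(ger0_norm t0) !(gtr0_norm a0).
  apply: (@le_lt_trans _ _ (a * (`|u| + `|v|))).
    by rewrite mulrDr lerD// -[leRHS]mul1r ler_wpM2r// mulr_ge0// ltW.
  rewrite aE mulrAC ltr_pdivrMr// ltr_pM2l// /N.
  by rewrite ltrDl.
have inb' rr (s t : R) : r <= rr -> 0 <= s <= 1 -> 0 <= t <= 1 ->
    ball x rr (x + s *: (a *: u) + t *: (a *: v)).
  move=> rrr s01 t01; rewrite -ball_normE /ball_ /= -addrA opprD addNKr normrN.
  exact: lt_le_trans (inb _ _ s01 t01) rrr.
have [r_1 r_2 r_3] : [/\ r <= r1, r <= r2 & r <= r3].
  by rewrite !ge_min !lexx !orbT.
have [|s [t [s01 t01 E1]]] := @second_difference f O x (a *: u) (a *: v) cf.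
  by move=> s t s01 t01; apply: H3; exact: inb'.
have [|t' [s' [t'01 s'01 E2]]] := @second_difference f O x (a *: v) (a *: u) cf.
  move=> s' t' s01' t01'; apply: H3; rewrite addrAC; exact: inb'.
have Dscale y u' v' : O y -> 'D_(a *: v') ('D_(a *: u') f : V -> R) y =
    a * a * 'D_v' ('D_u' f : V -> R) y.
  move=> Oy.
  rewrite (_ : 'D_(a *: v') _ y = 'D_(a *: v') (fun z => a * 'D_u' f z) y); last first.
    apply: near_eq_derive; apply: filterS (open_nbhs_nbhs (conj oO Oy)) => z Oz.
    by rewrite deriveZdir//; exact: Ck_on_derivable cf _ _ Oz.
  have dd : derivable ('D_u' f : V -> R) y v'.
    exact: Ck_on_derivable (Ck_on_D u' cf) _ _ Oy.
  rewrite deriveZdir; last first.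
    by apply: derivableM; [exact: derivable_cst|exact: dd].
  by rewrite -mulrA; congr (_ * _); rewrite deriveMl.
have Eq : 'D_v ('D_u f : V -> R) (x + s *: (a *: u) + t *: (a *: v)) =
          'D_u ('D_v f : V -> R) (x + s' *: (a *: u) + t' *: (a *: v)).
  apply: (@mulfI _ (a * a)); first by rewrite mulf_neq0// gt_eqF.
  have <- := Dscale _ u v (H3 _ (inb' _ _ _ r_3 s01 t01)).
  have O' : O (x + s' *: (a *: u) + t' *: (a *: v)).
    by apply: H3; exact: inb'.
  have <- := Dscale _ v u O'.
  rewrite -E1 [x + s' *: _ + _]addrAC -E2.
  by rewrite [x + a *: v + a *: u]addrAC; ring.
rewrite -(subrKA ('D_v ('D_u f : V -> R) (x + s *: (a *: u) + t *: (a *: v)))).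
apply: (le_trans (ler_normD _ _)); apply: lerD.
  by apply: H1; exact: inb'.
by rewrite Eq distrC; apply: H2; exact: inb'.
Qed.

End schwarz.

(** * Successive derivatives of the inverse, the square root and the bump function *)

Section real_functions.
Context (R : realType).

Lemma is_derive_inv (t : R) : t != 0 -> is_derive t (1 : R) (fun s : R => s^-1) (- t^-1 ^+ 2).
Proof.
move=> t0; have t0' : id t != 0 :> R by [].
have dt : derivable (@id R) t 1 by exact: derivable_id.
split; first exact: (derivableV t0' dt).
rewrite (deriveV t0' dt) derive_id /= -[LHS]/(_ * _) mulr1.
by rewrite exprVn.
Qed.

Lemma is_derive_invX (t : R) k : t != 0 ->
  is_derive t (1 : R) (fun s : R => s^-1 ^+ k) (- k%:R * t^-1 ^+ k.+1).
Proof.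
move=> t0; have H := is_derive_inv t0.
have := @is_deriveX _ _ (fun s : R => s^-1) k t 1 _ H.
rewrite fctE => H2; apply: (is_derive_eq H2).
rewrite -[LHS]/(_ * _) /=; case: k {H2} => [|k]; first by rewrite oppr0 !mul0r.
by rewrite /= !exprS; ring.
Qed.

Lemma is_derive_inv_iter i (t : R) : t != 0 ->
  is_derive t (1 : R) (fun s : R => (-1) ^+ i * i`!%:R * s^-1 ^+ i.+1)
    ((-1) ^+ i.+1 * i.+1`!%:R * t^-1 ^+ i.+2).
Proof.
move=> t0; have H := is_derive_invX i.+1 t0.
have := @is_deriveZ _ _ _ _ ((-1) ^+ i * i`!%:R : R) _ _ _ H.
move=> H2; apply: (is_derive_eq H2).
rewrite -[LHS]/(_ * _) factS natrM !exprS; ring.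
Qed.

(** The falling factorial [1/2 (1/2 - 1) ... (1/2 - i + 1)]: the derivative of order [i] of the
    square root is this coefficient times [sqrt t / t ^ i]. *)
Fixpoint sqrt_coef i : R := if i is j.+1 then sqrt_coef j * (2^-1 - j%:R) else 1.

Lemma is_derive_sqrt_iter i (t : R) : 0 < t ->
  is_derive t (1 : R) (fun s : R => sqrt_coef i * (Num.sqrt s * s^-1 ^+ i))
    (sqrt_coef i.+1 * (Num.sqrt t * t^-1 ^+ i.+1)).
Proof.
move=> t0; have t0' : t != 0 by rewrite gt_eqF.
have H1 := is_derive_invX i t0'.
have H2 := is_derive1_sqrt t0.
have H3 := @is_deriveM _ _ _ _ _ _ _ _ H2 H1.
have H4 := @is_deriveZ _ _ _ _ (sqrt_coef i : R) _ _ _ H3.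
apply: (is_derive_eq H4).
rewrite -[LHS]/(_ * (_ * _ + _ * _)) /=.
have s0 : Num.sqrt t != 0 by rewrite sqrtr_eq0 -ltNge.
have Et : t^-1 = (Num.sqrt t)^-1 ^+ 2 by rewrite -[in LHS](sqr_sqrtr (ltW t0)) exprVn.
rewrite -mulrA; congr (_ * _); rewrite exprS.
set T := t^-1 ^+ i; clearbody T.
rewrite Et; set r := Num.sqrt t in s0 *; clearbody r.
by field.
Qed.

(** Differentiating [p (1/t) exp (- 1/t)] gives [q (1/t) exp (- 1/t)] with [q = X^2 (p - p')]. So
    [bump i] is the derivative of order [i] of the flat function [exp (- 1/t)], extended by 0. *)
Fixpoint bump_poly i : {poly R} :=
  if i is j.+1 then 'X^2 * (bump_poly j - (bump_poly j)^`()) else 1.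

Definition bump i (t : R) : R :=
  if 0 < t then (bump_poly i).[t^-1] * expR (- t^-1) else 0.

Lemma bump_gt0 (t : R) : 0 < t -> 0 < bump 0 t.
Proof. by move=> t0; rewrite /bump t0 /= hornerC mul1r expR_gt0. Qed.

Lemma bump_le0 (t : R) : t <= 0 -> bump 0 t = 0.
Proof. by rewrite /bump leNgt => /negbTE ->. Qed.

(** With [s = 1/t], the extra factor [s ^+ 2] bounds [bump i t] by a multiple of [t ^+ 2], which
    makes its derivative at 0 vanish. *)
Lemma exp_dominates_poly (p : {poly R}) :
  exists2 C : R, 0 <= C & forall s : R, 0 <= s -> `|p.[s]| * s ^+ 2 <= C * expR s.
Proof.
exists (\sum_(i < size p) `|p`_i| * (i.+2)`!%:R).
  by apply: sumr_ge0 => i _; rewrite mulr_ge0.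
move=> s s0; rewrite horner_coef mulr_suml.
rewrite (le_trans (ler_wpM2r (exprn_ge0 _ s0) (ler_norm_sum _ _ _)))// mulr_suml.
apply: ler_sum => i _; rewrite normrM -!mulrA ler_wpM2l// normrX ger0_norm// -exprD addn2.
have := expR_ge1Dxn i.+1 s0.
rewrite -ler_pdivrMl ?ltr0n ?fact_gt0// mulrC; apply: le_trans.
by rewrite lerDr.
Qed.

Lemma is_derive0_quadratic (f : R -> R) (C : R) : f 0 = 0 -> 
  (forall h : R, `|h| <= 1 -> `|f h| <= C * h ^+ 2) -> is_derive (0 : R) (1 : R) f 0.
Proof.
move=> f0 fC.
have C0 : 0 <= C.
  have := fC 1; rewrite normr1 lexx expr1n mulr1 => /(_ isT); exact: le_trans.
have H : (fun h : R => h^-1 *: ((f \o shift 0) (h *: 1) - f 0)) @ (0 : R)^' --> (0 : R).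
  apply/cvgrPdist_le => e e0; near=> h.
  have h0 : h != 0 by near: h; exact: nbhs_dnbhs_neq.
  rewrite sub0r normrN /= f0 subr0 addr0 -[_ *: _]/(_ * _) -[h%:A]/(h * 1) mulr1.
  have h1 : `|h| <= 1 by near: h; apply: dnbhs0_le.
  rewrite normrM normfV ler_pdivrMl ?normr_gt0//.
  rewrite (le_trans (fC _ h1))// -real_normK ?num_real// expr2 mulrA mulrC.
  rewrite ler_wpM2l//.
  have he : `|h| <= e / (C + 1).
    by near: h; apply: dnbhs0_le; rewrite divr_gt0// ltr_wpDl.
  rewrite (le_trans (ler_wpM2l C0 he))// mulrCA ger_pMr//.
  by rewrite ler_pdivrMr ?mul1r ?lerDl// ltr_wpDl.
by split; [apply/cvg_ex; exists 0|apply/cvg_lim].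
Unshelve. all: by end_near. Qed.

Lemma is_derive_bump i (t : R) : is_derive t (1 : R) (bump i) (bump i.+1 t).
Proof.
have [t0|t0|t0] := ltgtP t 0.
- have -> : bump i.+1 t = 0 by rewrite /bump ltNge (ltW t0).
  apply: (@near_eq_is_derive R R R (cst (0 : R)) (bump i) t 1 0).
  near=> s; rewrite /bump ltNge.
  have s0 : s < 0 by near: s; exact: lt_nbhsl.
  by rewrite ltW.
- have tn0 : t != 0 by rewrite gt_eqF.
  apply: (@near_eq_is_derive R R R ((horner (bump_poly i) \o (fun s : R => s^-1)) *
      (expR \o (fun s : R => - s^-1))) (bump i) t 1).
    near=> s; rewrite /bump.
    have s0 : 0 < s by near: s; exact: lt_nbhsr.
    by rewrite s0.
  have H1 := is_derive_inv tn0.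
  have H2 := @is_derive1_comp R _ _ _ _ _ (is_derive_poly (bump_poly i) t^-1) H1.
  have H3 : is_derive t (1 : R) (fun s : R => - s^-1) (- - t^-1 ^+ 2).
    exact: is_deriveN.
  have H4 := @is_derive1_comp R expR (fun s : R => - s^-1) t _ _ (is_derive_expR (- t^-1)) H3.
  have H5 := @is_deriveM _ _ _ _ _ _ _ _ H2 H4.
  apply: (is_derive_eq H5).
  rewrite -[LHS]/(_ * _ + _ * _) /= /bump t0 /= !hornerE /=.
  rewrite !expr2; ring.
- rewrite t0; have -> : bump i.+1 0 = 0 by rewrite /bump ltxx.
  have [C C0 HC] := exp_dominates_poly (bump_poly i).
  apply: (@is_derive0_quadratic _ C); first by rewrite /bump ltxx.
  move=> h h1; rewrite /bump; case: ifP => h0; last first.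
    by rewrite normr0 mulr_ge0// sqr_ge0.
  have /HC : 0 <= h^-1 by rewrite invr_ge0 ltW.
  rewrite exprVn ler_pdivrMr ?exprn_gt0// => H.
  rewrite expRN normrM [X in _ * X]ger0_norm ?invr_ge0 ?expR_ge0//.
  by rewrite ler_pdivrMr ?expR_gt0// mulrAC.
Unshelve. all: by end_near. Qed.

End real_functions.

Section smooth_calculus_more.
Context (R : realType) (V : normedModType R).
Implicit Types (f g : V -> R) (O : set V).

Lemma smooth_onV O f : open O -> (forall x, O x -> f x != 0) -> smooth_on O f ->
  smooth_on O (fun x => (f x)^-1).
Proof.
move=> oO f0 cf.
have := smooth_on_comp1 oO (fun i t => @is_derive_inv_iter R i t) f0 cf.
by apply: smooth_on_ext => // x _; rewrite expr0 fact0 !mul1r expr1.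
Qed.

Lemma smooth_on_sqrt O f : open O -> (forall x, O x -> 0 < f x) -> smooth_on O f ->
  smooth_on O (fun x => Num.sqrt (f x)).
Proof.
move=> oO f0 cf.
have := smooth_on_comp1 oO (fun i t => @is_derive_sqrt_iter R i t) f0 cf.
by apply: smooth_on_ext => // x _; rewrite /= mul1r expr0 mulr1.
Qed.

Lemma smooth_on_bump O f : open O -> smooth_on O f -> smooth_on O (fun x => bump 0 (f x)).
Proof.
move=> oO cf.
exact: (@smooth_on_comp1 _ _ _ (@bump R) setT f oO (fun i t _ => @is_derive_bump R i t) (fun _ _ => I) cf).
Qed.

End smooth_calculus_more.

(** * Convex bodies and support functions *)

Section euclid.
Context (R : realType) (n : nat).
Local Notation vec := 'rV[R]_n.
Implicit Types (x y z : vec) (a t : R).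

Lemma dotpC x y : dotp x y = dotp y x.
Proof. by apply: eq_bigr => i _; rewrite mulrC. Qed.

Lemma dotpDl x y z : dotp (x + y) z = dotp x z + dotp y z.
Proof. by rewrite /dotp -big_split; apply: eq_bigr => i _; rewrite mxE mulrDl. Qed.

Lemma dotpDr x y z : dotp x (y + z) = dotp x y + dotp x z.
Proof. by rewrite dotpC dotpDl !(dotpC x). Qed.

Lemma dotpZl a x y : dotp (a *: x) y = a * dotp x y.
Proof. by rewrite /dotp mulr_sumr; apply: eq_bigr => i _; rewrite mxE mulrA. Qed.

Lemma dotpZr a x y : dotp x (a *: y) = a * dotp x y.
Proof. by rewrite dotpC dotpZl dotpC. Qed.

Lemma dotpNl x y : dotp (- x) y = - dotp x y.
Proof. by rewrite -scaleN1r dotpZl mulN1r. Qed.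

Lemma dotpNr x y : dotp x (- y) = - dotp x y.
Proof. by rewrite dotpC dotpNl dotpC. Qed.

Lemma dotpBl x y z : dotp (x - y) z = dotp x z - dotp y z.
Proof. by rewrite dotpDl dotpNl. Qed.

Lemma dotpBr x y z : dotp x (y - z) = dotp x y - dotp x z.
Proof. by rewrite dotpDr dotpNr. Qed.

Lemma dotp0l x : dotp 0 x = 0.
Proof. by rewrite -(scale0r x) dotpZl mul0r. Qed.

Lemma dotp0r x : dotp x 0 = 0.
Proof. by rewrite dotpC dotp0l. Qed.

Lemma dotp_ge0 x : 0 <= dotp x x.
Proof. by apply: sumr_ge0 => i _; rewrite -expr2 sqr_ge0. Qed.

Lemma dotp_eq0 x : dotp x x = 0 -> x = 0.
Proof.
move/eqP; rewrite psumr_eq0 => [/allP H|i _]; last by rewrite -expr2 sqr_ge0.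
apply/rowP => i; rewrite mxE; apply/eqP.
by have := H i (mem_index_enum i); rewrite -expr2 sqrf_eq0.
Qed.

Lemma dotp_delta x i : dotp (delta_mx 0 i) x = x 0 i.
Proof.
rewrite /dotp (bigD1 i) //= mxE !eqxx mul1r big1 ?addr0// => j ji.
by rewrite mxE (negbTE ji) andbF mul0r.
Qed.

Lemma dotp_subZ x y t :
  dotp (x - t *: y) (x - t *: y) = dotp x x - 2 * t * dotp x y + t ^+ 2 * dotp y y.
Proof. by rewrite dotpBl !dotpBr !dotpZl !dotpZr (dotpC y x); ring. Qed.

Lemma enorm_ge0 x : 0 <= enorm x.
Proof. exact: sqrtr_ge0. Qed.

Lemma enorm_sqr x : enorm x ^+ 2 = dotp x x.
Proof. by rewrite sqr_sqrtr // dotp_ge0. Qed.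

Lemma enorm0 : enorm (0 : vec) = 0.
Proof. by rewrite /enorm dotp0l sqrtr0. Qed.

Lemma enorm_eq0 x : (enorm x == 0) = (x == 0).
Proof.
apply/eqP/eqP => [x0|->]; last exact: enorm0.
by apply: dotp_eq0; rewrite -enorm_sqr x0 expr0n.
Qed.

Lemma enorm_gt0 x : (0 < enorm x) = (x != 0).
Proof. by rewrite lt_def enorm_ge0 enorm_eq0 andbT. Qed.

Lemma enormZ a x : enorm (a *: x) = `|a| * enorm x.
Proof.
by rewrite /enorm dotpZl dotpZr mulrA -expr2 sqrtrM ?sqr_ge0// sqrtr_sqr.
Qed.

Lemma enormN x : enorm (- x) = enorm x.
Proof. by rewrite -scaleN1r enormZ normrN1 mul1r. Qed.

Lemma enormB x y : enorm (x - y) = enorm (y - x).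
Proof. by rewrite -enormN opprB. Qed.

Lemma cauchy_schwarz x y : dotp x y <= enorm x * enorm y.
Proof.
have [->|x0] := eqVneq x 0; first by rewrite dotp0l enorm0 mul0r.
have [->|y0] := eqVneq y 0; first by rewrite dotp0r enorm0 mulr0.
have nx : 0 < enorm x by rewrite enorm_gt0.
have ny : 0 < enorm y by rewrite enorm_gt0.
have := dotp_ge0 (enorm y *: x - enorm x *: y).
rewrite dotpBl !dotpBr !dotpZl !dotpZr -!enorm_sqr (dotpC y x).
set p := dotp x y; set a := enorm x; set b := enorm y.
rewrite (_ : b * (b * a ^+ 2) - b * (a * p) - (a * (b * p) - a * (a * b ^+ 2)) =
  (a * b * 2) * (a * b - p)); last by ring.
by rewrite pmulr_rge0 ?subr_ge0// !mulr_gt0.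
Qed.

Lemma normr_dotp x y : `|dotp x y| <= enorm x * enorm y.
Proof.
rewrite ler_norml cauchy_schwarz andbT lerNl -dotpNl -(enormN x).
exact: cauchy_schwarz.
Qed.

Lemma enormD x y : enorm (x + y) <= enorm x + enorm y.
Proof.
rewrite -ler_sqr ?nnegrE ?addr_ge0 ?enorm_ge0// enorm_sqr dotpDl !dotpDr.
rewrite -!enorm_sqr (dotpC y x) sqrrD.
have := cauchy_schwarz x y; set p := dotp x y; lra.
Qed.

Lemma enorm_triB x y : `|enorm x - enorm y| <= enorm (x - y).
Proof.
have := enormD (x - y) y; rewrite subrK => H1.
have := enormD (y - x) x; rewrite subrK enormB => H2.
by rewrite ler_norml; apply/andP; split; lra.
Qed.

Lemma ler_entry_enorm x i : `|x 0 i| <= enorm x.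
Proof.
rewrite -dotp_delta (le_trans (normr_dotp _ _))// /enorm dotp_delta mxE !eqxx.
by rewrite sqrtr1 mul1r.
Qed.

Lemma ler_norm_enorm x : `|x| <= enorm x.
Proof.
apply: mx_norm_le (enorm_ge0 x) _ => i j; rewrite ord1; exact: ler_entry_enorm.
Qed.

Lemma ler_enorm_norm x : enorm x <= n%:R * `|x|.
Proof.
rewrite {1}[x]matrix_sum_delta big_ord1.
have -> : n%:R * `|x| = \sum_(j < n) `|x| by rewrite big_const_ord iter_addr_0 mulr_natl.
elim/big_ind2 : _ => [|u a v b ua vb|j _]; first by rewrite enorm0.
  by rewrite (le_trans (enormD _ _))// lerD.
rewrite enormZ /enorm dotp_delta mxE !eqxx sqrtr1 mulr1; exact: ler_mxentry.
Qed.

Lemma smooth_dotp p O : open O -> smooth_on O (fun x => dotp p x).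
Proof.
move=> oO; apply: smooth_on_sum => // i _; apply: smooth_onZ => //.
exact: smooth_on_coord.
Qed.

Lemma smooth_dotpxx O : open O -> smooth_on O (fun x => dotp x x).
Proof.
by move=> oO; apply: smooth_on_sum => // i _; apply: smooth_onM => //; exact: smooth_on_coord.
Qed.

Lemma dotp_continuous p : continuous (fun x => dotp p x).
Proof. by move=> x; exact: (smooth_on_continuous (smooth_dotp p openT)). Qed.

Lemma enorm_continuous : continuous (@enorm R n).
Proof.
move=> x; apply: continuous_comp; last exact: sqrt_continuous.
exact: (smooth_on_continuous (smooth_dotpxx openT)).
Qed.

Lemma open_neq0 : open [set x : vec | x != 0].
Proof.
have -> : [set x : vec | x != 0] = (@enorm R n) @^-1` [set t : R | 0 < t].
  by apply/seteqP; split => x /=; rewrite enorm_gt0.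
by apply: open_comp => [x _|]; [exact: enorm_continuous|exact: open_gt].
Qed.

Lemma smooth_enorm : smooth_on [set x : vec | x != 0] (@enorm R n).
Proof.
apply: smooth_on_sqrt; [exact: open_neq0| |exact: smooth_dotpxx open_neq0].
by move=> x /=; rewrite -enorm_gt0 sqrtr_gt0.
Qed.

Lemma compact_enorm_le (A : set vec) (M : R) :
  closed A -> (forall x, A x -> enorm x <= M) -> compact A.
Proof.
move=> cA AM; apply: bounded_closed_compact => //.
exists M; split; first exact: num_real.
move=> t Mt x Ax /=; rewrite (le_trans (ler_norm_enorm x))//.
by rewrite (le_trans (AM _ Ax))// ltW.
Qed.

Lemma closed_usphere : closed (@usphere R n).
Proof.
rewrite (_ : @usphere R n = (@enorm R n) @^-1` [set 1])//.
by apply: preimage_closed => [x _|]; [exact: enorm_continuous|exact: closed_eq].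
Qed.

Lemma compact_usphere : compact (@usphere R n).
Proof.
by apply: (compact_enorm_le (M := 1)); [exact: closed_usphere|move=> x ->].
Qed.

End euclid.

Section convex_bodies.
Context (R : realType) (n : nat).
Local Notation vec := 'rV[R]_n.
Local Notation body := (convex_body R n).
Implicit Types (x y z : vec) (t : R) (K L : body).

Lemma support_max K y : exists2 x, body_set K x &
  support_fun K y = dotp y x /\ forall z, body_set K z -> dotp y z <= support_fun K y.
Proof.
have [|||c cK cmax] := @compact_EVT_max _ _ (fun x : vec => dotp y x) (body_set K).
- exact: body_neq0.
- exact: body_compact.
- by apply: continuous_subspaceT => z; exact: dotp_continuous.
rewrite inE in cK.
have E : support_fun K y = dotp y c.
  apply/eqP; rewrite eq_le; apply/andP; split.
    apply: ge_sup; first by exists (dotp y c), c.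
    by move=> _ [z Kz <-]; apply: cmax; rewrite inE.
  apply: ub_le_sup; last by exists c.
  by exists (dotp y c) => _ [z Kz <-]; apply: cmax; rewrite inE.
by exists c => //; split => // z Kz; rewrite E; apply: cmax; rewrite inE.
Qed.

Lemma le_support K x y : body_set K x -> dotp y x <= support_fun K y.
Proof. by move=> Kx; have [_ _ [_]] := support_max K y; apply. Qed.

Lemma support_le K y t : (forall x, body_set K x -> dotp y x <= t) -> support_fun K y <= t.
Proof. by move=> H; have [x Kx [-> _]] := support_max K y; exact: H. Qed.

Definition sublinear (h : vec -> R) :=
  (forall x y, h (x + y) <= h x + h y) /\ (forall t x, 0 <= t -> h (t *: x) = t * h x).

Lemma support_sublinear K : sublinear (support_fun K).
Proof.
split=> [x y|t x t0].
  by apply: support_le => z Kz; rewrite dotpDl lerD// le_support.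
apply/eqP; rewrite eq_le; apply/andP; split.
  by apply: support_le => z Kz; rewrite dotpZl ler_wpM2l// le_support.
have [z Kz [-> _]] := support_max K x; rewrite -dotpZl; exact: le_support.
Qed.

Lemma support0 K : support_fun K 0 = 0.
Proof.
by have [_ /(_ 0 0 (lexx _))] := support_sublinear K; rewrite scale0r mul0r.
Qed.

(** The normal is [x - z], where [z] is the point of [K] nearest to [x]: moving from [z] towards
    another point of [K] cannot decrease the distance to [x]. *)
Lemma body_separation K x : ~ body_set K x -> exists y, support_fun K y < dotp y x.
Proof.
move=> nKx.
have [|||z zK zmin] := @compact_EVT_min _ _ (fun z : vec => enorm (x - z)) (body_set K).
- exact: body_neq0.
- exact: body_compact.
- apply: continuous_subspaceT => z; apply: continuous_comp; last exact: enorm_continuous.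
  by apply: continuousB; [exact: cst_continuous|].
rewrite inE in zK.
pose y := x - z; have y0 : y != 0.
  by apply/eqP => /subr0_eq xz; apply: nKx; rewrite xz.
exists y; suff H w : body_set K w -> dotp y (w - z) <= 0.
  apply: (@le_lt_trans _ _ (dotp y z)).
    by apply: support_le => w /H; rewrite dotpBr subr_le0.
  by rewrite -subr_gt0 -dotpBr -/y -enorm_sqr exprn_gt0// enorm_gt0.
move=> Kw; rewrite leNgt; apply/negP => p0.
set p := dotp y (w - z) in p0.
set q := dotp (w - z) (w - z).
have q0 : 0 <= q := dotp_ge0 _.
have key t : 0 <= t -> t <= 1 -> 2 * t * p <= t ^+ 2 * q.
  move=> t0 t1.
  have Kt : body_set K (t *: w + (1 - t) *: z).
    by have /convex_rVP := @body_convex _ _ K; apply.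
  have := zmin (t *: w + (1 - t) *: z); rewrite inE => /(_ Kt).
  rewrite -ler_sqr ?nnegrE ?enorm_ge0// !enorm_sqr.
  have -> : x - (t *: w + (1 - t) *: z) = y - t *: (w - z).
    by apply/rowP => i; rewrite /y !mxE; ring.
  by rewrite dotp_subZ -/p -/q; lra.
(* With this [t], [t * q < p], against [key]; the summand 1 keeps the denominator positive. *)
pose t := Num.min 1 (p / (q + 1)).
have t0 : 0 < t by rewrite lt_min ltr01 divr_gt0// ltr_wpDl.
have t1 : t <= 1 by rewrite ge_min lexx.
have t2 : t * (q + 1) <= p.
  by rewrite -ler_pdivlMr ?ltr_wpDl// ge_min lexx orbT.
have := key t (ltW t0) t1.
have := ler_wpM2l (ltW t0) t2; have := mulr_gt0 t0 p0; have := mulr_gt0 t0 t0.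
by rewrite expr2; lra.
Qed.

Lemma support_subset K L : (forall y, support_fun K y <= support_fun L y) ->
  body_set K `<=` body_set L.
Proof.
move=> KL x Kx; apply: contrapT => /body_separation[y].
by rewrite ltNge (le_trans (le_support y Kx))// KL.
Qed.

Lemma support_mem K x : (forall y, dotp y x <= support_fun K y) -> body_set K x.
Proof.
move=> H; apply: contrapT => /body_separation[y].
by rewrite ltNge H.
Qed.

Lemma support_inj K L : support_fun K =1 support_fun L -> K = L.
Proof.
move=> KL; apply: convex_body_eq; apply/seteqP; split.
  by apply: support_subset => y; rewrite KL.
by apply: support_subset => y; rewrite KL.
Qed.

Lemma support_body_add K L y :
  support_fun (body_add K L) y = support_fun K y + support_fun L y.
Proof.
apply/eqP; rewrite eq_le; apply/andP; split.
  by apply: support_le => _ [a [b [Ka Lb ->]]]; rewrite dotpDr lerD// le_support.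
have [a Ka [-> _]] := support_max K y; have [b Lb [-> _]] := support_max L y.
by rewrite -dotpDr; apply: le_support; exists a, b.
Qed.

Lemma support_body_scale t K y : 0 <= t ->
  support_fun (body_scale t K) y = t * support_fun K y.
Proof.
move=> t0; apply/eqP; rewrite eq_le; apply/andP; split.
  by apply: support_le => _ [a Ka <-]; rewrite dotpZr ler_wpM2l// le_support.
have [a Ka [-> _]] := support_max K y.
by rewrite -dotpZr; apply: le_support; exists a.
Qed.

Lemma support_point x y : support_fun (point_body x) y = dotp y x.
Proof. by have [z /= -> []] := support_max (point_body x) y. Qed.

Lemma support_bound K : exists2 M : R, 0 <= M &
  forall y, `|support_fun K y| <= M * enorm y.
Proof.
have [|||c cK cmax] := @compact_EVT_max _ _ (@enorm R n) (body_set K).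
- exact: body_neq0.
- exact: body_compact.
- by apply: continuous_subspaceT => z; exact: enorm_continuous.
exists (enorm c); first exact: enorm_ge0.
move=> y; have [x Kx [-> _]] := support_max K y.
rewrite (le_trans (normr_dotp _ _))// mulrC ler_wpM2r ?enorm_ge0//.
by apply: cmax; rewrite inE.
Qed.

Lemma support_lipschitz K (M : R) : (forall y, `|support_fun K y| <= M * enorm y) ->
  forall x y, `|support_fun K x - support_fun K y| <= M * enorm (x - y).
Proof.
move=> HM; have [hD _] := support_sublinear K.
have H x y : support_fun K x - support_fun K y <= M * enorm (x - y).
  have := hD (x - y) y; rewrite subrK => h1.
  have /ler_normlP[_ h2] := HM (x - y); lra.
move=> x y; rewrite ler_norml H andbT lerNl opprB enormB; exact: H.
Qed.

Lemma sublinear0 h : sublinear h -> h 0 = 0.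
Proof. by move=> [_ /(_ 0 0 (lexx _))]; rewrite scale0r mul0r. Qed.

Lemma sublinearN h x : sublinear h -> - h (- x) <= h x.
Proof.
move=> hs; have [hD _] := hs; have := hD x (- x).
by rewrite subrr (sublinear0 hs) -lerBlDr sub0r.
Qed.

Definition linear_along (h : vec -> R) v := h (- v) = - h v.

(** One step of the Hahn-Banach theorem. The function [g x], the infimum over [t >= 0] of
    [h (x + t v) - t h v], is the one-sided derivative of [h] at [v] in the direction [x]; if [h] is
    the support function of a body, [g] is that of its face with normal [v]. Taking [t = 1] at [- v]
    gives linearity along [v]. *)
Lemma sublinear_straighten h v : sublinear h ->
  exists g, [/\ sublinear g, forall x, g x <= h x,
    linear_along g v, g v = h v & forall w, linear_along h w -> linear_along g w].
Proof.
move=> hs; have [hD hZ] := hs.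
pose S x := [set r | exists2 t, 0 <= t & r = h (x + t *: v) - t * h v].
have Slb x : lbound (S x) (- h (- x)).
  move=> _ [t t0 ->]; rewrite lerBrDl lerBlDr -hZ//.
  by have := hD (x + t *: v) (- x); rewrite addrAC subrr add0r.
have S0 x : S x !=set0.
  by exists (h (x + 0 *: v) - 0 * h v), 0.
have Sinf x : has_inf (S x) by split => //; exists (- h (- x)); exact: Slb.
pose g x := inf (S x).
have gS x t : 0 <= t -> g x <= h (x + t *: v) - t * h v.
  by move=> t0; apply: ge_inf; [exists (- h (- x)); exact: Slb|exists t].
have gh x : g x <= h x.
  by have := gS x 0 (lexx _); rewrite scale0r addr0 mul0r subr0.
have g_ge x r : (forall t, 0 <= t -> r <= h (x + t *: v) - t * h v) -> r <= g x.
  by move=> H; apply: lb_le_inf => // _ [t t0 ->]; exact: H.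
have g0 : g 0 = 0.
  apply/eqP; rewrite eq_le -{1}(sublinear0 hs) gh /= g_ge// => t t0.
  by rewrite add0r hZ// subrr.
have gD x y : g (x + y) <= g x + g y.
  rewrite -lerBlDr; apply: (g_ge) => s s0.
  rewrite lerBlDr -lerBlDl; apply: (g_ge) => t t0.
  rewrite lerBlDl (le_trans (gS _ (s + t) (addr_ge0 s0 t0)))//.
  have := hD (x + s *: v) (y + t *: v).
  rewrite scalerDl addrACA mulrDl; lra.
have gZ t x : 0 <= t -> g (t *: x) = t * g x.
  rewrite le_eqVlt => /orP[/eqP <-|t0]; first by rewrite scale0r mul0r.
  have H s z : 0 < s -> s * g z <= g (s *: z).
    move=> s0; apply: (g_ge) => r r0.
    have r0' : 0 <= r / s by rewrite divr_ge0// ltW.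
    have E : h (s *: z + r *: v) = s * h (z + (r / s) *: v).
      by rewrite -hZ ?(ltW s0)// scalerDr scalerA mulrCA mulfV ?gt_eqF// mulr1.
    have := ler_wpM2l (ltW s0) (gS z _ r0').
    by rewrite E mulrBr mulrA [s * (r / s)]mulrC divfK ?gt_eqF.
  apply/eqP; rewrite eq_le H// andbT.
  rewrite -(ler_pM2l (_ : 0 < t^-1)) ?invr_gt0//.
  rewrite mulrA mulVf ?gt_eqF// mul1r.
  have := H t^-1 (t *: x); rewrite invr_gt0 scalerA mulVf ?gt_eqF// scale1r.
  exact.
have gs : sublinear g by [].
have lin w : g w <= h w -> g (- w) <= - h w -> linear_along g w /\ g w = h w.
  move=> h1 h2; have := sublinearN w gs => h3.
  have e1 : g w = h w by lra.
  by split=> //; rewrite /linear_along; lra.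
have gNv : g (- v) <= - h v.
  by have := gS (- v) 1 ler01; rewrite scale1r addNr (sublinear0 hs) mul1r sub0r.
have [lv ev] := lin v (gh v) gNv.
exists g; split => // w lw.
by have [] := lin w (gh w); rewrite -?lw.
Qed.

(** Straightening along [v] fixes the value [h v]; straightening then along each basis vector keeps
    the linearity already obtained, and the result is a linear function, represented by [x]. *)
Lemma sublinear_dominates_linear h v : sublinear h ->
  exists2 x, (forall y, dotp y x <= h y) & dotp v x = h v.
Proof.
move=> hs.
have [g [gs gh gl gv]] : exists g, [/\ sublinear g, forall x, g x <= h x,
    (forall i, i \in enum 'I_n -> linear_along g (delta_mx 0 i)) & 
    linear_along g v /\ g v = h v].
  elim: (enum 'I_n) => [|i s [g [gs gh gl [lv gv]]]].
    have [g [gs gh lv gv _]] := sublinear_straighten v hs.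
    by exists g; split.
  have [k [ks kg li _ kl]] := sublinear_straighten (delta_mx 0 i) gs.
  exists k; split => //.
  - by move=> x; exact: le_trans (kg x) (gh x).
  - by move=> j; rewrite inE => /orP[/eqP ->//|/gl/kl].
  - have lkv := kl _ lv; split=> //.
    have := kg v; have := kg (- v); rewrite lv lkv lerN2 -gv => a b.
    by apply/eqP; rewrite eq_le a b.
case: gv => lv gv; have [gD gZ] := gs.
pose x : vec := \row_i g (delta_mx 0 i).
have glin a i : g (a *: delta_mx 0 i) = a * g (delta_mx 0 i).
  have [a0|a0] := leP 0 a; first exact: gZ.
  rewrite -{1}[a]opprK scaleNr -scalerN gZ ?oppr_ge0 ?ltW//.
  by rewrite (gl i) ?mem_enum// mulrNN.
have gx y : g y <= dotp y x.
  rewrite {1}[y]matrix_sum_delta big_ord1 /dotp.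
  elim/big_ind2 : _ => [|u a w b ua wb|j _]; first by rewrite (sublinear0 gs).
    by rewrite (le_trans (gD _ _))// lerD.
  by rewrite glin mxE.
have gE y : dotp y x = g y.
  apply/eqP; rewrite eq_le gx andbT.
  have := gx (- y); rewrite dotpNl => h1; have := sublinearN y gs; lra.
by exists x => [y|]; rewrite gE.
Qed.

Lemma sublinear_body h : sublinear h -> exists K : body, support_fun K =1 h.
Proof.
move=> hs; pose A := [set x : vec | forall y, dotp y x <= h y].
have A0 : A !=set0.
  by have [x Ax _] := sublinear_dominates_linear 0 hs; exists x.
have cA : closed A.
  have -> : A = \bigcap_(y in [set: vec]) [set x | dotp y x <= h y].
    by apply/seteqP; split => [x Ax y _|x Ax y]; [exact: Ax|exact: (Ax y)].
  apply: closed_bigI => y _.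
  apply: (@preimage_closed _ _ (fun x => dotp y x) [set t : R | t <= h y]).
    by move=> x _; exact: dotp_continuous.
  exact: closed_le.
pose M := \sum_(i < n) Num.max (h (delta_mx 0 i)) (h (- delta_mx 0 i)).
have kA : compact A.
  apply: bounded_closed_compact => //; exists M; split; first exact: num_real.
  move=> t Mt x Ax /=; apply/ltW/(le_lt_trans _ Mt).
  have bd i : `|x 0 i| <= Num.max (h (delta_mx 0 i)) (h (- delta_mx 0 i)).
    rewrite ler_norml le_max lerNl le_max -dotp_delta -dotpNl.
    by rewrite (Ax (delta_mx 0 i)) (Ax (- delta_mx 0 i)) orbT.
  have M0 : 0 <= M by apply: sumr_ge0 => i _; exact: le_trans (bd i).
  apply: mx_norm_le => // i j; rewrite ord1 (le_trans (bd j))//.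
  rewrite /M (bigD1 j) //= lerDl; apply: sumr_ge0 => k _; exact: le_trans (bd k).
have vA : convex_set A.
  apply/convex_rVP => x y t Ax Ay t0 t1 z.
  rewrite dotpDr !dotpZr.
  have := Ax z; have := Ay z; set a := dotp z x; set b := dotp z y; nra.
exists (ConvexBody A0 kA vA) => y; apply/eqP; rewrite eq_le; apply/andP; split.
  by apply: support_le => x; exact.
by have [x Ax <-] := sublinear_dominates_linear y hs; apply: le_support.
Qed.

End convex_bodies.

Lemma lipschitz_at_continuous (R : realType) (V : normedModType R) (f : V -> R)
    (x : V) (C : R) : 0 <= C -> (forall z, `|f x - f z| <= C * `|x - z|) ->
  {for x, continuous f}.
Proof.
move=> C0 H; apply/cvgrPdist_le => e e0.
have N0 : 0 < C + 1 by rewrite ltr_wpDl.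
apply/nbhs_ballP; exists (e / (C + 1)); first by rewrite /= divr_gt0.
move=> z; rewrite -ball_normE /ball_ /= => /ltW xz.
rewrite (le_trans (H z))// (le_trans (ler_wpM2l C0 xz))//.
by rewrite mulrCA ger_pMr// ler_pdivrMr// mul1r lerDl.
Qed.

Section bodies_and_support.
Context (R : realType) (n : nat).
Local Notation vec := 'rV[R]_n.
Local Notation body := (convex_body R n).
Implicit Types (x y z : vec) (t : R) (K L : body) (h : vec -> R).

Definition body_of h : body :=
  if pselect (exists K : body, support_fun K =1 h) is left H then projT1 (cid H)
  else point_body 0.

Lemma support_body_of h : sublinear h -> support_fun (body_of h) =1 h.
Proof.
move=> /sublinear_body H; rewrite /body_of; case: pselect => // H'.
by case: (cid H').
Qed.

Lemma sublinear_enorm : sublinear (@enorm R n).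
Proof.
split=> [x y|t x t0]; first exact: enormD.
by rewrite enormZ ger0_norm.
Qed.

Definition ball_body : body := body_of (@enorm R n).

Lemma support_ball y : support_fun ball_body y = enorm y.
Proof. exact: support_body_of sublinear_enorm y. Qed.

Lemma mem_ball x : body_set ball_body x -> enorm x <= 1.
Proof.
move=> Bx; have := le_support x Bx; rewrite support_ball -enorm_sqr expr2.
have [->|x0] := eqVneq x 0; first by rewrite enorm0.
by rewrite -[leRHS]mulr1 ler_pM2l// enorm_gt0.
Qed.

Definition hausdorff_bound K L (e : R) : Prop :=
  [/\ 0 <= e,
    forall x, body_set K x -> exists2 y, body_set L y & enorm (x - y) <= e &
    forall y, body_set L y -> exists2 x, body_set K x & enorm (x - y) <= e].

(** The inequality says that [K] is contained in the parallel body [L + e B]. *)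
Lemma support_le_near K L (e : R) : 0 <= e ->
  (forall y, support_fun K y <= support_fun L y + e * enorm y) ->
  forall x, body_set K x -> exists2 y, body_set L y & enorm (x - y) <= e.
Proof.
move=> e0 H x Kx.
have : body_set (body_add L (body_scale e ball_body)) x.
  apply: support_mem => y.
  rewrite support_body_add support_body_scale// support_ball.
  exact: le_trans (le_support y Kx) (H y).
move=> [y [_ [Ly [b /mem_ball b1 <-] ->]]]; exists y => //.
by rewrite addrAC subrr add0r enormZ ger0_norm// -[leRHS]mulr1 ler_wpM2l.
Qed.

Lemma support_close_hausdorff_bound K L (e : R) : 0 <= e ->
  (forall y, `|support_fun K y - support_fun L y| <= e * enorm y) -> hausdorff_bound K L e.
Proof.
move=> e0 H; split => //.
  apply: support_le_near => // y; have /ler_normlP[_] := H y.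
  by rewrite lerBlDl.
move=> y Ly; have [|x Kx xy] := @support_le_near L K e e0 _ y Ly.
  by move=> z; have /ler_normlP[+ _] := H z; rewrite opprB lerBlDl.
by exists x => //; rewrite enormB.
Qed.

Lemma hausdorff_le K L (e : R) : 0 <= e ->
  (forall y, `|support_fun K y - support_fun L y| <= e * enorm y) -> hausdorff K L <= e.
Proof.
move=> e0 H; apply: ge_inf; first by exists 0 => ? [].
exact: support_close_hausdorff_bound.
Qed.

Lemma hausdorff_support K L y :
  `|support_fun K y - support_fun L y| <= hausdorff K L * enorm y.
Proof.
have [->|y0] := eqVneq y 0; first by rewrite !support0 subrr normr0 enorm0 mulr0.
have ny : 0 < enorm y by rewrite enorm_gt0.
rewrite -ler_pdivrMr//; apply: lb_le_inf.
  have [M M0 HM] := support_bound K; have [N N0 HN] := support_bound L.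
  exists (M + N); apply: support_close_hausdorff_bound; first exact: addr_ge0.
  by move=> z; rewrite (le_trans (ler_normB _ _))// mulrDl lerD.
move=> e [e0 H1 H2]; rewrite ler_pdivrMr// ler_norml; apply/andP; split.
  rewrite lerNl opprB lerBlDl; apply: support_le => z /H2[x Kx xz].
  rewrite -(subrK x z) dotpDr addrC lerD ?le_support// mulrC.
  rewrite (le_trans (cauchy_schwarz _ _))// ler_wpM2l ?enorm_ge0//.
  by rewrite enormB.
rewrite lerBlDl; apply: support_le => z /H1[x Lx xz].
rewrite -(subrK x z) dotpDr addrC lerD ?le_support// mulrC.
by rewrite (le_trans (cauchy_schwarz _ _))// ler_wpM2l ?enorm_ge0.
Qed.

(** Connectedness of the segment: just after the last point of [A] only [B] is available, and [B] is
    closed. *)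
Lemma segment_closed_cover (A B : set R) : closed A -> closed B -> A 0 -> B 1 ->
  (forall t : R, 0 <= t <= 1 -> A t \/ B t) ->
  exists t : R, [/\ 0 <= t <= 1, A t & B t].
Proof.
move=> cA cB A0 B1 AB.
have [|||c cS cmax] := @compact_EVT_max _ _ (@id R) (A `&` `[0, 1]%classic).
- by exists 0; split => //=; rewrite in_itv /= lexx ler01.
- rewrite setIC; apply: compact_closedI => //; exact: segment_compact.
- by apply: continuous_subspaceT => z; exact: cvg_id.
rewrite inE in cS; case: cS => Ac /=; rewrite in_itv /= => c01.
exists c; split => //; apply: contrapT => nBc.
have /nbhs_ballP[e /= e0 He] : nbhs c (~` B).
  by apply: open_nbhs_nbhs; split => //; exact: closed_openC.
have c1 : c < 1.
  by rewrite lt_def; case/andP: c01 => _ ->; rewrite andbT; apply: contra_notN nBc => /eqP <-.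
pose t := Num.min (c + e / 2) 1.
have ct : c < t by rewrite lt_min c1 andbT ltrDl divr_gt0.
have t01 : 0 <= t <= 1.
  case/andP: c01 => c0 _.
  by rewrite (le_trans c0 (ltW ct)) /= ge_min lexx orbT.
have nBt : ~ B t.
  apply: He; rewrite -ball_normE /ball_ /= distrC ger0_norm ?subr_ge0 ?ltW//.
  rewrite ltrBlDl; apply: (@le_lt_trans _ _ (c + e / 2)); first by rewrite ge_min lexx.
  by rewrite ltrD2l ltr_pdivrMr// ltr_pMr// ltr1n.
case: (AB t t01) => // At.
have := cmax t; rewrite inE /= in_itv /= => /(_ (conj At t01)).
by rewrite leNgt ct.
Qed.

Lemma convex_comb_continuous x y : continuous (fun t : R => x + t *: (y - x)).
Proof.
by move=> t; apply: cvgD; [exact: cvg_cst|exact: scalel_continuous].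
Qed.

Lemma body_closed K : closed (body_set K).
Proof. by apply: compact_closed; [exact: norm_hausdorff|exact: body_compact]. Qed.

Lemma union_support K L (U : body) : body_set U = body_set K `|` body_set L ->
  forall y, support_fun U y = Num.max (support_fun K y) (support_fun L y).
Proof.
move=> UKL y; apply/eqP; rewrite eq_le; apply/andP; split.
  by apply: support_le => x; rewrite UKL le_max => -[Sx|Sx]; rewrite (le_support y Sx) ?orbT.
rewrite ge_max; apply/andP; split; apply: support_le => x Kx; apply: le_support;
  rewrite UKL; by [left|right].
Qed.

(** The segment joining a maximizer in [K] to one in [L] lies in the convex union, hence meets the
    intersection; a linear form on it is at least the smaller of its two end values. *)
Lemma inter_support K L (U I : body) : body_set U = body_set K `|` body_set L ->
  body_set I = body_set K `&` body_set L ->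
  forall y, support_fun I y = Num.min (support_fun K y) (support_fun L y).
Proof.
move=> UKL IKL y; apply/eqP; rewrite eq_le; apply/andP; split.
  by apply: support_le => x; rewrite IKL => -[Kx Lx]; rewrite le_min !le_support.
have [a Ka [Ea _]] := support_max K y; have [b Lb [Eb _]] := support_max L y.
pose gam (t : R) := a + t *: (b - a).
have cl (S : body) : closed [set t : R | body_set S (gam t)].
  apply: (@preimage_closed _ _ gam (body_set S)); last exact: body_closed.
  by move=> t _; exact: convex_comb_continuous.
have [||t t01|t [/andP[t0 t1] Kt Lt]] := segment_closed_cover (cl K) (cl L).
- by rewrite /= /gam scale0r addr0.
- by rewrite /= /gam scale1r addrC subrK.
- have : body_set U (gam t).
    have -> : gam t = t *: b + (1 - t) *: a.
      by rewrite /gam; apply/rowP => i; rewrite !mxE; ring.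
    have /convex_rVP := @body_convex _ _ U; case/andP: t01 => t0 t1.
    by apply => //; rewrite UKL; [right|left].
  by rewrite UKL.
apply: (@le_trans _ _ (dotp y (gam t))); last by apply: le_support; rewrite IKL.
rewrite /gam dotpDr dotpZr dotpBr -Ea -Eb ge_min.
case: (leP (support_fun K y) (support_fun L y)) => KL.
  by rewrite lerDl mulr_ge0 ?subr_ge0.
by rewrite orbC; apply/orP; left; nra.
Qed.

Lemma support_continuous K : continuous (support_fun K).
Proof.
move=> x; have [M M0 HM] := support_bound K.
have MN : 0 <= M * n%:R by exact: mulr_ge0.
apply: (lipschitz_at_continuous MN) => z.
rewrite (le_trans (support_lipschitz HM _ _))//.
by rewrite -mulrA ler_wpM2l// ler_enorm_norm.
Qed.

(** Converse of [union_support] and [inter_support], used to recognize unions among bodies given by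
    functions. The core is that the minimum is itself sublinear. If [y1] separates [x] from [P] and
    [y2] separates it from [Q], both support functions dominate [x] at some point between [y1] and
    [y2]; so does their minimum, although it lies strictly below [x] at [y1] and [y2]. *)
Lemma support_lattice_sets (P Q U I : body) :
  (forall y, support_fun U y = Num.max (support_fun P y) (support_fun Q y)) ->
  (forall y, support_fun I y = Num.min (support_fun P y) (support_fun Q y)) ->
  body_set U = body_set P `|` body_set Q /\ body_set I = body_set P `&` body_set Q.
Proof.
move=> HU HI; split; apply/seteqP; split.
- move=> x Ux; apply: contrapT => /not_orP[nP nQ].
  have [y1 h1] := body_separation nP; have [y2 h2] := body_separation nQ.
  pose gam (t : R) := y1 + t *: (y2 - y1).
  have cl (S : body) : closed [set t : R | 0 <= support_fun S (gam t) - dotp x (gam t)].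
    apply: (@preimage_closed _ _ (fun t => support_fun S (gam t) - dotp x (gam t))
      [set t : R | 0 <= t]); last exact: closed_ge.
    have c1 : continuous (support_fun S \o gam).
      move=> t; apply: continuous_comp; [exact: convex_comb_continuous|exact: support_continuous].
    have c2 : continuous ((dotp x) \o gam).
      move=> t; apply: continuous_comp; [exact: convex_comb_continuous|exact: dotp_continuous].
    move=> t _; exact: (cvgB (c1 t) (c2 t)).
  have Ug z : 0 <= support_fun P z - dotp x z \/ 0 <= support_fun Q z - dotp x z.
    by apply/orP; rewrite dotpC !subr_ge0 -le_max -HU; exact: le_support.
  have [||t _|t [/andP[t0 t1] Qt Pt]] := segment_closed_cover (cl Q) (cl P).
  + by rewrite /= /gam scale0r addr0; case: (Ug y1) => //; rewrite dotpC subr_ge0 leNgt h1.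
  + rewrite /= /gam scale1r [y1 + _]addrC subrK.
    by case: (Ug y2) => //; rewrite dotpC subr_ge0 leNgt h2.
  + by case: (Ug (gam t)); [right|left].
  have [hD hZ] := support_sublinear I.
  have : 0 <= support_fun I (gam t) - dotp (gam t) x.
    rewrite subr_ge0 HI le_min (dotpC _ x); move: Pt Qt; rewrite /= !subr_ge0.
    by move=> -> ->.
  have Eg : gam t = (1 - t) *: y1 + t *: y2.
    by rewrite /gam; apply/rowP => i; rewrite !mxE; ring.
  have := hD ((1 - t) *: y1) (t *: y2); rewrite -Eg !hZ ?subr_ge0//.
  have -> : dotp (gam t) x = (1 - t) * dotp y1 x + t * dotp y2 x.
    by rewrite Eg dotpDl !dotpZl.
  have l1 : support_fun I y1 < dotp y1 x by rewrite HI gt_min h1.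
  have l2 : support_fun I y2 < dotp y2 x by rewrite HI gt_min h2 orbT.
  move: l1 l2; set a := support_fun I y1; set b := support_fun I y2.
  set c := dotp y1 x; set d := dotp y2 x => l1 l2 i1 i2.
  have := ler_wpM2l t0 (ltW l2); have : 0 <= 1 - t by lra.
  have [t2|t2] := ltP t 1.
    have : (1 - t) * a < (1 - t) * c by rewrite ltr_pM2l// subr_gt0.
    lra.
  have t1' : t = 1 by lra.
  rewrite t1' in i1 i2; lra.
- by move=> x [Sx|Sx]; apply: support_mem => y; rewrite HU le_max (le_support y Sx) ?orbT.
- move=> x Ix; split; apply: support_mem => y;
    by rewrite (le_trans (le_support y Ix))// HI ge_min lexx ?orbT.
- by move=> x [Px Qx]; apply: support_mem => y; rewrite HI le_min !le_support.
Qed.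

End bodies_and_support.

(** * Smooth multiples of support functions *)

Section degree0_smooth.
Context (R : realType) (n : nat).
Local Notation vec := 'rV[R]_n.
Implicit Types (x y z u v w : vec) (t : R) (f g h : vec -> R).

Definition punctured : set vec := [set x | x != 0].

Lemma open_punctured : open punctured. Proof. exact: open_neq0. Qed.

Definition deg0 f := forall t x, 0 < t -> f (t *: x) = f x.

Definition unitv x : vec := (enorm x)^-1 *: x.

Lemma enorm_unitv x : x != 0 -> enorm (unitv x) = 1.
Proof.
move=> x0; rewrite enormZ ger0_norm ?invr_ge0 ?enorm_ge0// mulVf//.
by rewrite enorm_eq0.
Qed.

Lemma enorm_unitvK x : x != 0 -> enorm x *: unitv x = x.
Proof. by move=> x0; rewrite scalerA mulfV ?scale1r// enorm_eq0. Qed.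

Lemma deg0_unitv f x : deg0 f -> x != 0 -> f (unitv x) = f x.
Proof. by move=> f0 x0; apply: f0; rewrite invr_gt0 enorm_gt0. Qed.

Lemma derive_grad g (O : set vec) x v : open O -> smooth_on O g -> O x ->
  'D_v g x = dotp v (grad g x).
Proof.
move=> oO cg Ox; have dg := Ck1_differentiable oO (cg 1%N) Ox.
rewrite (deriveE _ dg) {1}[v]matrix_sum_delta big_ord1 linear_sum.
apply: eq_bigr => i _; rewrite linearZ /= mxE -(deriveE _ dg).
by [].
Qed.

(** An annulus is taken in place of the sphere because the segments of the mean value theorem leave
    the sphere; those between unit vectors at distance at most 1/2 stay in the annulus. *)
Lemma smooth_bounded_annulus g : smooth_on punctured g ->
  exists2 M : R, 0 <= M & forall x, 2^-1 <= enorm x <= 2 -> `|g x| <= M.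
Proof.
move=> cg; pose A := [set x : vec | 2^-1 <= enorm x <= 2].
have A0 x : A x -> x != 0.
  by move=> /andP[x1 _]; rewrite -enorm_gt0; apply: lt_le_trans x1; rewrite invr_gt0.
have kA : compact A.
  apply: (compact_enorm_le (M := 2)); last by move=> x /andP[].
  have -> : A = (@enorm R n) @^-1` `[2^-1, 2]%classic.
    by apply/seteqP; split => x /=; rewrite in_itv.
  by apply: preimage_closed => [x _|]; [exact: enorm_continuous|exact: itv_closed].
have [[x0 Ax0]|nA] := pselect (A !=set0); last first.
  by exists 0 => // x Ax; exfalso; apply: nA; exists x.
have [|||c cA cmax] := @compact_EVT_max _ _ (fun x => `|g x|) A.
- by exists x0.
- exact: kA.
- apply: continuous_in_subspaceT => x; rewrite inE => Ax.
  apply: continuous_comp; last exact: norm_continuous.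
  exact: (smooth_on_continuous cg (A0 _ Ax)).
by exists `|g c| => // x Ax; apply: cmax; rewrite inE.
Qed.

Lemma segment_annulus w x t : enorm w = 1 -> enorm (x - w) <= 2^-1 -> 0 <= t <= 1 ->
  2^-1 <= enorm (w + t *: (x - w)) <= 2.
Proof.
move=> w1 xw /andP[t0 t1].
have Et : enorm (t *: (x - w)) <= 2^-1.
  by rewrite enormZ ger0_norm// -[leRHS]mul1r ler_pM ?enorm_ge0.
have := enormD w (t *: (x - w)).
have := enormD (w + t *: (x - w)) (- (t *: (x - w))); rewrite addrK enormN w1.
move: Et; set e := enorm (t *: _); set d := enorm (w + _) => h1 h2 h3.
by apply/andP; split; lra.
Qed.

Lemma smooth_mvt g w x : smooth_on punctured g -> enorm w = 1 -> enorm (x - w) <= 2^-1 ->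
  exists2 y, (2^-1 <= enorm y <= 2) /\ enorm (y - w) <= enorm (x - w) &
    g x - g w = dotp (x - w) (grad g y).
Proof.
move=> cg w1 xw.
have ann0 y : 2^-1 <= enorm y <= 2 -> punctured y.
  by move=> /andP[y1 _]; rewrite /punctured /= -enorm_gt0; apply: lt_le_trans y1; rewrite invr_gt0.
have [|c c01 E] := @mvt_line R _ g w (x - w).
  move=> t t01; exact: (smooth_on_derivable cg (ann0 _ (segment_annulus w1 xw t01))).
have An := segment_annulus w1 xw c01.
exists (w + c *: (x - w)).
  split => //; rewrite addrAC subrr add0r enormZ; case/andP: c01 => c0 c1.
  by rewrite ger0_norm// -[leRHS]mul1r ler_wpM2r ?enorm_ge0.
by rewrite -(derive_grad _ open_punctured cg (ann0 _ An)) -E [w + _]addrC subrK.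
Qed.

Lemma enorm_le_sum x : enorm x <= \sum_(i < n) `|x 0 i|.
Proof.
rewrite {1}[x]matrix_sum_delta big_ord1.
elim/big_ind2 : _ => [|u a v b ua vb|j _]; first by rewrite enorm0.
  by rewrite (le_trans (enormD _ _))// lerD.
by rewrite enormZ /enorm dotp_delta mxE !eqxx sqrtr1 mulr1.
Qed.

Lemma grad_bounded_annulus g : smooth_on punctured g ->
  exists2 M : R, 0 <= M & forall x, 2^-1 <= enorm x <= 2 -> enorm (grad g x) <= M.
Proof.
move=> cg.
have H i : exists2 M : R, 0 <= M & forall x, 2^-1 <= enorm x <= 2 -> `|grad g x 0 i| <= M.
  have [M M0 HM] := smooth_bounded_annulus (smooth_on_D (delta_mx 0 i) cg).
  by exists M => // x /HM; rewrite mxE.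
have [M HM] := choice (fun i => let: ex_intro2 M a b := H i in
  ex_intro (fun M : R => 0 <= M /\ forall x, 2^-1 <= enorm x <= 2 -> `|grad g x 0 i| <= M) M (conj a b)).
exists (\sum_(i < n) M i); first by apply: sumr_ge0 => i _; have [] := HM i.
move=> x Ax; rewrite (le_trans (enorm_le_sum _))//; apply: ler_sum => i _.
by have [_] := HM i; apply.
Qed.

Lemma smooth_lipschitz_near g : smooth_on punctured g ->
  exists2 L : R, 0 <= L & forall w x, enorm w = 1 -> enorm (x - w) <= 2^-1 ->
    `|g x - g w| <= L * enorm (x - w).
Proof.
move=> cg; have [M M0 HM] := grad_bounded_annulus cg.
exists M => // w x w1 xw; have [y [Ay _] ->] := smooth_mvt cg w1 xw.
rewrite (le_trans (normr_dotp _ _))// mulrC ler_wpM2r ?enorm_ge0//.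
exact: HM.
Qed.

Lemma unit_annulus u : enorm u = 1 -> 2^-1 <= enorm u <= 2.
Proof. by move=> ->; apply/andP; split; lra. Qed.

Lemma smooth_lipschitz_sphere g : smooth_on punctured g ->
  exists2 L : R, 0 <= L & forall u w, enorm u = 1 -> enorm w = 1 ->
    `|g u - g w| <= L * enorm (u - w).
Proof.
move=> cg; have [L L0 HL] := smooth_lipschitz_near cg.
have [M M0 HM] := smooth_bounded_annulus cg.
(* When [|u - w| > 1/2], the crude bound [2 M] is at most [4 M |u - w|]. *)
exists (L + 4 * M); first by rewrite addr_ge0// mulr_ge0.
move=> u w u1 w1; rewrite mulrDl; have [uw|uw] := leP (enorm (u - w)) 2^-1.
  by rewrite (le_trans (HL _ _ w1 uw))// lerDl !mulr_ge0 ?enorm_ge0.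
have := HM u (unit_annulus u1); have := HM w (unit_annulus w1).
have := ler_normB (g u) (g w).
have : 0 <= L * enorm (u - w) by rewrite mulr_ge0 ?enorm_ge0.
have : 0 <= M * (enorm (u - w) - 2^-1) by rewrite mulr_ge0// subr_ge0 ltW.
rewrite mulrBr; set e := enorm (u - w); lra.
Qed.

Lemma smooth_taylor_sphere g : smooth_on punctured g ->
  exists2 L : R, 0 <= L & forall u w, enorm u = 1 -> enorm w = 1 ->
    `|g u - g w - dotp (u - w) (grad g w)| <= L * enorm (u - w) ^+ 2.
Proof.
move=> cg.
have H i : exists L : R, 0 <= L /\ forall w x, enorm w = 1 -> enorm (x - w) <= 2^-1 ->
    `|grad g x 0 i - grad g w 0 i| <= L * enorm (x - w).
  have [L L0 HL] := smooth_lipschitz_near (smooth_on_D (delta_mx 0 i) cg).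
  by exists L; split => // w x w1 xw; rewrite !mxE; exact: HL.
have [L HL] := choice H.
pose L1 := \sum_(i < n) L i.
have L10 : 0 <= L1 by apply: sumr_ge0 => i _; have [] := HL i.
have HL1 w x : enorm w = 1 -> enorm (x - w) <= 2^-1 ->
    enorm (grad g x - grad g w) <= L1 * enorm (x - w).
  move=> w1 xw; rewrite (le_trans (enorm_le_sum _))// mulr_suml; apply: ler_sum => i _.
  by rewrite !mxE; have [_ /(_ w x w1 xw)] := HL i; rewrite !mxE.
have [M M0 HM] := smooth_bounded_annulus cg.
have [N N0 HN] := grad_bounded_annulus cg.
(* Beyond distance 1/2, [2 M <= 8 M |u - w| ^+ 2] controls the values, and
   [N |u - w| <= 2 N |u - w| ^+ 2] the linear term. *)
exists (L1 + 8 * M + 2 * N); first by rewrite !addr_ge0// mulr_ge0.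
move=> u w u1 w1; have e0 := enorm_ge0 (u - w).
have [uw|uw] := leP (enorm (u - w)) 2^-1.
  have [y [Ay yw] ->] := smooth_mvt cg w1 uw.
  rewrite -dotpBr (le_trans (normr_dotp _ _))//.
  have yw' := le_trans yw uw.
  have h1 := HL1 w y w1 yw'.
  have h2 := ler_wpM2l e0 h1.
  have h3 := ler_wpM2l e0 (ler_wpM2l L10 yw).
  apply: (le_trans h2); apply: (le_trans h3).
  rewrite mulrCA -expr2 ler_wpM2r ?sqr_ge0// -addrA lerDl addr_ge0// mulr_ge0//.
have a1 := HM u (unit_annulus u1); have a2 := HM w (unit_annulus w1).
have a3 := ler_normB (g u) (g w).
have a4 := ler_normB (g u - g w) (dotp (u - w) (grad g w)).
have a5 := normr_dotp (u - w) (grad g w).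
have a6 := ler_wpM2l e0 (HN w (unit_annulus w1)).
move: uw e0 a5 a6; set e := enorm (u - w) => uw e0 a5 a6.
have b0 : e * 2^-1 <= e ^+ 2 by rewrite expr2 ler_wpM2l// ltW.
have b1 : 0 <= L1 * e ^+ 2 by rewrite mulr_ge0 ?sqr_ge0.
have b2 := ler_wpM2l M0 b0; have b3 := ler_wpM2l N0 b0.
have b4 : M * 2^-1 <= M * e by rewrite ler_wpM2l// ltW.
by rewrite !mulrDl; lra.
Qed.

Lemma grad_deg0 f w : smooth_on punctured f -> deg0 f -> w != 0 -> dotp w (grad f w) = 0.
Proof.
move=> cf f0 w0; rewrite -(derive_grad _ open_punctured cf w0).
have H : is_derive (0 : R) (1 : R) (fun s : R => f (w + s *: w)) ('D_w f w).
  apply: is_derive_line; rewrite scale0r addr0; exact: (smooth_on_derive w cf w0).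
have H2 : is_derive (0 : R) (1 : R) (fun s : R => f (w + s *: w)) 0.
  apply: (@near_eq_is_derive R R R (cst (f w))).
  near=> s; rewrite /cst -{2}[w]scale1r -scalerDl f0//.
  have : -1 < s by near: s; apply: lt_nbhsr; rewrite ltrN10.
  by lra.
by case: H => _ <-; case: H2.
Unshelve. all: by end_near. Qed.

Section triangle_defect.
Variables (x y : vec).
Hypotheses (x0 : x != 0) (y0 : y != 0) (z0 : x + y != 0).
Let u := unitv x.
Let v := unitv y.
Let w := unitv (x + y).
Let delta := enorm x + enorm y - enorm (x + y).

Lemma variance_defect :
  enorm x * enorm (u - w) ^+ 2 + enorm y * enorm (v - w) ^+ 2 = 2 * delta.
Proof.
have E p : p != 0 -> enorm p * enorm (unitv p - w) ^+ 2 = 2 * enorm p - 2 * dotp p w.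
  move=> p0; rewrite enorm_sqr dotpBl !dotpBr -!enorm_sqr !enorm_unitv//.
  have -> : dotp p w = enorm p * dotp (unitv p) w by rewrite -dotpZl enorm_unitvK.
  by rewrite (dotpC w) expr1n; ring.
rewrite !E//.
have Ew : dotp x w + dotp y w = enorm (x + y).
  rewrite -dotpDl -{1}(enorm_unitvK z0) dotpZl -enorm_sqr enorm_unitv//.
  by rewrite expr1n mulr1.
by rewrite /delta -Ew; ring.
Qed.

Lemma weighted_center : enorm x *: (u - w) + enorm y *: (v - w) = - (delta *: w).
Proof.
rewrite !scalerBr !enorm_unitvK// addrACA -{1}(enorm_unitvK z0) -/w /delta.
by rewrite scalerBl scalerDl !opprB addrA; apply/rowP => i; rewrite !mxE; ring.
Qed.

(** The weighted sum of the displacements [u - w] and [v - w] is a multiple of [w], to which the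
    gradient of a function of degree 0 is orthogonal. Only the second order remainders survive, and
    [variance_defect] adds them up. *)
Lemma mean_defect f (C : R) : deg0 f -> dotp w (grad f w) = 0 ->
  (forall u w, enorm u = 1 -> enorm w = 1 ->
    `|f u - f w - dotp (u - w) (grad f w)| <= C * enorm (u - w) ^+ 2) ->
  `|enorm x * (f x - f (x + y)) + enorm y * (f y - f (x + y))| <= C * (2 * delta).
Proof.
move=> f0 gw HC.
rewrite -(deg0_unitv f0 x0) -(deg0_unitv f0 y0) -(deg0_unitv f0 z0) -/u -/v -/w.
have [u1 v1 w1] : [/\ enorm u = 1, enorm v = 1 & enorm w = 1] by rewrite !enorm_unitv.
have E : enorm x * dotp (u - w) (grad f w) + enorm y * dotp (v - w) (grad f w) = 0.
  by rewrite -!dotpZl -dotpDl weighted_center dotpNl dotpZl gw mulr0 oppr0.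
rewrite -variance_defect [C * (_ + _)]mulrDr.
set a := enorm x; set b := enorm y.
have -> : a * (f u - f w) + b * (f v - f w) =
   a * (f u - f w - dotp (u - w) (grad f w)) + b * (f v - f w - dotp (v - w) (grad f w)).
  rewrite [in RHS]mulrBr [X in _ = _ + X]mulrBr addrACA -opprD E oppr0 addr0.
  by [].
rewrite (le_trans (ler_normD _ _))// !normrM.
rewrite (ger0_norm (enorm_ge0 x)) (ger0_norm (enorm_ge0 y)) (mulrCA C a) (mulrCA C b).
by apply: lerD; apply: ler_wpM2l; by [exact: enorm_ge0|exact: HC].
Qed.

Lemma delta_ge0 : 0 <= delta. Proof. by rewrite subr_ge0 enormD. Qed.

End triangle_defect.

(* With weights [|x|, |y|] at the unit vectors [u, v] of [x, y] and [w] that of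
   [x + y], the first order terms of [psi] and of [h] at [w] contribute
   [O(delta)] because [|x| (u - w) + |y| (v - w) = - delta w], and the second
   order terms because [|x| |u - w|^2 + |y| |v - w|^2 = 2 delta]. *)
Lemma sublinear_cutoff (psi : vec -> R) (M : R) :
  smooth_on punctured psi -> deg0 psi -> (forall x, x != 0 -> 0 <= psi x) -> 0 <= M ->
  exists2 C : R, 0 <= C & forall h, sublinear h -> (forall y, `|h y| <= M * enorm y) ->
    forall C', C <= C' -> sublinear (fun x => psi x * h x + C' * enorm x).
Proof.
move=> cpsi psi0 psi_ge0 M0.
have [L L0 HL] := smooth_lipschitz_sphere cpsi.
have [T T0 HT] := smooth_taylor_sphere cpsi.
have [B B0 HB] := smooth_bounded_annulus cpsi.
(* The first term pays for the variation of [psi] weighted by [h w], the second for the products of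
   variations of [psi] and [h], the third for the case [x + y = 0]. *)
pose C := (T * 2) * M + L * M * 2 + B * M.
have BM0 : 0 <= B * M by exact: mulr_ge0.
have C00 : 0 <= (T * 2) * M + L * M * 2 by rewrite addr_ge0// !mulr_ge0.
have C0 : 0 <= C by rewrite addr_ge0.
exists C => // h hs hM C' CC'; have [hD hZ] := hs; have h0 := sublinear0 hs.
split=> [x y|t x t0]; last first.
  have [->|tn0] := eqVneq t 0; first by rewrite scale0r h0 enorm0 mul0r !mulr0 addr0.
  rewrite psi0 ?lt_def ?tn0// hZ// enormZ ger0_norm//; ring.
have [->|x0] := eqVneq x 0; first by rewrite add0r h0 enorm0 !mulr0 add0r add0r.
have [->|y0] := eqVneq y 0; first by rewrite addr0 h0 enorm0 !mulr0 addr0 addr0.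
have C'0 : 0 <= C' := le_trans C0 CC'.
have [z0|z0] := eqVneq (x + y) 0.
  rewrite z0 h0 enorm0 !mulr0 addr0.
  have low p : p != 0 -> 0 <= psi p * h p + C' * enorm p.
    move=> p0; have b1 := HB _ (unit_annulus (enorm_unitv p0)).
    rewrite (deg0_unitv psi0 p0) ger0_norm ?psi_ge0// in b1.
    have /ler_normlP[b2 _] := hM p.
    have b3 : psi p * - h p <= psi p * (M * enorm p) by rewrite ler_wpM2l ?psi_ge0.
    have b4 : psi p * (M * enorm p) <= B * (M * enorm p).
      by rewrite ler_wpM2r// mulr_ge0 ?enorm_ge0.
    have b5 : C * enorm p <= C' * enorm p by rewrite ler_wpM2r ?enorm_ge0.
    have b6 : B * M * enorm p <= C * enorm p.
      by rewrite ler_wpM2r ?enorm_ge0// /C lerDr.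
    move: b3 b4 b5 b6; rewrite mulrN mulrA; lra.
  by rewrite addr_ge0 ?low.
have md := mean_defect x0 y0 z0 psi0 (grad_deg0 cpsi psi0 (_ : unitv (x + y) != 0)) HT.
have w0 : unitv (x + y) != 0 by rewrite -enorm_gt0 enorm_unitv.
move: md => /(_ w0) md.
have vd := variance_defect x0 y0 z0.
have d0 := delta_ge0 x y.
set a := enorm x in md vd d0 *; set b := enorm y in md vd d0 *.
set d := a + b - enorm (x + y) in md vd d0.
set u := unitv x in vd; set v := unitv y in vd; set w := unitv (x + y) in vd md w0.
have a0 : 0 <= a := enorm_ge0 x. have b0 : 0 <= b := enorm_ge0 y.
have Ex : h x = a * h u by rewrite -hZ// enorm_unitvK.
have Ey : h y = b * h v by rewrite -hZ// enorm_unitvK.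
have w1 : enorm w = 1 by rewrite enorm_unitv.
have cross p : p != 0 -> 
    `|(psi p - psi (x + y)) * (h (unitv p) - h w)| <= (L * M) * enorm (unitv p - w) ^+ 2.
  move=> p0; rewrite -(deg0_unitv psi0 p0) -(deg0_unitv psi0 z0) normrM.
  rewrite expr2 mulrACA ler_pM//; first exact: (HL _ _ (enorm_unitv p0) w1).
  rewrite ler_norml; apply/andP; split; last first.
    have := hD (unitv p - w) w; rewrite subrK.
    have := ler_norm (h (unitv p - w)); have := hM (unitv p - w); lra.
  have := hD (w - unitv p) (unitv p); rewrite subrK.
  have := ler_norm (h (w - unitv p)); have := hM (w - unitv p); rewrite (enormB w); lra.
have cx := ler_wpM2l a0 (cross x x0); have cy := ler_wpM2l b0 (cross y y0).
rewrite -/u in cx; rewrite -/v in cy.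
set p := psi x in md cx *; set q := psi y in md cy *; set s := psi (x + y) in md cx cy *.
have s0 : 0 <= s by exact: psi_ge0.
have k3 : `|h w| <= M by have := hM w; rewrite w1 mulr1.
have sD : 0 <= s * (h x + h y - h (x + y)) by rewrite mulr_ge0// subr_ge0.
have m1 : `|h w * (a * (p - s) + b * (q - s))| <= M * (T * (2 * d)).
  by rewrite normrM ler_pM.
(* A discrete Leibniz rule around [w]: the subadditivity gap of [h], the mean defect of [psi], and
   the crossed variations. *)
have E : p * h x + q * h y - s * h (x + y) = s * (h x + h y - h (x + y)) +
    h w * (a * (p - s) + b * (q - s)) + (a * ((p - s) * (h u - h w)) + b * ((q - s) * (h v - h w))).
  rewrite Ex Ey; ring.
have cx' : `|a * ((p - s) * (h u - h w))| <= a * ((L * M) * enorm (u - w) ^+ 2).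
  by rewrite normrM ger0_norm.
have cy' : `|b * ((q - s) * (h v - h w))| <= b * ((L * M) * enorm (v - w) ^+ 2).
  by rewrite normrM ger0_norm.
have tot : (L * M) * (2 * d) = a * ((L * M) * enorm (u - w) ^+ 2) + b * ((L * M) * enorm (v - w) ^+ 2).
  by rewrite -vd; ring.
have Cd : C * d <= C' * d by rewrite ler_wpM2r.
have Bd : 0 <= B * M * d by rewrite mulr_ge0.
have : p * h x + q * h y - s * h (x + y) >= - (C' * d).
  rewrite E; move: (ler_norm (- (h w * (a * (p - s) + b * (q - s))))).
  move: (ler_norm (- (a * ((p - s) * (h u - h w))))) (ler_norm (- (b * ((q - s) * (h v - h w))))).
  rewrite !normrN => n1 n2 n3.
  move: Cd; rewrite {1}/C !mulrDl => Cd.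
  lra.
move=> low; have -> : C' * enorm (x + y) = C' * a + C' * b - C' * d by rewrite /d; ring.
by clear -low; lra.
Qed.

End degree0_smooth.

(** * Smooth positively curved bodies *)

Section derivative_bounds.
Context (R : realType) (V : normedModType R).
Implicit Types (f : V -> R) (x v : V).

Lemma derive_quotient f x v (e : R) : derivable f x v -> 0 < e ->
  exists2 t : R, 0 < t & `|'D_v f x - t^-1 * (f (x + t *: v) - f x)| <= e.
Proof.
move=> /derivableP df e0; have [d1 _] := df.
have := d1; rewrite /derivable => /(cvgrPdist_le _ _).1 /(_ e e0).
move=> [r /= r0 Hr]; exists (r / 2); first by rewrite divr_gt0.
have r2 : 0 < r / 2 by rewrite divr_gt0.
have := Hr (r / 2); rewrite /ball_ /= sub0r normrN (gtr0_norm r2).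
rewrite ltr_pdivrMr// ltr_pMr// ltr1n => /(_ isT); rewrite gt_eqF// => /(_ isT).
by rewrite [_ *: v + x]addrC.
Qed.

Lemma derive_le f x v (c : R) : derivable f x v ->
  (forall t : R, 0 < t -> f (x + t *: v) - f x <= t * c) -> 'D_v f x <= c.
Proof.
move=> df H; apply/ler_addgt0Pl => e e0.
have [t t0 Ht] := derive_quotient df e0.
have := H t t0; rewrite -ler_pdivrMl// => h1.
have /ler_normlP[_ h2] := Ht; lra.
Qed.

Lemma derive_norm_le f x v (c : R) : derivable f x v ->
  (forall t : R, 0 < t -> `|f (x + t *: v) - f x| <= t * c) -> `|'D_v f x| <= c.
Proof.
move=> df H; rewrite ler_norml derive_le// ?andbT; last first.
  by move=> t /H /ler_normlP[].
rewrite lerNl -deriveN//; apply: derive_le; first exact: derivableN.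
move=> t /H /ler_normlP[+ _]; rewrite opprB; apply: le_trans.
by rewrite [leLHS]/= opprK addrC.
Qed.

End derivative_bounds.

Section homogeneous_smooth.
Context (R : realType) (n : nat).
Local Notation vec := 'rV[R]_n.
Implicit Types (x y z u v w : vec) (t : R) (G : vec -> R).

Definition homog k G := forall t x, 0 < t -> x != 0 -> G (t *: x) = t ^+ k * G x.

Lemma derive_homog k G v : smooth_on (@punctured R n) G -> homog k.+1 G ->
  homog k ('D_v G : vec -> R).
Proof.
move=> cG hG t x t0 x0.
have tx0 : t *: x != 0 by rewrite scaler_eq0 negb_or x0 gt_eqF.
have E1 : 'D_v (fun z => G (t *: z)) x = 'D_(t *: v) G (t *: x).
  rewrite /derive; congr (lim _); apply: (congr1 (fun F => F @ _)).
  by apply/funext => h /=; rewrite [t *: (_ + _)]scalerDr !scalerA [t * h]mulrC.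
have E2 : 'D_v (fun z => G (t *: z)) x = t ^+ k.+1 * 'D_v G x.
  rewrite -deriveMl; last exact: (smooth_on_derivable cG x0).
  apply: near_eq_derive.
  by apply: filterS (open_nbhs_nbhs (conj (@open_punctured R n) x0)) => z z0; exact: hG.
apply: (@mulfI _ t); first by rewrite gt_eqF.
have dG : derivable G (t *: x) v := smooth_on_derivable cG tx0.
rewrite -(deriveZdir t dG).
by rewrite -E1 E2 exprS mulrA.
Qed.

Lemma euler_homog k G x : smooth_on (@punctured R n) G -> homog k G -> x != 0 ->
  'D_x G x = k%:R * G x.
Proof.
move=> cG hG x0.
have H : is_derive (0 : R) (1 : R) (fun s : R => G (x + s *: x)) ('D_x G x).
  by apply: is_derive_line; rewrite scale0r addr0; exact: (smooth_on_derive x cG x0).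
have H2 : is_derive (0 : R) (1 : R) (fun s : R => G (x + s *: x)) (k%:R * G x).
  apply: (@near_eq_is_derive R R R (fun s : R => (1 + s) ^+ k * G x)).
    near=> s; rewrite -{2}[x]scale1r -scalerDl hG//.
    have : -1 < s by near: s; apply: lt_nbhsr; rewrite ltrN10.
    by lra.
  have d1 : is_derive (0 : R) (1 : R) (fun s : R => 1 + s) 1.
    have := @is_deriveD R R R (cst 1) id 0 1 0 1 _ _; rewrite add0r; exact.
  have d2 := @is_deriveX _ _ _ k _ _ _ d1.
  have d3 := @is_deriveM _ _ _ _ _ _ _ _ d2 (@is_derive_cst R R R (G x) (0 : R) (1 : R)).
  rewrite !fctE in d3; apply: (is_derive_eq d3).
  rewrite scaler0 add0r -[LHS]/(_ * (_ * _)) /cst addr0 expr1n !mulr1; exact: mulrC.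
by case: H => _ <-; case: H2.
Unshelve. all: by end_near. Qed.

Lemma homog1_lipschitz G : smooth_on (@punctured R n) G -> homog 1 G ->
  exists2 N : R, 0 <= N & forall x y, x != 0 -> y != 0 ->
    `|G x - G y| <= N * enorm (x - y) /\ `|G x| <= N * enorm x.
Proof.
move=> cG hG.
have [L L0 HL] := smooth_lipschitz_sphere cG.
have [M M0 HM] := smooth_bounded_annulus cG.
exists (M + 2 * L); first by rewrite addr_ge0// mulr_ge0.
move=> x y x0 y0.
have GE z : z != 0 -> G z = enorm z * G (unitv z).
  move=> z0; rewrite -{1}(enorm_unitvK z0) hG ?expr1//; first by rewrite enorm_gt0.
  by rewrite -enorm_gt0 enorm_unitv.
have Gu z : z != 0 -> `|G (unitv z)| <= M by move=> z0; apply: HM; rewrite unit_annulus// enorm_unitv.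
split; last first.
  rewrite (GE _ x0) normrM ger0_norm ?enorm_ge0// mulrC ler_wpM2r ?enorm_ge0//.
  by rewrite (le_trans (Gu _ x0))// lerDl mulr_ge0.
rewrite (GE _ x0) (GE _ y0); set a := enorm x; set b := enorm y.
set u := unitv x; set v := unitv y.
have -> : a * G u - b * G v = (a - b) * G u + b * (G u - G v) by ring.
have b0 : 0 <= b := enorm_ge0 y.
have h1 : `|(a - b) * G u| <= enorm (x - y) * M.
  by rewrite normrM ler_pM// ?enorm_triB// Gu.
have h2 : `|b * (G u - G v)| <= L * (b * enorm (u - v)).
  rewrite normrM ger0_norm// mulrCA ler_wpM2l//.
  by apply: HL; rewrite enorm_unitv.
have h3 : b * enorm (u - v) <= 2 * enorm (x - y).
  have -> : b * enorm (u - v) = enorm ((x - y) + (b - a) *: u).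
    rewrite -{1}(ger0_norm b0) -enormZ scalerBr scalerBl enorm_unitvK// enorm_unitvK//.
    by congr enorm; apply/rowP => i; rewrite !mxE; ring.
  rewrite (le_trans (enormD _ _))// enormZ enorm_unitv// mulr1.
  by rewrite mulr_natl mulr2n lerD2l (enormB x); exact: enorm_triB.
have h4 := ler_wpM2l L0 h3.
apply: (le_trans (ler_normD _ _)); apply: (le_trans (lerD h1 h2)).
by rewrite mulrDl; lra.
Qed.

End homogeneous_smooth.

(** * Smooth inversion of a perturbation of the identity *)

Section half_lipschitz_perturbation.
Context (R : realType) (n : nat).
Local Notation vec := 'rV[R]_n.
Variable E : vec -> vec.
Hypothesis E_lip : forall x y, `|E x - E y| <= 2^-1 * `|x - y|.

Lemma half_lipschitz_entry x y i : `|E x 0 i - E y 0 i| <= 2^-1 * `|x - y|.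
Proof.
apply: le_trans (E_lip x y).
by have := ler_mxentry (E x - E y) 0 i; rewrite !mxE.
Qed.

Lemma half_lipschitz_continuous : continuous E.
Proof.
move=> x; apply: continuous_entries => i j; rewrite ord1.
apply: (@lipschitz_at_continuous _ _ _ _ 2^-1) => // z.
exact: half_lipschitz_entry.
Qed.

(** A minimizer [c] of the residual over a ball stable under [y |-> x - E y] has residual 0, because
    the map at least halves the residual. *)
Lemma perturbation_surjective x : exists y, y + E y = x.
Proof.
(* With this radius, [|x - E y| <= r / 2 + |y| / 2 <= r] on the ball. *)
pose r := 2 * `|x - E 0|.
pose B := [set y : vec | `|y| <= r].
have B0 : B 0 by rewrite /B /= normr0 mulr_ge0.
have TB y : B y -> B (x - E y).
  rewrite /B /= => By.
  have -> : x - E y = (x - E 0) + (E 0 - E y) by rewrite subrKA.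
  rewrite (le_trans (ler_normD _ _))//.
  have := E_lip 0 y; rewrite sub0r normrN /r; move: By; rewrite /r; lra.
have kB : compact B.
  apply: bounded_closed_compact.
    exists r; split; first exact: num_real.
    by move=> t rt y By; exact: le_trans By (ltW rt).
  apply: (@preimage_closed _ _ (fun y : vec => `|y|) [set t : R | t <= r]).
    by move=> y _; exact: norm_continuous.
  exact: closed_le.
have [|||c cB cmin] := @compact_EVT_min _ _ (fun y : vec => `|x - E y - y|) B.
- by exists 0.
- exact: kB.
- apply: continuous_subspaceT => y; apply: continuous_comp; last exact: norm_continuous.
  have c1 : {for y, continuous (fun y => x - E y)}.
    by apply: continuousB; [exact: cst_continuous|exact: half_lipschitz_continuous].
  by apply: (continuousB c1); exact: cvg_id.
rewrite inE in cB; exists c; apply/esym/subr0_eq; rewrite opprD addrA addrAC.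
apply/eqP; rewrite -normr_le0.
have := cmin (x - E c); rewrite inE => /(_ (TB _ cB)).
have -> : x - E (x - E c) - (x - E c) = E c - E (x - E c).
  by apply/rowP => i; rewrite !mxE; ring.
have := E_lip c (x - E c); rewrite [`|c - _|]distrC.
set d := `|x - E c - c|; lra.
Qed.

Definition perturbation_inv x : vec := projT1 (cid (perturbation_surjective x)).
Local Notation Psi := perturbation_inv.

Lemma perturbation_invP x : Psi x + E (Psi x) = x.
Proof. by rewrite /perturbation_inv; case: cid. Qed.

Lemma perturbation_expansive y z : `|y - z| <= 2 * `|(y + E y) - (z + E z)|.
Proof.
have := E_lip y z; have := ler_normB ((y + E y) - (z + E z)) (E y - E z).
have -> : y + E y - (z + E z) - (E y - E z) = y - z.
  by apply/rowP => i; rewrite !mxE; ring.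
lra.
Qed.

Lemma perturbation_inv_lip x x' : `|Psi x - Psi x'| <= 2 * `|x - x'|.
Proof.
have := perturbation_expansive (Psi x) (Psi x').
by rewrite !perturbation_invP.
Qed.

Hypothesis E0 : E 0 = 0.
Hypothesis E_smooth : forall i, smooth_on (@punctured R n) (fun y => E y 0 i).

Lemma perturbation_inv_neq0 (x : vec) : x != 0 -> Psi x != 0.
Proof.
apply: contra => /eqP Px; rewrite -(perturbation_invP x) Px E0 addr0.
by [].
Qed.

(** Transposed with respect to the usual Jacobian matrix, since vectors are rows: [v *m J y] is the
    derivative of [y + E y] in the direction [v]. *)
Definition perturbation_jacobian (y : vec) : 'M[R]_n :=
  \matrix_(i, j) ((i == j)%:R + 'D_(delta_mx 0 i) (fun z => E z 0 j) y).
Local Notation J := perturbation_jacobian.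

(** The row [v *m (J y - 1)] is a directional derivative of [E], hence of norm at most [|v| / 2].
    The parameter [t] joins the identity to [J y] through invertible matrices, which fixes the sign
    of the determinant in [jacobian_det_gt0]. *)
Lemma jacobian_expansive (t : R) (y v : vec) : 0 <= t <= 1 -> y != 0 ->
  `|v| <= 2 * `|v *m (1%:M + t *: (J y - 1%:M))|.
Proof.
move=> /andP[t0 t1] y0.
have D_le : `|v *m (J y - 1%:M)| <= 2^-1 * `|v|.
  apply: mx_norm_le => [|i j]; first by rewrite mulr_ge0 ?invr_ge0.
  rewrite ord1.
  have -> : (v *m (J y - 1%:M)) 0 j = 'D_v (fun z => E z 0 j) y.
    rewrite (derive_grad _ (@open_punctured R n) (E_smooth j) y0) mxE.
    by apply: eq_bigr => k _; rewrite !mxE addrAC subrr add0r.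
  apply: derive_norm_le; first exact: (smooth_on_derivable (E_smooth j) y0).
  move=> t' t'0; apply: (le_trans (half_lipschitz_entry _ _ _)).
  by rewrite addrAC subrr add0r normrZ gtr0_norm// mulrCA.
have E1 : v = v *m (1%:M + t *: (J y - 1%:M)) - t *: (v *m (J y - 1%:M)).
  by rewrite mulmxDr mulmx1 -scalemxAr addrK.
have : `|v| <= `|v *m (1%:M + t *: (J y - 1%:M))| + `|t *: (v *m (J y - 1%:M))|.
  by rewrite {1}E1; exact: ler_normB.
rewrite normrZ ger0_norm//.
have : t * `|v *m (J y - 1%:M)| <= 1 * (2^-1 * `|v|) by rewrite ler_pM.
lra.
Qed.

Lemma jacobian_path_det (t : R) (y : vec) : 0 <= t <= 1 -> y != 0 ->
  \det (1%:M + t *: (J y - 1%:M)) != 0.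
Proof.
move=> t01 y0; rewrite -unitfE -[_ \is a _]/(_ \in unitmx).
rewrite -row_free_unit; apply: contraT => nf.
have /rowV0Pn[v /sub_kermxP v1 v0] : kermx (1%:M + t *: (J y - 1%:M)) != 0.
  by rewrite kermx_eq0.
have := jacobian_expansive v t01 y0.
by rewrite v1 normr0 mulr0 normr_le0 (negbTE v0).
Qed.

Lemma jacobian_det_gt0 (y : vec) : y != 0 -> 0 < \det (J y).
Proof.
move=> y0.
pose d (t : R) := \det (1%:M + t *: (J y - 1%:M)).
have dc : continuous d.
  move=> t; apply: (@smooth_on_continuous _ _ setT) => //.
  apply: smooth_on_sum => [|s _]; first exact: openT.
  apply: smooth_onM; [exact: openT|exact: (smooth_on_cst _ openT)|].
  apply: smooth_on_prod => [|i _]; first exact: openT.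
  apply: (@smooth_on_ext _ _ _ (fun t : R => (1%:M : 'M[R]_n) i (s i) + t * (J y - 1%:M) i (s i))).
  - exact: openT.
  - by move=> x _; rewrite !mxE.
  apply: smooth_onD; [exact: openT|exact: (smooth_on_cst _ openT)|].
  apply: smooth_onM; [exact: openT| |exact: (smooth_on_cst _ openT)].
  by apply: (@smooth_on_linear _ _ _ (@idfun R)); [exact: openT|move=> z; exact: cvg_id].
have d1 : d 1 = \det (J y) by rewrite /d scale1r addrC subrK.
have d0 : d 0 = 1 by rewrite /d scale0r addr0 det1.
rewrite -d1 ltNge; apply/negP => dneg.
have [||c] := @IVT R d 0 1 0 ler01.
- exact: continuous_subspaceT.
- by rewrite d0 ge_min dneg orbT /= le_max ler01.
rewrite in_itv /= => c01 /eqP; apply/negP.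
exact: jacobian_path_det.
Qed.

Lemma jacobian_unit (y : vec) : y != 0 -> J y \in unitmx.
Proof. by move=> y0; rewrite unitmxE unitfE gt_eqF// jacobian_det_gt0. Qed.

Lemma is_derive_perturbation_inv (x v : vec) i : x != 0 ->
  is_derive x v (fun z => Psi z 0 i) ((v *m invmx (J (Psi x))) 0 i).
Proof.
move=> x0; set y := Psi x; have y0 : y != 0 := perturbation_inv_neq0 x0.
set d := v *m invmx (J y).
have dJ : d *m J y = v by rewrite mulmxKV// jacobian_unit.
clearbody d.
have lim : (fun h : R => h^-1 *: (Psi (h *: v + x) 0 i - y 0 i)) @ (0 : R)^' --> d 0 i.
  apply/cvgrPdist_le => e e0.
  (* The factor 4 absorbs two factors 2, one from the Lipschitz bound on [Psi], the other from
     [jacobian_expansive]. *)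
  pose N : R := 4 * (`|v| + 1).
  have N0 : 0 < N by rewrite mulr_gt0// ltr_wpDl.
  have eN : 0 < e / N by rewrite divr_gt0.
  have incr j : exists r : R, 0 < r /\ forall w : vec, `|w| < r ->
      `|E (y + w) 0 j - E y 0 j - dotp w (grad (fun z => E z 0 j) y)| <= e / N * `|w|.
    have [r r0 Hr] := increment_estimate (entries 1 n) (@open_punctured R n) (E_smooth j 1%N) y0 eN.
    exists r; split => // w wr; have := Hr w wr; rewrite -matrix_sum_entries.
    rewrite /entries big_enum /= (_ : \sum_(ij in _) _ = dotp w (grad (fun z => E z 0 j) y))//.
    rewrite -(pair_big predT predT (fun (a : 'I_1) (b : 'I_n) => w a b * 'D_(delta_mx a b) (fun z => E z 0 j) y)) /=.
    by rewrite big_ord1; apply: eq_bigr => k _; rewrite mxE.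
  have [r Hr] := choice incr.
  have r0 : 0 < \big[Num.min/1]_(j < n) r j.
    elim/big_ind : _ => // [a b a0 b0|j _]; first by rewrite lt_min a0 b0.
    by have [] := Hr j.
  set rm := \big[Num.min/1]_(j < n) r j in r0.
  near=> h.
  have h0 : h != 0 by near: h; exact: nbhs_dnbhs_neq.
  have [w wE] : exists w, w = Psi (h *: v + x) - y by eexists.
  have w_le : `|w| <= 2 * (`|h| * `|v|).
    by rewrite wE (le_trans (perturbation_inv_lip _ _))// addrK normrZ.
  have hr : `|h| < rm / N.
    by near: h; apply: dnbhs0_lt; rewrite divr_gt0.
  have w_lt : `|w| < rm.
    apply: le_lt_trans w_le _; move: hr; rewrite ltr_pdivlMr// /N => hr.
    apply: le_lt_trans hr.
    have -> : `|h| * (4 * (`|v| + 1)) = 2 * (`|h| * `|v|) + (2 * (`|h| * `|v|) + 4 * `|h|) by ring.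
    by rewrite lerDl addr_ge0// ?mulr_ge0.
  (* As [y + E y] increases by exactly [h v], this product is minus the remainder of the first order
     expansion of [E] at [y]. *)
  have key : `|(w - h *: d) *m J y| <= e / N * (2 * (`|h| * `|v|)).
    apply: mx_norm_le => [|a j]; first by apply: mulr_ge0; [exact: ltW|rewrite !mulr_ge0].
    rewrite ord1 mulmxBl -scalemxAl dJ.
    have -> : (w *m J y - h *: v) 0 j =
       - (E (y + w) 0 j - E y 0 j - dotp w (grad (fun z => E z 0 j) y)).
      have : (y + w) + E (y + w) - (y + E y) = h *: v.
        by rewrite wE [y + (_ - y)]addrC subrK !perturbation_invP addrK.
      move=> <-; rewrite !mxE /dotp.
      under eq_bigr do rewrite mxE mulrDr.
      have -> : \sum_(k < n) (w 0 k * (k == j)%:R + w 0 k * 'D_(delta_mx 0 k) (fun z => E z 0 j) y) =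
          w 0 j + \sum_(k < n) w 0 k * grad (fun z => E z 0 j) y 0 k.
        rewrite big_split /= (bigD1 j) //= eqxx mulr1 big1 ?addr0.
          by congr (_ + _); apply: eq_bigr => k _; rewrite [grad _ _ _ _]mxE.
        by move=> k kj; rewrite (negbTE kj) mulr0.
      ring.
    rewrite normrN; have [_ Hj] := Hr j.
    apply: (le_trans (Hj w _)); last by rewrite ler_wpM2l// ltW.
    by apply: lt_le_trans w_lt _; apply: bigmin_le.
  have := jacobian_expansive (t := 1) (w - h *: d) _ y0.
  rewrite lexx ler01 scale1r [1%:M + _]addrC subrK => /(_ isT) Hw.
  have -> : d 0 i - h^-1 *: (Psi (h *: v + x) 0 i - y 0 i) = - h^-1 * ((w - h *: d) 0 i).
    by rewrite wE !mxE -[_ *: _]/(_ * _); field; exact: h0.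
  rewrite normrM normrN normfV ler_pdivrMl ?normr_gt0//.
  apply: (le_trans (ler_mxentry _ _ _)); apply: (le_trans Hw).
  have h1 := ler_wpM2l (ler0n _ 2) key; apply: (le_trans h1).
  have -> : 2 * (e / N * (2 * (`|h| * `|v|))) = `|h| * (e * (4 * `|v| / N)) by ring.
  rewrite ler_wpM2l// ger_pMr// ler_pdivrMr// mul1r /N mulrDr; lra.
split; first by apply/cvg_ex; exists (d 0 i).
by apply/cvg_lim.
Unshelve. all: by end_near. Qed.

(** Bootstrap: the derivative of [Psi] is [invmx (J (Psi x))], so [Psi] gains one order of
    regularity at each step. The inverse matrix is smooth by Cramer's formula. *)
Lemma smooth_perturbation_inv i : smooth_on (@punctured R n) (fun x => Psi x 0 i).
Proof.
have oP := @open_punctured R n.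
have JS a b : smooth_on (@punctured R n) (fun y => J y a b).
  apply: (@smooth_on_ext _ _ _ (fun y => (a == b)%:R + 'D_(delta_mx 0 a) (fun z => E z 0 b) y)) => //.
    by move=> y _; rewrite mxE.
  by apply: smooth_onD => //; [exact: smooth_on_cst|exact: smooth_on_D].
have detS m (A : vec -> 'M[R]_m) : (forall a b, smooth_on (@punctured R n) (fun y => A y a b)) ->
    smooth_on (@punctured R n) (fun y => \det (A y)).
  move=> AS; apply: smooth_on_sum => // s _; apply: smooth_onZ => //.
  by apply: smooth_on_prod => // k _; exact: AS.
have invS a b : smooth_on (@punctured R n) (fun y => invmx (J y) a b).
  apply: (@smooth_on_ext _ _ _ (fun y => (\det (J y))^-1 * \adj (J y) a b)) => //.
    by move=> y y0; rewrite /invmx jacobian_unit// !mxE.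
  apply: smooth_onM => //.
    apply: smooth_onV => //; last exact: detS.
    by move=> y y0; rewrite gt_eqF// jacobian_det_gt0.
  apply: (@smooth_on_ext _ _ _ (fun y => (-1) ^+ (b + a) * \det (row' b (col' a (J y))))) => //.
    by move=> y _; rewrite !mxE.
  apply: smooth_onZ => //; apply: detS => c d.
  by apply: (@smooth_on_ext _ _ _ (fun y => J y (lift b c) (lift a d))) => // y _; rewrite !mxE.
have Psic j x : {for x, continuous (fun z => Psi z 0 j)}.
  have c0 : 0 <= 2 :> R by [].
  apply: (lipschitz_at_continuous c0) => z; apply: le_trans (perturbation_inv_lip x z).
  by have := ler_mxentry (Psi x - Psi z) 0 j; rewrite !mxE.
move=> k; elim: k i => [|k IH] i.
  by split => // x x0; exact: Psic.
apply: (Ck_onS oP) => [x x0|v]; first exact: Psic.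
exists (fun x => \sum_a v 0 a * invmx (J (Psi x)) a i).
  move=> x x0; apply: is_derive_eq (is_derive_perturbation_inv v i x0) _.
  by rewrite mxE.
have sumC (s : seq 'I_n) : Ck_on (@punctured R n) k
    (fun x => \sum_(a <- s) v 0 a * invmx (J (Psi x)) a i).
  elim: s => [|a s IHs].
    apply: (@Ck_on_ext _ _ _ _ (fun=> 0)) => //; last exact: Ck_on_cst.
    by move=> x _; rewrite big_nil.
  apply: (@Ck_on_ext _ _ _ _ (fun x => v 0 a * invmx (J (Psi x)) a i +
      \sum_(a <- s) v 0 a * invmx (J (Psi x)) a i)) => //.
    by move=> x _; rewrite big_cons.
  apply: Ck_onD => //; apply: Ck_onM => //; first exact: Ck_on_cst.
  apply: (Ck_on_comp_mx oP oP perturbation_inv_neq0 (invS a i k)) => c b.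
  by rewrite ord1; exact: IH.
exact: sumC.
Qed.

End half_lipschitz_perturbation.

Lemma is_derive_bigsum (R : realType) (V : normedModType R) I (s : seq I)
    (F : I -> V -> R) (d : I -> R) x v :
  (forall i, is_derive x v (F i) (d i)) ->
  is_derive x v (fun z => \sum_(i <- s) F i z) (\sum_(i <- s) d i).
Proof.
move=> H; elim: s => [|i s IH].
  rewrite big_nil (_ : (fun z => _) = cst 0); first exact: is_derive_cst.
  by apply/funext => z; rewrite big_nil.
rewrite big_cons (_ : (fun z => _) = F i + (fun z => \sum_(i <- s) F i z)).
  exact: is_deriveD.
by apply/funext => z; rewrite big_cons.
Qed.

Lemma adj_invmx (R : comUnitRingType) n (A : 'M[R]_n) : A \in unitmx ->
  \adj (invmx A) = (\det A)^-1 *: A.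
Proof.
move=> uA; have := mul_mx_adj (invmx A); rewrite det_inv => /(congr1 (mulmx A)).
by rewrite mulmxA mulmxV// mul1mx mul_mx_scalar.
Qed.

Lemma sublinearZ (R : realType) n (h : 'rV[R]_n -> R) (c : R) : 0 <= c -> sublinear h ->
  sublinear (fun x => c * h x).
Proof.
move=> c0 [hD hZ]; split=> [x y|t x t0]; first by rewrite -mulrDr ler_wpM2l.
by rewrite hZ// mulrCA.
Qed.

Lemma sublinear_ext (R : realType) n (h g : 'rV[R]_n -> R) : h =1 g -> sublinear h -> sublinear g.
Proof. by move=> /funext ->. Qed.

(** * Bodies whose support function is a small smooth perturbation of the norm *)

Section smooth_bodies.
Context (R : realType) (n : nat).
Local Notation vec := 'rV[R]_n.
Implicit Types (x y z u v w : vec).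
Variable f : vec -> R.
Hypotheses (f_smooth : smooth_on (@punctured R n) f) (f_deg0 : deg0 f).

Let oP := @open_punctured R n.

(** [sublinear_cutoff] is applied to the nonnegative function [f + B] and to the norm, with constant
    [e^-1 - B]. Multiplication by [e] then gives exactly [|x| + e f |x|], and [e] only has to
    satisfy [C <= e^-1 - B]. *)
Lemma sublinear_perturbation : exists2 e0 : R, 0 < e0 &
  forall e : R, 0 < e <= e0 -> sublinear (fun x => enorm x + e * (f x * enorm x)).
Proof.
have [B B0 HB] := smooth_bounded_annulus f_smooth.
have fB x : x != 0 -> `|f x| <= B.
  move=> x0; rewrite -(deg0_unitv f_deg0 x0); apply: HB.
  by rewrite unit_annulus// enorm_unitv.
have [||||C C0 HC] := @sublinear_cutoff R n (fun x => f x + B) 1.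
- by apply: smooth_onD => //; exact: smooth_on_cst.
- by move=> t x t0; rewrite f_deg0.
- by move=> x /fB /ler_normlP[h1 h2]; lra.
- by [].
have BC : 0 < B + C + 1 by rewrite ltr_wpDl// addr_ge0.
exists (B + C + 1)^-1; first by rewrite invr_gt0.
move=> e /andP[e0 eBC].
have He : C <= e^-1 - B.
  have : B + C + 1 <= e^-1 by rewrite -[leLHS]invrK lef_pV2 ?posrE ?invr_gt0.
  lra.
have := sublinearZ (ltW e0) (HC _ (@sublinear_enorm R n) _ _ He).
move=> H; apply: sublinear_ext (H _) => [x|y]; last first.
  by rewrite mul1r ger0_norm ?enorm_ge0.
have en0 : e != 0 by rewrite gt_eqF.
by rewrite /=; field.
Qed.

Section body.
Variable e : R.
(* [grad H] is [y + E y], a perturbation of the identity. As in Legendre duality,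
   its inverse [Psi] is the gradient of half the squared gauge [H \o Psi] of the
   body with support function [h]; the Hessian of the latter is thus [J^-1]. *)
Let h x := enorm x + e * (f x * enorm x).
Let H x := h x ^+ 2 / 2.
(** The expansion is [H x = |x| ^+ 2 / 2 + e H1 x + e ^+ 2 H2 x], whose first term has gradient [x];
    [E] is the gradient of the rest. *)
Let H1 x := dotp x x * f x.
Let H2 x := dotp x x * f x ^+ 2 / 2.
Let D j : vec -> R := fun y => e * 'D_(delta_mx 0 j) H1 y + e ^+ 2 * 'D_(delta_mx 0 j) H2 y.
(** Away from the origin the entries of [E] are homogeneous of degree 1, so 0 is the continuous
    value there. *)
Let E (y : vec) : vec := \row_j (if y == 0 then 0 else D j y).

Hypothesis h_sublinear : sublinear h.
Hypothesis E_lip : forall x y, `|E x - E y| <= 2^-1 * `|x - y|.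
Hypothesis h_ge : forall x, 2^-1 * enorm x <= h x.

Let H1_smooth : smooth_on (@punctured R n) H1.
Proof. by apply: smooth_onM => //; exact: smooth_dotpxx. Qed.

Let H2_smooth : smooth_on (@punctured R n) H2.
Proof.
apply: smooth_onM => //; last exact: smooth_on_cst.
by apply: smooth_onM => //; [exact: smooth_dotpxx|exact: smooth_on_exp].
Qed.

Let h_smooth : smooth_on (@punctured R n) h.
Proof.
apply: smooth_onD => //; first exact: smooth_enorm.
by apply: smooth_onZ => //; apply: smooth_onM => //; exact: smooth_enorm.
Qed.

Let H_smooth : smooth_on (@punctured R n) H.
Proof. by apply: smooth_onM => //; [exact: smooth_on_exp|exact: smooth_on_cst]. Qed.

Let H1_homog : homog 2 H1.
Proof. by move=> t x t0 _; rewrite /H1 dotpZl dotpZr f_deg0//; ring. Qed.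

Let H2_homog : homog 2 H2.
Proof. by move=> t x t0 _; rewrite /H2 dotpZl dotpZr f_deg0//; ring. Qed.

Let h_homog : homog 1 h.
Proof. by move=> t x t0 _; rewrite /h enormZ f_deg0// gtr0_norm//; ring. Qed.

Let H_homog : homog 2 H.
Proof. by move=> t x t0 x0; rewrite /H h_homog//; ring. Qed.

Let D_smooth j : smooth_on (@punctured R n) (D j).
Proof.
by apply: smooth_onD => //; apply: smooth_onZ => //; exact: smooth_on_D.
Qed.

Let D_homog j : homog 1 (D j).
Proof.
move=> t x t0 x0; rewrite /D (derive_homog _ H1_smooth H1_homog t0 x0).
rewrite (derive_homog _ H2_smooth H2_homog t0 x0); ring.
Qed.

Let E_entry j y : y != 0 -> E y 0 j = D j y.
Proof. by move=> y0; rewrite mxE (negbTE y0). Qed.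

Let E0 : E 0 = 0.
Proof. by apply/rowP => j; rewrite !mxE eqxx. Qed.

Let E_smooth j : smooth_on (@punctured R n) (fun y => E y 0 j).
Proof.
by apply: smooth_on_ext (D_smooth j) => // y y0; rewrite E_entry.
Qed.

Let E_homog j : homog 1 (fun y => E y 0 j).
Proof.
move=> t x t0 x0; rewrite !E_entry ?D_homog//.
by rewrite scaler_eq0 negb_or x0 gt_eqF.
Qed.

Let derive_H j y : y != 0 -> 'D_(delta_mx 0 j) H y = y 0 j + E y 0 j.
Proof.
move=> y0; rewrite E_entry//.
have HE z : H z = 2^-1 * (dotp z z) + (e * H1 z + e ^+ 2 * H2 z).
  by rewrite /H /H1 /H2 /h -enorm_sqr; field.
have d0 : is_derive y (delta_mx 0 j) (fun z : vec => dotp z z) (2 * y 0 j).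
  have -> : 2 * y 0 j = \sum_(i < n) (y 0 i * (delta_mx 0 j : vec) 0 i + y 0 i * (delta_mx 0 j : vec) 0 i).
    rewrite big_split /= -/(dotp y (delta_mx 0 j)) dotpC dotp_delta; ring.
  apply: is_derive_bigsum => i.
  have cd : is_derive y (delta_mx 0 j) (fun z : vec => z 0 i) ((delta_mx 0 j : vec) 0 i).
    split; first exact: (smooth_on_derivable (smooth_on_coord 0 i openT)).
    rewrite (deriveE _ (differentiable_coord _ _ _)).
    have @c : {linear vec -> R}.
      by exists (fun N : vec => N 0 i); do 2![eexists]; do ?[constructor];
        rewrite ?mxE// => ? *; rewrite ?mxE//; move=> ?; rewrite !mxE.
    by rewrite -[LHS]/('d c y (delta_mx 0 j)) diff_lin//; exact: coord_continuous.
  exact: (@is_deriveM _ _ _ _ _ _ _ _ cd cd).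
have d1 := smooth_on_derive (delta_mx 0 j) H1_smooth y0.
have d2 := smooth_on_derive (delta_mx 0 j) H2_smooth y0.
have d3 := @is_deriveD _ _ _ _ _ _ _ _ _ (@is_deriveZ _ _ _ _ (2^-1 : R) _ _ _ d0)
  (@is_deriveD _ _ _ _ _ _ _ _ _ (@is_deriveZ _ _ _ _ e _ _ _ d1) (@is_deriveZ _ _ _ _ (e ^+ 2) _ _ _ d2)).
rewrite (funext HE); case: d3 => _ d3.
apply: etrans; first exact: d3.
by rewrite /D /GRing.scale /=; field.
Qed.

Let gradH y : y != 0 -> grad H y = y + E y.
Proof. by move=> y0; apply/rowP => j; rewrite mxE derive_H// [RHS]mxE. Qed.

Local Notation Psi := (perturbation_inv E_lip).

(** Euler's relation for [H], of degree 2, at [y = Psi x], where [x] is the gradient of [H]. *)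
Let dual_pairing x : x != 0 -> dotp (Psi x) x = h (Psi x) ^+ 2.
Proof.
move=> x0; have y0 := perturbation_inv_neq0 E_lip E0 x0.
rewrite -{2}(perturbation_invP E_lip x) -gradH// -(derive_grad _ oP H_smooth y0).
rewrite (euler_homog H_smooth H_homog y0) /H; by field.
Qed.

(** The defining function of the body: [g x <= 0] means [h (Psi x) <= 1]. *)
Let g x := H (Psi x) - 2^-1.

Let g_smooth : smooth_on (@punctured R n) g.
Proof.
apply: smooth_onB => //; last exact: smooth_on_cst.
apply: (smooth_on_comp_mx oP oP (perturbation_inv_neq0 E_lip E0) H_smooth).
by move=> i j; rewrite ord1; exact: (smooth_perturbation_inv E_lip E0 E_smooth).
Qed.

(** The envelope identity. By [dual_pairing], [dotp z (Psi z)] is twice [H (Psi z)]. Differentiating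
    both sides at [x], with [x] the gradient of [H] at [Psi x], the terms in the derivative [d] of
    [Psi] cancel up to one copy, equal to [dotp v (Psi x)]. *)
Let derive_g x v : x != 0 -> 'D_v g x = dotp v (Psi x).
Proof.
move=> x0; have y0 := perturbation_inv_neq0 E_lip E0 x0.
pose d j := 'D_v (fun z => Psi z 0 j) x.
have dP j : is_derive x v (fun z => Psi z 0 j) (d j).
  exact: (smooth_on_derive v (smooth_perturbation_inv E_lip E0 E_smooth j) x0).
have dHP : is_derive x v (H \o Psi) (\sum_(j < n) x 0 j * d j).
  have := @is_derive_comp_mx R _ 1 n H Psi x v (Ck1_differentiable oP (H_smooth 1%N) y0).
  have dd i j : derivable (fun z => Psi z i j) x v by rewrite ord1; case: (dP j).
  move=> /(_ dd); rewrite /entries big_enum /=.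
  rewrite -(pair_big predT predT (fun (a : 'I_1) (b : 'I_n) =>
    'D_(delta_mx a b) H (Psi x) * 'D_v (fun z => Psi z a b) x)) /= big_ord1.
  move=> K; apply: is_derive_eq K _; apply: eq_bigr => j _.
  by rewrite derive_H// -[in RHS](perturbation_invP E_lip x) [in RHS]mxE.
have cd i : is_derive x v (fun z : vec => z 0 i) (v 0 i).
  split; first exact: (smooth_on_derivable (smooth_on_coord 0 i openT)).
  rewrite (deriveE _ (differentiable_coord _ _ _)).
  have @c : {linear vec -> R}.
    by exists (fun N : vec => N 0 i); do 2![eexists]; do ?[constructor];
      rewrite ?mxE// => ? *; rewrite ?mxE//; move=> ?; rewrite !mxE.
  by rewrite -[LHS]/('d c x v) diff_lin//; exact: coord_continuous.
have dS : is_derive x v (fun z => \sum_(j < n) z 0 j * Psi z 0 j)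
    (\sum_(j < n) (x 0 j * d j + Psi x 0 j * v 0 j)).
  by apply: is_derive_bigsum => j; exact: (@is_deriveM _ _ _ _ _ _ _ _ (cd j) (dP j)).
have dS' : is_derive x v (fun z => \sum_(j < n) z 0 j * Psi z 0 j)
    (2 * \sum_(j < n) x 0 j * d j).
  apply: (near_eq_is_derive _ (@is_deriveZ _ _ _ _ (2 : R) _ _ _ dHP)).
  apply: filterS (open_nbhs_nbhs (conj oP x0)) => z z0.
  rewrite -[LHS]/(2 * (H (Psi z))) -/(dotp z (Psi z)) dotpC dual_pairing// /H.
  by field.
have key : \sum_(j < n) x 0 j * d j = dotp v (Psi x).
  have E1 : \sum_(j < n) (x 0 j * d j + Psi x 0 j * v 0 j) = 2 * \sum_(j < n) x 0 j * d j.
    by case: dS => _ <-; case: dS' => _ <-.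
  move: E1; rewrite big_split /= -/(dotp (Psi x) v) dotpC.
  by move=> /eqP; rewrite mulr_natl mulr2n (inj_eq (addrI _)) => /eqP.
rewrite -key; have [_ <-] := dHP.
have -> : g = (H \o Psi) + cst (- 2^-1) by [].
rewrite deriveD; [|by case: dHP|exact: derivable_cst].
by rewrite derive_cst addr0.
Qed.

Let grad_g x : x != 0 -> grad g x = Psi x.
Proof. by move=> x0; apply/rowP => j; rewrite mxE derive_g// dotp_delta. Qed.

Local Notation J := (perturbation_jacobian E).

Let hessian_g x : x != 0 -> hessian g x = invmx (J (Psi x)).
Proof.
move=> x0; apply/matrixP => i j; rewrite mxE.
have -> : 'D_(delta_mx 0 i) (fun y => 'D_(delta_mx 0 j) g y) x =
    'D_(delta_mx 0 i) (fun z => Psi z 0 j) x.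
  apply: near_eq_derive; apply: filterS (open_nbhs_nbhs (conj oP x0)) => z z0.
  by rewrite derive_g// dotp_delta.
have [_ ->] := is_derive_perturbation_inv E_lip E0 E_smooth (delta_mx 0 i) j x0.
by rewrite -rowE mxE.
Qed.

(** The Hessian of [g] is [J^-1], whose adjugate is [J / det J], and [Psi x *m J = x] by Euler's
    relation for [E]. The numerator of the curvature is thus [h (Psi x) ^+ 2 / det J]. *)
Let curvature_pos x : x != 0 -> 0 < level_gauss_curvature g x.
Proof.
move=> x0; have y0 := perturbation_inv_neq0 E_lip E0 x0.
rewrite /level_gauss_curvature grad_g// hessian_g//.
rewrite divr_gt0 ?exprn_gt0 ?enorm_gt0//.
have dJ := jacobian_det_gt0 E_lip E_smooth y0.
rewrite adj_invmx ?(jacobian_unit E_lip E_smooth)// -scalemxAr -scalemxAl mxE.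
rewrite mulr_gt0 ?invr_gt0//.
have -> : Psi x *m J (Psi x) = x.
  rewrite -[RHS](perturbation_invP E_lip x); apply/rowP => j; rewrite mxE [in RHS]mxE.
  under eq_bigr do rewrite mxE mulrDr.
  rewrite big_split /= (bigD1 j) //= eqxx mulr1 big1 ?addr0; last first.
    by move=> k kj; rewrite (negbTE kj) mulr0.
  congr (_ + _).
  transitivity (dotp (Psi x) (grad (fun z => E z 0 j) (Psi x))).
    by apply: eq_bigr => k _; rewrite [in RHS]mxE.
  rewrite -(derive_grad _ oP (E_smooth j) y0).
  by rewrite (euler_homog (E_smooth j) (E_homog j) y0) mul1r.
have -> : (x *m (Psi x)^T) 0 0 = dotp (Psi x) x.
  by rewrite mxE dotpC; apply: eq_bigr => j _; rewrite [_^T _ _]mxE.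
rewrite dual_pairing// exprn_gt0//; apply: lt_le_trans (h_ge _).
by rewrite mulr_gt0// ?invr_gt0// enorm_gt0.
Qed.

Variable K : convex_body R n.
Hypothesis K_support : support_fun K =1 h.

Let h_ge0 x : 0 <= h x.
Proof. by apply: le_trans (h_ge x); rewrite mulr_ge0 ?enorm_ge0 ?invr_ge0. Qed.

(** Write [y = Psi x]. If [x] is in [K], then [h y ^+ 2 = dotp y x <= h y]. Conversely
    [dotp z x = 'D_z H y = h y * 'D_z h y], and subadditivity bounds ['D_z h y] by [h z]. *)
Let mem_K x : x != 0 -> body_set K x <-> g x <= 0.
Proof.
move=> x0; have y0 := perturbation_inv_neq0 E_lip E0 x0.
have gE : (g x <= 0) = (h (Psi x) <= 1).
  rewrite subr_le0 /H ler_pdivrMr// mulVf// -[X in _ <= X](expr1n _ 2).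
  by rewrite ler_sqr ?nnegrE.
rewrite gE; split => [Kx|h1].
  have hp : 0 < h (Psi x).
    by apply: lt_le_trans (h_ge _); rewrite mulr_gt0// ?invr_gt0// enorm_gt0.
  have := le_support (Psi x) Kx; rewrite K_support dual_pairing// expr2.
  by rewrite -[leRHS]mulr1 ler_pM2l.
apply: support_mem => z; rewrite K_support -(perturbation_invP E_lip x) -gradH//.
rewrite -(derive_grad _ oP H_smooth y0).
have dh := smooth_on_derivable (v := z) h_smooth y0.
have -> : 'D_z H (Psi x) = h (Psi x) * 'D_z h (Psi x).
  have := @is_deriveM _ _ _ _ _ _ _ _ (@is_deriveX _ _ _ 2 _ _ _ (derivableP dh))
     (@is_derive_cst _ _ _ (2^-1 : R) (Psi x) z).
  rewrite !fctE => -[_ ->].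
  rewrite scaler0 add0r -[LHS]/(_ * (_ * _)) /= expr1 mulrA mulrA mulVf// mul1r.
  by [].
apply: (@le_trans _ _ (h (Psi x) * h z)).
  rewrite ler_wpM2l//; apply: derive_le => // t t0.
  have [hD hZ] := h_sublinear; rewrite lerBlDl.
  by have := hD (Psi x) (t *: z); rewrite (hZ _ _ (ltW t0)).
by rewrite -[leRHS]mul1r ler_wpM2r.
Qed.

Lemma perturbed_body_smooth : smooth_positively_curved K.
Proof.
move=> p Kp np.
(* By [h_ge] the body contains the Euclidean ball of radius 1/2, so its boundary avoids the origin,
   where [g] need not be smooth. The radius is converted to the sup norm, with [n.+1] to cover
   [n = 0]. *)
have p0 : p != 0.
  apply: contra_not_neq np => ->; apply/nbhs_ballP.
  exists (2 * n.+1%:R)^-1; first by rewrite /= invr_gt0 mulr_gt0// ltr0n.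
  move=> x; rewrite -ball_normE /ball_ /= sub0r normrN => xr.
  apply: support_mem => z; rewrite K_support; apply: le_trans (h_ge z).
  apply: (le_trans (cauchy_schwarz _ _)); rewrite mulrC ler_wpM2r ?enorm_ge0//.
  apply: (le_trans (ler_enorm_norm x)).
  apply: (@le_trans _ _ (n.+1%:R * (2 * n.+1%:R)^-1)).
    by apply: ler_pM => //; [rewrite ler_nat|exact: ltW].
  by rewrite invfM mulrCA mulfV ?mulr1// pnatr_eq0.
exists (@punctured R n), g; split => //.
- by move=> x x0; split; [rewrite grad_g//; exact: (perturbation_inv_neq0 E_lip E0)|exact: mem_K].
- exact: curvature_pos.
Qed.

End body.

Lemma smooth_body : exists (e : R) (K : convex_body R n),
  [/\ 0 < e, smooth_positively_curved K &
      support_fun K =1 (fun x => enorm x + e * (f x * enorm x))].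
Proof.
have [e0 e0_gt0 He0] := sublinear_perturbation.
have [B B0 HB] := smooth_bounded_annulus f_smooth.
pose H1 x := dotp x x * f x; pose H2 x := dotp x x * f x ^+ 2 / 2.
have H1_smooth : smooth_on (@punctured R n) H1.
  by apply: smooth_onM => //; exact: smooth_dotpxx.
have H2_smooth : smooth_on (@punctured R n) H2.
  apply: smooth_onM => //; last exact: smooth_on_cst.
  by apply: smooth_onM => //; [exact: smooth_dotpxx|exact: smooth_on_exp].
have H1_homog : homog 2 H1.
  by move=> t x t0 _; rewrite /H1 dotpZl dotpZr f_deg0//; ring.
have H2_homog : homog 2 H2.
  by move=> t x t0 _; rewrite /H2 dotpZl dotpZr f_deg0//; ring.
have lip (G : vec -> R) : smooth_on (@punctured R n) G -> homog 2 G ->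
    exists N : 'I_n -> R, forall j, 0 <= N j /\ forall x y, x != 0 -> y != 0 ->
      `|'D_(delta_mx 0 j) G x - 'D_(delta_mx 0 j) G y| <= N j * enorm (x - y) /\
      `|'D_(delta_mx 0 j) G x| <= N j * enorm x.
  move=> cG hG.
  have Hj j : exists N : R, 0 <= N /\ forall x y, x != 0 -> y != 0 ->
      `|'D_(delta_mx 0 j) G x - 'D_(delta_mx 0 j) G y| <= N * enorm (x - y) /\
      `|'D_(delta_mx 0 j) G x| <= N * enorm x.
    have [N N0 HN] := homog1_lipschitz (smooth_on_D (delta_mx 0 j) cG) (derive_homog (delta_mx 0 j) cG hG).
    by exists N.
  by have [N HN] := choice Hj; exists N.
have [N1 HN1] := lip _ H1_smooth H1_homog; have [N2 HN2] := lip _ H2_smooth H2_homog.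
pose N := \sum_(j < n) (N1 j + N2 j).
have N0 : 0 <= N by apply: sumr_ge0 => j _; rewrite addr_ge0//; [case: (HN1 j)|case: (HN2 j)].
have NN j : N1 j + N2 j <= N.
  rewrite /N (bigD1 j) //= lerDl; apply: sumr_ge0 => k _.
  by rewrite addr_ge0//; [case: (HN1 k)|case: (HN2 k)].
pose M := N * n%:R + B + 1.
have M0 : 0 < M by rewrite ltr_wpDl// addr_ge0// mulr_ge0.
(* The bound 1 gives [e ^+ 2 <= e], [e0] gives sublinearity, and the last one makes [E]
   1/2-Lipschitz for the sup norm, whence the factor [n%:R] in [M], and [e |f|] at most 1/2. *)
pose e := Num.min (Num.min 1 e0) (2 * M)^-1.
have e_gt0 : 0 < e by rewrite !lt_min ltr01 e0_gt0 invr_gt0 mulr_gt0.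
have e1 : e <= 1 by rewrite !ge_min lexx.
have ee0 : e <= e0 by rewrite !ge_min lexx orbT.
have eM : e * M <= 2^-1.
  rewrite -ler_pdivlMr// -invfM.
  by rewrite !ge_min lexx orbT.
have hs := He0 e; rewrite e_gt0 ee0 in hs; have {}hs := hs isT.
have [K HK] := sublinear_body hs.
exists e, K; split => //.
have Dbound (a b c d r : R) j : 0 <= r -> `|a - b| <= N1 j * r -> `|c - d| <= N2 j * r ->
    `|(e * a + e ^+ 2 * c) - (e * b + e ^+ 2 * d)| <= e * (N * r).
  move=> r0 ab cd.
  have -> : e * a + e ^+ 2 * c - (e * b + e ^+ 2 * d) = e * ((a - b) + e * (c - d)) by ring.
  rewrite normrM gtr0_norm// ler_wpM2l ?(ltW e_gt0)//.
  apply: (le_trans (ler_normD _ _)); rewrite normrM (gtr0_norm e_gt0).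
  apply: (@le_trans _ _ ((N1 j + N2 j) * r)); last by rewrite ler_wpM2r.
  rewrite mulrDl lerD//; apply: le_trans cd.
  by rewrite -[leRHS]mul1r ler_wpM2r.
apply: (perturbed_body_smooth hs _ _ HK).
  move=> x y; apply: mx_norm_le => [|i j]; first by rewrite mulr_ge0// invr_ge0.
  have fin r : r <= e * (N * enorm (x - y)) -> r <= 2^-1 * `|x - y|.
    move=> /le_trans; apply; apply: (@le_trans _ _ (e * (N * (n%:R * `|x - y|)))).
      by rewrite ler_wpM2l ?(ltW e_gt0)// ler_wpM2l// ler_enorm_norm.
    rewrite !mulrA ler_wpM2r//; apply: le_trans eM; rewrite -mulrA ler_wpM2l ?(ltW e_gt0)//.
    by rewrite /M -addrA lerDl addr_ge0.
  rewrite !mxE; apply: fin; have [_ L1] := HN1 j; have [_ L2] := HN2 j.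
  have [->|x0] := eqVneq x 0; have [->|y0] := eqVneq y 0.
  - by rewrite !subrr normr0 enorm0 !mulr0.
  - have [_ l1] := L1 y y y0 y0; have [_ l2] := L2 y y y0 y0.
    have := Dbound 0 _ 0 _ _ j (enorm_ge0 y); rewrite !mulr0 addr0 [0 - y]sub0r enormN.
    by apply; rewrite sub0r normrN.
  - have [_ l1] := L1 x x x0 x0; have [_ l2] := L2 x x x0 x0.
    have := Dbound _ 0 _ 0 _ j (enorm_ge0 x); rewrite !mulr0 addr0 [x - 0]subr0.
    by apply; rewrite subr0.
  - have [l1 _] := L1 x y x0 y0; have [l2 _] := L2 x y x0 y0.
    by apply: (Dbound _ _ _ _ _ j); rewrite ?enorm_ge0.
move=> x; have [->|x0] := eqVneq x 0; first by rewrite enorm0 !mulr0 addr0.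
have fB : `|f x| <= B.
  by rewrite -(deg0_unitv f_deg0 x0); apply: HB; rewrite unit_annulus// enorm_unitv.
have : e * `|f x| <= 2^-1.
  apply: le_trans eM; rewrite ler_wpM2l ?(ltW e_gt0)//; apply: (le_trans fB).
  by rewrite /M addrAC lerDr addr_ge0// mulr_ge0.
have := ler_wpM2l (ltW e_gt0) (ler_norm (- f x)); rewrite normrN => h1 h2.
have h3 : 2^-1 <= 1 + e * f x by lra.
have -> : enorm x + e * (f x * enorm x) = (1 + e * f x) * enorm x by ring.
by rewrite ler_wpM2r ?enorm_ge0.
Qed.

End smooth_bodies.

Lemma ball_body_smooth (R : realType) n : smooth_positively_curved (ball_body R n).
Proof.
have [|e [K [_ sK hK]]] := @smooth_body R n (fun=> 0) (smooth_on_cst _ (@open_punctured R n)).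
  by [].
rewrite (_ : ball_body R n = K)//; apply: support_inj => y.
by rewrite hK support_ball mul0r mulr0 addr0.
Qed.

(** * Polynomial approximation of test functions *)

Section bernstein.
Context (R : realType).

(** The binomial probabilities [binom N k X^k (1 - X)^(N - k)], given by the recursion on the last
    trial, so that their sums follow by induction on [N]. *)
Fixpoint bernstein (N k : nat) : {poly R} :=
  if N is M.+1 then
    (1%:P - 'X) * bernstein M k + 'X * (if k is l.+1 then bernstein M l else 0%:P)
  else ((k == 0)%:R)%:P.

Lemma bernstein_gt N k : (N < k)%N -> bernstein N k = 0.
Proof.
elim: N k => [|N IH] [|k] //= Nk.
by rewrite !IH// ?polyC0 ?mulr0 ?addr0// ltnW.
Qed.

Lemma bernstein_ge0 N k (s : R) : 0 <= s <= 1 -> 0 <= (bernstein N k).[s].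
Proof.
move=> /andP[s0 s1]; elim: N k => [|N IH] k /=.
  by rewrite hornerC; case: eqP.
rewrite !(hornerD, hornerM, hornerN, hornerX, hornerC) addr_ge0// mulr_ge0// ?subr_ge0//.
by case: k => [|k]; rewrite ?hornerC.
Qed.

Lemma bernstein_sumS N (F : nat -> R) (s : R) :
  \sum_(k < N.+2) (bernstein N.+1 k).[s] * F k =
  (1 - s) * (\sum_(k < N.+1) (bernstein N k).[s] * F k) +
  s * (\sum_(k < N.+1) (bernstein N k).[s] * F k.+1).
Proof.
have E (k : nat) : (bernstein N.+1 k).[s] * F k = (1 - s) * ((bernstein N k).[s] * F k) +
    s * ((if k is l.+1 then bernstein N l else 0%:P).[s] * F k).
  by rewrite /= !(hornerD, hornerM, hornerN, hornerX, hornerC); ring.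
rewrite (eq_bigr _ (fun (k : 'I_N.+2) _ => E k)) big_split /= -!mulr_sumr; congr (_ * _ + _ * _).
  by rewrite big_ord_recr /= bernstein_gt// hornerC mul0r addr0.
by rewrite big_ord_recl /= hornerC mul0r add0r.
Qed.

Lemma bernstein_sum1 N (s : R) : \sum_(k < N.+1) (bernstein N k).[s] = 1.
Proof.
suff : \sum_(k < N.+1) (bernstein N k).[s] * 1 = 1 by under eq_bigr do rewrite mulr1.
elim: N => [|N IH]; first by rewrite big_ord1 /= hornerC mulr1.
by rewrite (@bernstein_sumS N (fun=> 1)) IH; ring.
Qed.

(** Variance plus squared bias of the binomial law; keeping [c] general closes the induction. *)
Lemma bernstein_moment2 N (c s : R) :
  \sum_(k < N.+1) (bernstein N k).[s] * (k%:R - c) ^+ 2 =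
  N%:R * s * (1 - s) + (N%:R * s - c) ^+ 2.
Proof.
elim: N c => [|N IH] c; first by rewrite big_ord1 /= hornerC; ring.
rewrite (@bernstein_sumS N (fun k => (k%:R - c) ^+ 2)) IH.
under [X in s * X]eq_bigr do rewrite -natr1 -addrA -[1 - c]opprB.
by rewrite IH -natr1; ring.
Qed.

(** Bernstein weights transported affinely from [[0, 1]] to [[-a, a]]; the second moment becomes
    [4 a ^+ 2 s (1 - s) / M], which dictates the choice of [N]. *)
Lemma approximate_identity (a eta : R) : 0 < a -> 0 < eta ->
  exists (N : nat) (w : 'I_N.+1 -> {poly R}) (x : 'I_N.+1 -> R),
    [/\ forall k, `|x k| <= a,
        forall (t : R) k, `|t| <= a -> 0 <= (w k).[t],
        forall t : R, \sum_k (w k).[t] = 1 &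
        forall t : R, `|t| <= a -> \sum_k (w k).[t] * (t - x k) ^+ 2 <= eta].
Proof.
move=> a0 eta0.
have [N HN] : exists N, 4 * a ^+ 2 / eta < N.+1%:R.
  exists (Num.truncn (4 * a ^+ 2 / eta)); exact: truncnS_gt.
pose M := N.+1; pose s (t : R) := (t + a) / (2 * a).
pose sp : {poly R} := ((2 * a)^-1)%:P * ('X + a%:P).
have spE t : sp.[t] = s t by rewrite /sp !hornerE mulrC.
have an0 : a != 0 by rewrite gt_eqF.
have s01 (t : R) : `|t| <= a -> 0 <= s t <= 1.
  move=> /ler_normlP[t1 t2]; rewrite /s; apply/andP; split.
    by rewrite divr_ge0//; lra.
  by rewrite ler_pdivrMr; lra.
exists M, (fun k => bernstein M k \Po sp), (fun k => 2 * a * (k%:R / M%:R) - a).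
have M0 : 0 < M%:R :> R by rewrite ltr0n.
split.
- move=> k.
  have k0 : 0 <= (k%:R / M%:R : R) by rewrite divr_ge0.
  have k1 : (k%:R / M%:R : R) <= 1 by rewrite ler_pdivrMr// mul1r ler_nat -ltnS.
  rewrite ler_norml; apply/andP; split; nra.
- by move=> t k ta; rewrite horner_comp spE bernstein_ge0// s01.
- move=> t; rewrite -[RHS](bernstein_sum1 M (s t)); apply: eq_bigr => k _.
  by rewrite horner_comp spE.
- move=> t ta; have /andP[s0 s1] := s01 _ ta.
  have E (k : 'I_M.+1) : (bernstein M k \Po sp).[t] * (t - (2 * a * (k%:R / M%:R) - a)) ^+ 2 =
      (4 * a ^+ 2 / M%:R ^+ 2) * ((bernstein M k).[s t] * (k%:R - M%:R * s t) ^+ 2).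
    rewrite horner_comp spE /s; field.
    by rewrite an0 gt_eqF.
  rewrite (eq_bigr _ (fun k _ => E k)) -mulr_sumr bernstein_moment2 subrr expr0n addr0.
  have -> : 4 * a ^+ 2 / M%:R ^+ 2 * (M%:R * s t * (1 - s t)) = (4 * a ^+ 2 / M%:R) * (s t * (1 - s t)).
    by field; rewrite gt_eqF.
  apply: (@le_trans _ _ (4 * a ^+ 2 / M%:R * 1)).
    apply: ler_wpM2l; first by rewrite divr_ge0// mulr_ge0// sqr_ge0.
    by move: (s t) s0 s1 => u u0 u1; nra.
  by rewrite mulr1 ler_pdivrMr// [eta * _]mulrC -ler_pdivrMr// ltW.
Qed.

Lemma poly_primitive (p : {poly R}) (a : R) : exists2 q : {poly R}, q^`() = p & q.[a] = 0.
Proof.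
pose q0 := \poly_(i < (size p).+1) (p`_i.-1 / i%:R).
have dq : q0^`() = p.
  apply/polyP => i; rewrite coef_deriv coef_poly ltnS /=.
  case: ltnP => ip; last by rewrite mul0rn nth_default.
  by rewrite -[LHS]mulr_natr divfK// pnatr_eq0.
exists (q0 - q0.[a]%:P); first by rewrite derivB derivC subr0.
by rewrite !hornerE subrr.
Qed.

End bernstein.

(** * Weierstrass approximation by products of one-variable polynomials *)

Section tensor_polynomials.
Context (R : realType) (p q : nat).
Local Notation mat := 'M[R]_(p, q).
Implicit Types (F G : mat -> R) (X Y : mat).

(** A coefficient with one univariate polynomial per matrix entry. Such a term is a product over the
    rows, hence a tensor product of functions of the single points of the sphere. *)
Definition monomial_data := seq (R * ('I_p -> 'I_q -> {poly R})).

Definition tensor_poly (s : monomial_data) X : R :=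
  \sum_(c <- s) c.1 * \prod_i \prod_j (c.2 i j).[X i j].

Lemma smooth_horner (O : set mat) (r : {poly R}) i j : open O ->
  smooth_on O (fun X => r.[X i j]).
Proof.
move=> oO; apply: (@smooth_on_ext _ _ _ (fun X => \sum_(k < size r) r`_k * X i j ^+ k)) => //.
  by move=> X _; rewrite horner_coef.
apply: smooth_on_sum => // k _; apply: smooth_onZ => //; apply: smooth_on_exp => //.
exact: smooth_on_coord.
Qed.

Lemma smooth_tensor_poly (O : set mat) s : open O -> smooth_on O (tensor_poly s).
Proof.
move=> oO; apply: smooth_on_sum => // c _; apply: smooth_onZ => //.
by do 2! (apply: smooth_on_prod => // ? _); exact: smooth_horner.
Qed.

(** The modulus of continuity is stated with a quadratic term because the error is averaged against
    product weights, of which only the variances are known. *)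
Lemma weierstrass G (a : R) : 0 < a ->
  (forall e : R, 0 < e -> exists2 C : R, 0 <= C & forall X Y, `|X| <= a -> `|Y| <= a ->
     `|G X - G Y| <= e + C * \sum_ij (X ij.1 ij.2 - Y ij.1 ij.2) ^+ 2) ->
  forall e : R, 0 < e -> exists s, forall X, `|X| <= a -> `|G X - tensor_poly s X| <= e.
Proof.
move=> a0 HG e e0; have e2 : 0 < e / 2 by rewrite divr_gt0.
have [C C0 HC] := HG _ e2.
pose D : R := C * (#|{: 'I_p * 'I_q}|)%:R + 1.
have D0 : 0 < D by rewrite ltr_wpDl// mulr_ge0.
have eta0 : 0 < e / 2 / D by rewrite divr_gt0.
have [N [w [x [xa w0 w1 w2]]]] := approximate_identity a0 eta0.
pose T := ('I_p * 'I_q)%type.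
pose grid (f : {ffun T -> 'I_N.+1}) : mat := \matrix_(i, j) x (f (i, j)).
pose W (f : {ffun T -> 'I_N.+1}) X := \prod_(ij : T) (w (f ij)).[X ij.1 ij.2].
exists [seq (G (grid f), fun i j => w (f (i, j))) | f <- enum {: {ffun T -> 'I_N.+1}}] => X Xa.
have tE : tensor_poly [seq (G (grid f), fun i j => w (f (i, j))) | f <- enum {: {ffun T -> 'I_N.+1}}] X =
    \sum_f W f X * G (grid f).
  rewrite /tensor_poly big_map big_enum /=; apply: eq_bigr => f _; rewrite mulrC; congr (_ * _).
  by rewrite pair_bigA /=; apply: eq_bigr => -[].
have Xij ij : `|X ij.1 ij.2| <= a by exact: le_trans (ler_mxentry _ _ _) Xa.
have W0 f : 0 <= W f X by apply: prodr_ge0 => ij _; exact: w0.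
have W1 : \sum_f W f X = 1.
  rewrite /W -(bigA_distr_bigA (fun (ij : T) k => (w k).[X ij.1 ij.2])) /=.
  by rewrite big1.
have W2 (ij : T) : \sum_f W f X * (X ij.1 ij.2 - x (f ij)) ^+ 2 <= e / 2 / D.
  have -> : \sum_f W f X * (X ij.1 ij.2 - x (f ij)) ^+ 2 =
    \sum_(f : {ffun T -> 'I_N.+1}) \prod_(kl : T) ((w (f kl)).[X kl.1 kl.2] *
       (if kl == ij then (X ij.1 ij.2 - x (f kl)) ^+ 2 else 1)).
    apply: eq_bigr => f _; rewrite big_split /=; congr (_ * _).
    rewrite (bigD1 ij) //= eqxx big1 ?mulr1// => kl klij; by rewrite (negbTE klij).
  rewrite -(bigA_distr_bigA (fun (kl : T) k => (w k).[X kl.1 kl.2] *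
     (if kl == ij then (X ij.1 ij.2 - x k) ^+ 2 else 1))) /=.
  rewrite (bigD1 ij) //= [X in _ * X]big1 ?mulr1.
    by rewrite eqxx; exact: w2.
  move=> kl klij; under eq_bigr do rewrite (negbTE klij) mulr1.
  exact: w1.
rewrite tE -[G X]mul1r -W1 mulr_suml -sumrB.
apply: (le_trans (ler_norm_sum _ _ _)).
apply: (@le_trans _ _ (\sum_f W f X * (e / 2 + C * \sum_(ij : T) (X ij.1 ij.2 - x (f ij)) ^+ 2))).
  apply: ler_sum => f _; rewrite -mulrBr normrM (ger0_norm (W0 f)) ler_wpM2l//.
  have ga : `|grid f| <= a by apply: mx_norm_le (ltW a0) _ => i j; rewrite mxE.
  apply: (le_trans (HC _ _ Xa ga)); rewrite lerD2l ler_wpM2l//.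
  by apply: ler_sum => -[i j] _; rewrite mxE.
under eq_bigr do rewrite mulrDr [_ * (C * _)]mulrCA mulr_sumr.
rewrite big_split /= -mulr_suml W1 mul1r -mulr_sumr exchange_big /=.
rewrite {2}(splitr e) lerD2l.
apply: (@le_trans _ _ (C * \sum_(ij : T) (e / 2 / D))).
  by rewrite ler_wpM2l// ler_sum// => ij _; exact: W2.
rewrite sumr_const -[_ *+ _]mulr_natl mulrA mulrA ler_pdivrMr//.
by rewrite [leRHS]mulrC ler_wpM2r ?(ltW e2)// /D lerDl.
Qed.

End tensor_polynomials.

(** * Simultaneous approximation of iterated partial derivatives *)

Section iterated_partials.
Context (R : realType) (p q : nat).
Local Notation mat := 'M[R]_(p, q).
Implicit Types (f g F : mat -> R) (X Y : mat) (O : set mat) (s : seq ('I_p * 'I_q)).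
Local Notation ed ij := (delta_mx ij.1 ij.2 : mat).

Lemma iter_partial_smooth O s f : smooth_on O f -> smooth_on O (iter_partial s f).
Proof. by elim: s => //= ij s IH cf; apply: smooth_on_D; exact: IH. Qed.

Lemma iter_partial_ext O s f g : open O -> (forall X, O X -> f X = g X) ->
  forall X, O X -> iter_partial s f X = iter_partial s g X.
Proof.
move=> oO fg; elim: s => //= ij s IH X OX; apply: near_eq_derive.
by apply: filterS (open_nbhs_nbhs (conj oO OX)) => Y; exact: IH.
Qed.

Lemma iter_partial_commute O s f ij : open O -> smooth_on O f ->
  forall X, O X -> iter_partial s ('D_(ed ij) f : mat -> R) X = 'D_(ed ij) (iter_partial s f) X.
Proof.
move=> oO cf; elim: s => //= kl s IH X OX.
rewrite -(schwarz (delta_mx ij.1 ij.2) (delta_mx kl.1 kl.2) oO (iter_partial_smooth s cf 2%N) OX).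
apply: near_eq_derive.
by apply: filterS (open_nbhs_nbhs (conj oO OX)) => Y; exact: IH.
Qed.

Lemma iter_partial_rem O s f ij : open O -> smooth_on O f -> ij \in s ->
  forall X, O X -> iter_partial s f X = iter_partial (rem ij s) ('D_(ed ij) f : mat -> R) X.
Proof.
move=> oO cf; elim: s => //= kl s IH; have [->|klij] := eqVneq kl ij => ijs X OX.
  by rewrite (iter_partial_commute _ _ oO cf).
rewrite /=; apply: near_eq_derive.
apply: filterS (open_nbhs_nbhs (conj oO OX)) => Y OY; apply: IH => //.
by move: ijs; rewrite inE eq_sym (negbTE klij).
Qed.

Lemma derive_constant_line f X (v : mat) : (forall h : R, f (X + h *: v) = f X) ->
  is_derive X v f 0.
Proof.
move=> H.
have E : (fun h : R => h^-1 *: ((f \o shift X) (h *: v) - f X)) = cst 0.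
  by apply/funext => h /=; rewrite [_ + X]addrC H subrr scaler0.
split; first by rewrite /derivable E; exact: is_cvg_cst.
by rewrite /derive E; exact: lim_cst.
Qed.

Lemma derive_coord X (v : mat) i j : is_derive X v (fun Y : mat => Y i j) (v i j).
Proof.
split; first exact: (smooth_on_derivable (smooth_on_coord i j openT)).
rewrite (deriveE _ (differentiable_coord _ _ _)).
have @c : {linear mat -> R}.
  by exists (fun N : mat => N i j); do 2![eexists]; do ?[constructor];
    rewrite ?mxE// => ? *; rewrite ?mxE//; move=> ?; rewrite !mxE.
by rewrite -[LHS]/('d c X v) diff_lin//; exact: coord_continuous.
Qed.

(** Directions other than [ij] are tangent to the hyperplane on which [f] vanishes. *)
Lemma iter_partial_face s f ij (a : R) : ij \notin s ->
  (forall X, X ij.1 ij.2 = a -> f X = 0) ->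
  forall X, X ij.1 ij.2 = a -> iter_partial s f X = 0.
Proof.
elim: s => //= kl s IH; rewrite inE negb_or => /andP[klij ijs] f0 X Xa.
have H := IH ijs f0.
have HL (h : R) : iter_partial s f (X + h *: ed kl) = iter_partial s f X.
  rewrite !H// !mxE Xa; case: ij kl klij {ijs f0 Xa IH H} => [i j] [k l] /=.
  by rewrite xpair_eqE negb_and => /orP[] /negbTE ->; rewrite ?andbF mulr0 addr0.
by have [_ ->] := derive_constant_line HL.
Qed.

Lemma tensor_poly_primitive (d : monomial_data R p q) ij (a : R) :
  exists d' : monomial_data R p q,
    (forall X, is_derive X (ed ij) (tensor_poly d') (tensor_poly d X)) /\
    (forall X, X ij.1 ij.2 = a -> tensor_poly d' X = 0).
Proof.
have [pr prP] : exists pr : {poly R} -> {poly R}, forall r, (pr r)^`() = r /\ (pr r).[a] = 0.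
  have H r : exists r' : {poly R}, r'^`() = r /\ r'.[a] = 0.
    by have [r' h1 h2] := poly_primitive r a; exists r'.
  by have [pr H'] := choice H; exists pr.
pose T := ('I_p * 'I_q)%type.
pose up (c : R * ('I_p -> 'I_q -> {poly R})) : R * ('I_p -> 'I_q -> {poly R}) :=
  (c.1, fun k l => if (k, l) == ij then pr (c.2 k l) else c.2 k l).
have splitP (c : R * ('I_p -> 'I_q -> {poly R})) X (c' : 'I_p -> 'I_q -> {poly R}) :
    (forall kl : T, kl != ij -> c' kl.1 kl.2 = c.2 kl.1 kl.2) ->
    \prod_i \prod_j (c' i j).[X i j] =
   (c' ij.1 ij.2).[X ij.1 ij.2] * \prod_(kl : T | kl != ij) (c.2 kl.1 kl.2).[X kl.1 kl.2].
  move=> cc; rewrite pair_bigA (bigD1 ij) //=; congr (_ * _).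
  by apply: eq_bigr => kl klij; rewrite cc.
exists [seq up c | c <- d]; split => [X|X Xa]; last first.
  rewrite /tensor_poly big_map big1// => c _.
  rewrite (splitP c) => [|kl klij]; last by rewrite /up /= -surjective_pairing (negbTE klij).
  rewrite /up /= -surjective_pairing eqxx Xa.
  by have [_ ->] := prP (c.2 ij.1 ij.2); rewrite mul0r mulr0.
rewrite (_ : tensor_poly [seq up c | c <- d] =
    fun X => \sum_(c <- d) c.1 * \prod_i \prod_j ((up c).2 i j).[X i j]); last first.
  by apply/funext => Y; rewrite /tensor_poly big_map.
rewrite /tensor_poly; apply: is_derive_bigsum => c.
rewrite (splitP c X c.2)//.
rewrite (_ : (fun Y => c.1 * _) = (fun Y : mat => (c.1 * (pr (c.2 ij.1 ij.2)).[Y ij.1 ij.2]) * 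
    \prod_(kl : T | kl != ij) (c.2 kl.1 kl.2).[Y kl.1 kl.2])); last first.
  apply/funext => Y; rewrite (splitP c) => [|kl klij]; last by rewrite /up /= -surjective_pairing (negbTE klij).
  by rewrite /up /= -surjective_pairing eqxx mulrA.
have d1 : is_derive X (ed ij) (fun Y : mat => (pr (c.2 ij.1 ij.2)).[Y ij.1 ij.2]) ((c.2 ij.1 ij.2).[X ij.1 ij.2]).
  have := is_derive_comp1 (derive_coord X (ed ij) ij.1 ij.2) (is_derive_poly (pr (c.2 ij.1 ij.2)) (X ij.1 ij.2)).
  by rewrite mxE !eqxx mulr1 (prP _).1.
have d2 : is_derive X (ed ij) (fun Y : mat => \prod_(kl : T | kl != ij) (c.2 kl.1 kl.2).[Y kl.1 kl.2]) 0.
  apply: derive_constant_line => h; apply: eq_bigr => -[k l] klij; rewrite !mxE /=.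
  move: klij; rewrite [ij]surjective_pairing xpair_eqE negb_and.
  by case/orP => /negbTE ->; rewrite ?andbF mulr0 addr0.
have d3 := @is_deriveM _ _ _ _ _ _ _ _ (@is_deriveZ _ _ _ _ (c.1 : R) _ _ _ d1) d2.
apply: (is_derive_eq d3).
by rewrite scaler0 add0r /GRing.scale /=; ring.
Qed.

Lemma compact_cube (a : R) : compact [set X : mat | `|X| <= a].
Proof.
pose B := [set v : 'rV[R]_(p * q) | `|v| <= a].
have kB : compact B.
  apply: bounded_closed_compact.
    exists a; split; first exact: num_real.
    by move=> t rt y By; exact: le_trans By (ltW rt).
  apply: (@preimage_closed _ _ (fun y : 'rV[R]_(p * q) => `|y|) [set t : R | t <= a]).
    by move=> y _; exact: norm_continuous.
  exact: closed_le.
have -> : [set X : mat | `|X| <= a] = (@vec_mx R p q) @` B.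
  apply/seteqP; split => [X Xa|_ [v vB <-]].
    exists (mxvec X); last exact: mxvecK.
    rewrite /B /=; apply: mx_norm_le; first exact: le_trans Xa.
    move=> i j; rewrite ord1; case/mxvec_indexP: j => k l; rewrite mxvecE.
    exact: le_trans (ler_mxentry _ _ _) Xa.
  rewrite /=; apply: mx_norm_le; first exact: le_trans vB.
  by move=> i j; rewrite mxE; exact: le_trans (ler_mxentry _ _ _) vB.
apply: continuous_compact kB; apply: continuous_subspaceT => v.
apply: continuous_entries => i j.
have -> : (fun y : 'rV[R]_(p * q) => vec_mx y i j) = (fun y => y 0 (mxvec_index i j)).
  by apply/funext => y; rewrite mxE.
exact: coord_continuous.
Qed.

Lemma smooth_bounded_cube f (a : R) : smooth_on setT f ->
  exists2 M : R, 0 <= M & forall X, `|X| <= a -> `|f X| <= M.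
Proof.
move=> cf; have [[X0 HX0]|nA] := pselect ([set X : mat | `|X| <= a] !=set0); last first.
  by exists 0 => // X Xa; exfalso; apply: nA; exists X.
have [|||c cA cmax] := @compact_EVT_max _ _ (fun x => `|f x|) [set X : mat | `|X| <= a].
- by exists X0.
- exact: compact_cube.
- apply: continuous_subspaceT => x; apply: continuous_comp; last exact: norm_continuous.
  exact: (smooth_on_continuous cf).
by exists `|f c| => // x Ax; apply: cmax; rewrite inE.
Qed.

Lemma smooth_quadratic_modulus F (a : R) : smooth_on setT F ->
  forall e : R, 0 < e -> exists2 C : R, 0 <= C & forall X Y, `|X| <= a -> `|Y| <= a ->
     `|F X - F Y| <= e + C * \sum_ij (X ij.1 ij.2 - Y ij.1 ij.2) ^+ 2.
Proof.
move=> cF e e0.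
have H (ij : 'I_p * 'I_q) : exists M : R, 0 <= M /\ forall X, `|X| <= a -> `|'D_(ed ij) F X| <= M.
  by have [M M0 HM] := smooth_bounded_cube a (smooth_on_D (delta_mx ij.1 ij.2) cF); exists M.
have [M HM] := choice H.
pose S := \sum_ij M ij.
have MS ij : M ij <= S.
  by rewrite /S (bigD1 ij) //= lerDl; apply: sumr_ge0 => kl _; have [] := HM kl.
have S0 : 0 <= S by apply: sumr_ge0 => kl _; have [] := HM kl.
pose k : R := #|{: 'I_p * 'I_q}|%:R + 1.
have k0 : 0 < k by rewrite ltr_wpDl.
(* Each summand is bounded by [S r <= t + (S r) ^+ 2 / t], and the copies of [t], one per entry,
   must sum to at most [e]. *)
have [t t0 tE] : exists2 t : R, 0 < t & t = e / k by exists (e / k); rewrite ?divr_gt0.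
exists (S ^+ 2 / t); first by rewrite divr_ge0 ?sqr_ge0 ?ltW.
move=> X Y Xa Ya.
have [|c /andP[c0 c1] E] := @mvt_line R _ F Y (X - Y).
  by move=> u _; exact: (smooth_on_derivable cF).
have Za : `|Y + c *: (X - Y)| <= a.
  have -> : Y + c *: (X - Y) = c *: X + (1 - c) *: Y.
    by apply/matrixP => i j; rewrite !mxE; ring.
  apply: (le_trans (ler_normD _ _)); rewrite !normrZ (ger0_norm c0) ger0_norm ?subr_ge0//.
  have c1' : 0 <= 1 - c by rewrite subr_ge0.
  have := ler_wpM2l c0 Xa; have := ler_wpM2l c1' Ya; lra.
have {E} -> : F X - F Y = 'D_(X - Y) F (Y + c *: (X - Y)) by rewrite -E [Y + _]addrC subrK.
set Z := Y + c *: (X - Y) in Za *.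
have dF := Ck1_differentiable (@openT mat) (cF 1%N) (I : setT Z).
have -> : 'D_(X - Y) F Z = \sum_ij (X ij.1 ij.2 - Y ij.1 ij.2) * 'D_(ed ij) F Z.
  rewrite (deriveE _ dF) {1}[X - Y]matrix_sum_entries /entries big_enum /= linear_sum.
  by apply: eq_bigr => ij _; rewrite linearZ /= !mxE (deriveE _ dF).
apply: (le_trans (ler_norm_sum _ _ _)).
apply: (@le_trans _ _ (\sum_(ij : 'I_p * 'I_q) (t + S ^+ 2 / t * (X ij.1 ij.2 - Y ij.1 ij.2) ^+ 2))).
  apply: ler_sum => ij _; set d := X ij.1 ij.2 - Y ij.1 ij.2.
  have h1 : `|d * 'D_(ed ij) F Z| <= `|d| * S.
    by rewrite normrM ler_wpM2l//; have [_ HMij] := HM ij; apply: (le_trans (HMij _ Za)).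
  apply: (le_trans h1); rewrite -(real_normK (num_real d)); set r := `|d|.
  have r0 : 0 <= r by exact: normr_ge0.
  have -> : S ^+ 2 / t * r ^+ 2 = (r * S) ^+ 2 / t by rewrite exprMn; ring.
  have rS : 0 <= r * S by exact: mulr_ge0.
  rewrite -(ler_pM2l t0) mulrDr [t * (_ / t)]mulrC divfK ?gt_eqF//.
  move: (r * S) rS => u u0; have := sqr_ge0 (t - u); rewrite sqrrB !expr2; nra.
rewrite big_split /= -mulr_sumr lerD2r sumr_const -[_ *+ _]mulr_natl tE mulrA ler_pdivrMr//.
by rewrite [leRHS]mulrC ler_wpM2r ?(ltW e0)// /k lerDl.
Qed.

(* Taking the last coordinate of [L] first: approximate ['D_ij F], then integrate
   from the face [X ij = - a], on which [F] vanishes to infinite order. *)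
Lemma Ck_weierstrass (a b : R) (L : seq ('I_p * 'I_q)) F (e : R) : b < a -> 0 < a -> smooth_on setT F ->
  (forall X, b < `|X| -> F X = 0) -> 0 < e ->
  exists d : monomial_data R p q, forall s, (forall ij, (count_mem ij s <= count_mem ij L)%N) ->
    forall X, `|X| <= a -> `|iter_partial s (fun Y => F Y - tensor_poly d Y) X| <= e.
Proof.
move=> ba a0; elim: L F e => [|ij L IH] F e cF F0 e0.
  have [d Hd] := weierstrass a0 (smooth_quadratic_modulus a cF) e0.
  exists d => s Hs X Xa; have -> : s = [::].
    by case: s Hs => // kl s /(_ kl); rewrite /= eqxx.
  exact: Hd.
(* [2 a] is the largest distance to the face inside the cube; the summand 1 makes the same tolerance
   suffice for derivatives that involve [ij]. *)
have e'0 : 0 < e / (2 * a + 1) by rewrite divr_gt0//; lra.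
have [|d Hd] := IH ('D_(ed ij) F : mat -> R) _ (smooth_on_D _ cF) _ e'0.
  move=> X bX.
  have oB : open [set Y : mat | b < `|Y|].
    apply: (@open_comp _ _ (fun Y : mat => `|Y|) [set t : R | b < t]).
      by move=> Y _; exact: norm_continuous.
    exact: open_gt.
  rewrite -(derive_cst (0 : R) X (delta_mx ij.1 ij.2)); apply: near_eq_derive.
  by apply: filterS (open_nbhs_nbhs (conj oB bX)) => Y bY; rewrite F0.
have [d' [dd' d'0]] := tensor_poly_primitive d ij (- a).
exists d'; pose D Y := F Y - tensor_poly d' Y.
have cD : smooth_on setT D.
  by apply: smooth_onB => //; [exact: openT|exact: smooth_tensor_poly openT].
have DD : 'D_(ed ij) D = (fun Y => 'D_(ed ij) F Y - tensor_poly d Y).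
  apply/funext => Y; have [h1 <-] := dd' Y.
  by rewrite /D -deriveB//; exact: (smooth_on_derivable cF).
have D_face X : X ij.1 ij.2 = - a -> D X = 0.
  move=> Xa; rewrite /D d'0// subr0 F0//; apply: (lt_le_trans ba).
  by have := ler_mxentry X ij.1 ij.2; rewrite Xa normrN gtr0_norm.
(* If [s] contains [ij], that derivative is performed first and the bound on ['D_ij F] applies to
   the remaining ones. Otherwise the error vanishes on the face, and the mean value theorem from the
   projection [X'] on the face bounds it. *)
move=> s Hs X Xa; have [ijs|ijs] := boolP (ij \in s).
  rewrite -/D (iter_partial_rem openT cD ijs)// DD.
  apply: (@le_trans _ _ (e / (2 * a + 1))); last first.
    by rewrite ler_pdivrMr; [rewrite ler_peMr ?ltW//; lra|lra].
  apply: Hd => // kl; rewrite count_rem ijs /= leq_subLR; exact: Hs.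
have Hs' kl : (count_mem kl s <= count_mem kl L)%N.
  have [<-|ijkl] := eqVneq ij kl.
    by rewrite (count_memPn ijs).
  by have := Hs kl; rewrite /= (negbTE ijkl).
pose t := X ij.1 ij.2 + a; pose X' := X - t *: ed ij.
have Xij : `|X ij.1 ij.2| <= a := le_trans (ler_mxentry _ _ _) Xa.
have /andP[t0 t1] : 0 <= t <= 2 * a.
  by move/ler_normlP: Xij => [h1 h2]; rewrite /t; apply/andP; split; lra.
pose G := iter_partial s D.
have cG : smooth_on setT G by exact: iter_partial_smooth.
have GX' : G X' = 0.
  apply: (iter_partial_face ijs D_face).
  by rewrite /X' !mxE !eqxx mulr1 /t opprD addrA subrr add0r.
have [|c /andP[c0 c1] E] := @mvt_line R _ G X' (t *: ed ij).
  by move=> u _; exact: (smooth_on_derivable cG).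
have {E} : G X = t * 'D_(ed ij) G (X' + c *: (t *: ed ij)).
  rewrite -deriveZdir; last exact: (smooth_on_derivable cG).
  by rewrite -E /X' subrK GX' subr0.
rewrite -/G => ->.
have Za : `|X' + c *: (t *: ed ij)| <= a.
  apply: mx_norm_le (ltW a0) _ => k l.
  have Xkl : `|X k l| <= a := le_trans (ler_mxentry _ _ _) Xa.
  have [kl|kl] := eqVneq (k, l) ij.
    rewrite /X' !mxE -kl /= !eqxx !mulr1 /t -kl /=.
    move/ler_normlP: Xkl => [h1 h2]; rewrite ler_norml; apply/andP; split; nra.
  suff -> : (X' + c *: (t *: ed ij)) k l = X k l by [].
  rewrite /X' !mxE; move: kl; rewrite [in X in X -> _](surjective_pairing ij) xpair_eqE => /negbTE ->.
  by rewrite !mulr0 subr0 addr0.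
rewrite /G -(iter_partial_commute s ij openT cD)// DD normrM (ger0_norm t0).
apply: (@le_trans _ _ (2 * a * (e / (2 * a + 1)))).
  by apply: ler_pM => //; exact: Hd.
by rewrite mulrA ler_pdivrMr; [rewrite mulrC ler_wpM2l ?(ltW e0)//; lra|lra].
Qed.

End iterated_partials.

Lemma open_forall (T : topologicalType) (I : finType) (O : I -> set T) :
  (forall i, open (O i)) -> open [set x | forall i, O i x].
Proof.
move=> oO; rewrite openE => x Ox; rewrite /interior.
have H : \forall y \near x, forall i, O i y.
  by apply: filter_forall => i; exact: open_nbhs_nbhs (conj (oO i) (Ox i)).
exact: H.
Qed.

(** * Test functions on products of spheres *)

Section sphere_product.
Context (R : realType) (r n : nat).
Local Notation mat := 'M[R]_(r, n).
Local Notation vec := 'rV[R]_n.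
Implicit Types (X Y : mat) (f G c : mat -> R) (s : seq ('I_r * 'I_n)).
Local Notation ed ij := (delta_mx ij.1 ij.2 : mat).

Definition rows_neq0 : set mat := [set X | forall i, row i X != 0].
Local Notation N := (@normalize_rows R n r).

Lemma row_continuous i : continuous (fun X : mat => row i X).
Proof.
move=> X; apply: continuous_entries => a j.
rewrite (_ : (fun y : mat => row i y a j) = (fun y : mat => y i j)).
  exact: coord_continuous.
by apply/funext => y; rewrite mxE.
Qed.

Lemma open_row_preimage i (O : set vec) : open O -> open [set X : mat | O (row i X)].
Proof. by move=> oO; apply: open_comp => // X _; exact: row_continuous. Qed.

Lemma open_rows_neq0 : open rows_neq0.
Proof. by apply: open_forall => i; apply: (open_row_preimage (O := @punctured R n)); exact: open_punctured. Qed.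

Lemma smooth_row (O : set vec) (O' : set mat) (g : vec -> R) i : open O -> open O' ->
  (forall X, O' X -> O (row i X)) -> smooth_on O g -> smooth_on O' (fun X => g (row i X)).
Proof.
move=> oO oO' OO cg; apply: (smooth_on_comp_mx (Phi := fun X => row i X) oO oO' OO cg) => a j.
apply: (@smooth_on_ext _ _ _ (fun X => X i j)) => //; last exact: smooth_on_coord.
by move=> X _; rewrite mxE.
Qed.

Lemma row_normalize X i : row i (N X) = unitv (row i X).
Proof. by apply/rowP => j; rewrite !mxE mulrC. Qed.

Lemma normalize_rows_neq0 X : rows_neq0 X -> rows_neq0 (N X).
Proof.
by move=> HX i; rewrite row_normalize -enorm_gt0 enorm_unitv// HX.
Qed.

Lemma normalize_sphere X : rows_neq0 X -> sphere_pow (N X).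
Proof. by move=> HX i; rewrite row_normalize; apply: enorm_unitv; exact: HX. Qed.

Lemma sphere_rows_neq0 X : sphere_pow X -> rows_neq0 X.
Proof. by move=> HX i; rewrite -enorm_gt0 HX. Qed.

Lemma normalize_id X : sphere_pow X -> N X = X.
Proof. by move=> HX; apply/matrixP => i j; rewrite !mxE HX divr1. Qed.

Lemma smooth_normalize i j : smooth_on rows_neq0 (fun X => N X i j).
Proof.
have oW := open_rows_neq0.
apply: (@smooth_on_ext _ _ _ (fun X => X i j * (enorm (row i X))^-1)) => //.
  by move=> X _; rewrite mxE.
apply: smooth_onM => //; first exact: smooth_on_coord.
apply: smooth_onV => //.
  by move=> X HX; rewrite enorm_eq0; exact: HX.
by apply: (smooth_row (@open_punctured R n) oW _ (@smooth_enorm R n)) => X HX; exact: HX.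
Qed.

Lemma smooth_normalized_row (g : vec -> R) i : smooth_on (@punctured R n) g ->
  smooth_on rows_neq0 (fun X => g (row i (N X))).
Proof.
move=> cg; apply: (smooth_on_comp_mx (Phi := fun X => row i (N X)) (@open_punctured R n) open_rows_neq0 _ cg).
  by move=> X /normalize_rows_neq0; apply.
move=> a j; apply: smooth_on_ext (smooth_normalize i j); first exact: open_rows_neq0.
by move=> X _; rewrite [RHS]mxE.
Qed.

Lemma sphere_smooth_tensor (g : 'I_r -> vec -> R) :
  (forall i, smooth_on (@punctured R n) (g i)) ->
  sphere_smooth (fun X : mat => \prod_i g i (row i X)).
Proof.
move=> cg; apply: smooth_on_prod => [|i _]; first exact: open_rows_neq0.
exact: smooth_normalized_row.
Qed.

Lemma sphere_smoothD (a : R) f G : sphere_smooth f -> sphere_smooth G ->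
  sphere_smooth (fun X => a * f X + G X).
Proof.
move=> cf cG; apply: smooth_onD => //; first exact: open_rows_neq0.
by apply: smooth_onZ => //; exact: open_rows_neq0.
Qed.

Lemma compact_sphere_pow : compact (@sphere_pow R n r).
Proof.
apply: (subclosed_compact _ (@compact_cube R r n 1)).
  have -> : @sphere_pow R n r = \bigcap_(i in [set: 'I_r]) [set X : mat | usphere (row i X)].
    by apply/seteqP; split => [X HX i _|X HX i]; [exact: HX|exact: HX].
  apply: closed_bigI => i _.
  by apply: preimage_closed => [X _|]; [exact: row_continuous|exact: closed_usphere].
move=> X HX /=; apply: mx_norm_le => // i j.
by rewrite -(HX i); have := ler_entry_enorm (row i X) j; rewrite mxE.
Qed.

Lemma smooth_bounded_sphere c : smooth_on rows_neq0 c ->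
  exists2 M : R, 0 <= M & forall X, sphere_pow X -> `|c X| <= M.
Proof.
move=> cc; have [[X0 HX0]|nA] := pselect (@sphere_pow R n r !=set0); last first.
  by exists 0 => // X Xa; exfalso; apply: nA; exists X.
have [|||M cA cmax] := @compact_EVT_max _ _ (fun x => `|c x|) (@sphere_pow R n r).
- by exists X0.
- exact: compact_sphere_pow.
- apply: continuous_in_subspaceT => X; rewrite inE => HX.
  apply: continuous_comp; last exact: norm_continuous.
  exact: (smooth_on_continuous cc (sphere_rows_neq0 HX)).
by exists `|c M| => // x Ax; apply: cmax; rewrite inE.
Qed.

(** Iterated chain and product rules. The list [L] depends on [s] and [c] but not on [G], which is
    what yields a bound uniform in [G]. Its elements contain functions, hence [List.In]. *)
Lemma iter_partial_normalize c s : smooth_on rows_neq0 c ->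
  exists L : seq (seq ('I_r * 'I_n) * (mat -> R)),
    (forall e, List.In e L -> (size e.1 <= size s)%N /\ smooth_on rows_neq0 e.2) /\
    forall G, smooth_on setT G -> forall X, rows_neq0 X ->
      iter_partial s (fun Y => G (N Y) * c Y) X =
      \sum_(e <- L) iter_partial e.1 G (N X) * e.2 X.
Proof.
have oW := open_rows_neq0.
move=> cc; elim: s => [|kl s [L [HL EL]]].
  exists [:: ([::], c)]; split => [e [<-|[]]|G cG X HX] //.
  by rewrite big_seq1.
pose dN ij : mat -> R := 'D_(ed kl) (fun Y => N Y ij.1 ij.2).
have cdN ij : smooth_on rows_neq0 (dN ij) by apply: smooth_on_D; exact: smooth_normalize.
pose next (e : seq ('I_r * 'I_n) * (mat -> R)) : seq (seq ('I_r * 'I_n) * (mat -> R)) :=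
  (e.1, 'D_(ed kl) e.2 : mat -> R) ::
  [seq (ij :: e.1, fun Y => dN ij Y * e.2 Y) | ij <- entries r n].
exists (flatten [seq next e | e <- L]); split.
  move=> e; elim: L HL {EL} => //= e0 L IH HL.
  have [s0 c0] := HL e0 (or_introl erefl).
  rewrite List.in_app_iff => -[<-|[|hL]].
  - by split; [exact: leqW|exact: smooth_on_D].
  - elim: (entries r n) => //= ij l IHl [<- /=|]; last exact: IHl.
    by split => //; exact: smooth_onM.
  - by apply: (IH _ hL) => e1 He1; apply: HL; right.
move=> G cG X HX /=.
have -> : 'D_(ed kl) (iter_partial s (fun Y => G (N Y) * c Y)) X =
  'D_(ed kl) (fun Y => \sum_(e <- L) iter_partial e.1 G (N Y) * e.2 Y) X.
  apply: near_eq_derive; apply: filterS (open_nbhs_nbhs (conj oW HX)) => Y HY.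
  exact: EL.
have key e : smooth_on rows_neq0 e.2 ->
    is_derive X (ed kl) (fun Y => iter_partial e.1 G (N Y) * e.2 Y)
     (\sum_(e' <- next e) iter_partial e'.1 G (N X) * e'.2 X).
  move=> ce; have cI : smooth_on setT (iter_partial e.1 G) by exact: iter_partial_smooth.
  have dI : is_derive X (ed kl) (fun Y => iter_partial e.1 G (N Y))
      (\sum_(ij <- entries r n) 'D_(ed ij) (iter_partial e.1 G) (N X) * dN ij X).
    apply: is_derive_comp_mx; first exact: (Ck1_differentiable openT (cI 1%N)).
    by move=> i j; exact: (smooth_on_derivable (smooth_normalize i j) HX).
  have d1 := @is_deriveM _ _ _ _ _ _ _ _ dI (smooth_on_derive (ed kl) ce HX).
  apply: (is_derive_eq d1); rewrite big_cons /= /GRing.scale /=.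
  congr (_ + _); rewrite [RHS]big_map mulr_sumr; apply: eq_bigr => ij _ /=; ring.
have [d1 E1] : is_derive X (ed kl) (fun Y => \sum_(e <- L) iter_partial e.1 G (N Y) * e.2 Y)
   (\sum_(e <- L) \sum_(e' <- next e) iter_partial e'.1 G (N X) * e'.2 X).
  elim: L HL {EL} => [|e0 L IH] HL.
    rewrite big_nil (_ : (fun z => _) = cst 0); first exact: is_derive_cst.
    by apply/funext => z; rewrite big_nil.
  rewrite big_cons (_ : (fun z => _) = (fun Y => iter_partial e0.1 G (N Y) * e0.2 Y) +
      (fun z => \sum_(e <- L) iter_partial e.1 G (N z) * e.2 z)).
    apply: is_deriveD; first by apply: key; have [] := HL e0 (or_introl erefl).
    by apply: IH => e1 He1; apply: HL; right.
  by apply/funext => z; rewrite big_cons.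
rewrite E1; elim: (L) => [|e0 L' IH]; first by rewrite !big_nil.
rewrite (_ : flatten [seq next e | e <- e0 :: L'] = next e0 ++ flatten [seq next e | e <- L'])//.
by rewrite big_cat big_cons IH.
Qed.

(** There are finitely many words [s] of each length, so the constants obtained word by word can be
    summed. *)
Lemma iter_partial_normalize_bound c k : smooth_on rows_neq0 c ->
  exists2 C : R, 0 <= C & forall G (M : R), smooth_on setT G ->
    (forall s X, (size s <= k)%N -> sphere_pow X -> `|iter_partial s G X| <= M) ->
    forall s X, (size s <= k)%N -> sphere_pow X ->
      `|iter_partial s (fun Y => G (N Y) * c Y) X| <= C * M.
Proof.
move=> cc.
have one s : exists C : R, 0 <= C /\ forall G (M : R), smooth_on setT G ->
    (forall s' X, (size s' <= size s)%N -> sphere_pow X -> `|iter_partial s' G X| <= M) ->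
    forall X, sphere_pow X -> `|iter_partial s (fun Y => G (N Y) * c Y) X| <= C * M.
  have [L [HL EL]] := iter_partial_normalize s cc.
  have [C [C0 HC]] : exists C : R, 0 <= C /\ forall G (M : R),
      (forall s' X, (size s' <= size s)%N -> sphere_pow X -> `|iter_partial s' G X| <= M) ->
      forall X, sphere_pow X -> `|\sum_(e <- L) iter_partial e.1 G (N X) * e.2 X| <= C * M.
    elim: L HL {EL} => [|e L IH] HL.
      by exists 0; split => // G M HM X HX; rewrite big_nil normr0 mul0r.
    have [|C [C0 HC]] := IH; first by move=> e1 He1; apply: HL; right.
    have [se ce] := HL e (or_introl erefl).
    have [B B0 HB] := smooth_bounded_sphere ce.
    exists (B + C); split; first exact: addr_ge0.
    move=> G M HM X HX; rewrite big_cons; apply: (le_trans (ler_normD _ _)).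
    rewrite mulrDl; apply: lerD; last exact: HC.
    rewrite normrM mulrC; apply: ler_pM => //; first exact: HB.
    by rewrite (normalize_id HX); exact: HM.
  exists C; split => // G M cG HM X HX.
  by rewrite (EL G cG X (sphere_rows_neq0 HX)); exact: HC.
have [C HC] := choice one.
elim: k => [|k [C' C'0 HC']].
  exists (C [::]); first by case: (HC [::]).
  move=> G M cG HM s X s0 HX; have /nilP s_nil : nilp s by rewrite /nilp -leqn0.
  by rewrite s_nil; case: (HC [::]) => _; apply.
exists (C' + \sum_(t : k.+1.-tuple ('I_r * 'I_n)) C t).
  by rewrite addr_ge0// sumr_ge0// => t _; case: (HC t).
move=> G M cG HM s X sk HX.
have M0 : 0 <= M by apply: le_trans (normr_ge0 _) (HM [::] X _ HX).
rewrite mulrDl; move: sk; rewrite leq_eqVlt => /orP[/eqP sk|sk].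
  have E : s = tval (tcast sk (in_tuple s)) by rewrite val_tcast.
  apply: (@le_trans _ _ (C s * M)).
    by have [_] := HC s; apply => // s' Y; rewrite sk; exact: HM.
  rewrite -[leLHS]add0r lerD ?mulr_ge0// ler_wpM2r//.
  rewrite (bigD1 (tcast sk (in_tuple s))) //= -E lerDl.
  by apply: sumr_ge0 => t _; case: (HC t).
apply: (@le_trans _ _ (C' * M)); last first.
  by rewrite lerDl mulr_ge0// sumr_ge0// => t _; case: (HC t).
by apply: HC' => // s' Y s'k; apply: HM; exact: leqW.
Qed.

End sphere_product.

(** * Supports of Goodey-Weil distributions *)

Section distributions.
Context (R : realType) (n r : nat).
Local Notation mat := 'M[R]_(r, n).
Local Notation vec := 'rV[R]_n.
Local Notation body := (convex_body R n).
Implicit Types (X Y : mat) (f g : mat -> R).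
Variable T : (mat -> R) -> R[i].
Hypothesis dT : Defs.distribution T.

Let T_lin (a : R) f g : sphere_smooth f -> sphere_smooth g ->
  T (fun X => a * f X + g X) = a%:C * T f + T g.
Proof. by case: dT => H _; exact: H. Qed.

Lemma normc_ge0 (z : R[i]) : 0 <= Normc.normc z.
Proof. by case: z => a b; exact: sqrtr_ge0. Qed.

(** The radial extension of [f - g] vanishes on an open set containing the product of spheres,
    together with its derivatives, so the continuity estimate applies with bound 0. *)
Lemma distribution_ext f g : sphere_smooth f -> sphere_smooth g ->
  (forall X, sphere_pow X -> f X = g X) -> T f = T g.
Proof.
move=> cf cg fg; have [_ [k [C HC]]] := dT.
have cd : sphere_smooth (fun X => (-1) * f X + g X) by exact: sphere_smoothD.
have H : T (fun X => (-1) * f X + g X) = 0.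
  apply: Normc.eq0_normc; apply/eqP; rewrite eq_le normc_ge0 andbT -(mulr0 C).
  apply: HC => // s X _ HX.
  have oW := @open_rows_neq0 R r n.
  rewrite (@iter_partial_ext _ _ _ (@rows_neq0 R r n) s _ (fun=> 0) oW _ X (sphere_rows_neq0 HX)).
    suff -> : iter_partial s (fun=> 0 : R) = (fun=> 0) by rewrite normr0.
    elim: s => //= ij s ->; apply/funext => Y; exact: derive_cst.
  by move=> Y /normalize_sphere HY; rewrite /radial_ext /= fg// mulN1r addNr.
move: H; rewrite T_lin// (_ : (-1)%:C = -1); last by rewrite rmorphN1.
by rewrite mulN1r => /eqP; rewrite addrC subr_eq0 => /eqP ->.
Qed.

Lemma distribution0 : T (fun=> 0) = 0.
Proof.
have c0 : sphere_smooth (fun _ : mat => 0 : R).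
  by apply: smooth_on_cst; exact: open_rows_neq0.
have := T_lin 1 c0 c0.
under [X in T X]eq_fun do rewrite mulr0 addr0.
by rewrite mul1r => /esym/eqP; rewrite -subr_eq0 addrK => /eqP.
Qed.

Lemma distribution_sum I (s : seq I) (a : I -> R) (F : I -> mat -> R) :
  (forall i, sphere_smooth (F i)) ->
  sphere_smooth (fun X => \sum_(i <- s) a i * F i X) /\
  T (fun X => \sum_(i <- s) a i * F i X) = \sum_(i <- s) (a i)%:C * T (F i).
Proof.
move=> cF; elim: s => [|i s [cs IH]].
  rewrite big_nil (_ : (fun X => _) = fun=> 0); last first.
    by apply/funext => X; rewrite big_nil.
  split; last exact: distribution0.
  by apply: smooth_on_cst; exact: open_rows_neq0.
rewrite big_cons (_ : (fun X => _) = fun X => a i * F i X + \sum_(i <- s) a i * F i X).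
  by split; [exact: sphere_smoothD|rewrite T_lin// IH].
by apply/funext => X; rewrite big_cons.
Qed.

(** The value at the tuple of differences [h_(P i) - h_(Q i)] of the multilinear extension of [psi],
    written before that extension is available. *)
Definition alternating_sum (psi : ('I_r -> body) -> R[i]) (P Q : 'I_r -> body) : R[i] :=
  \sum_(S : {set 'I_r}) (-1) ^+ #|S| * psi (fun i => if i \in S then Q i else P i).

Variable psi : ('I_r -> body) -> R[i].
Hypothesis T_psi : forall K : 'I_r -> body,
  (forall i, smooth_positively_curved (K i)) -> T (support_tensor K) = psi K.
Variable A : set vec.
Hypothesis psi_alt : forall P Q : 'I_r -> body,
  (forall i u, A u -> support_fun (P i) u = support_fun (Q i) u) -> alternating_sum psi P Q = 0.

(** On the sphere [e_i f_i = h_(K i) - h_B] with smooth bodies [K i] and the unit ball [B].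
    Expanding the product, the distribution yields an alternating sum of [psi], and the two support
    functions agree on [A] because [f_i] vanishes there. *)
Lemma distribution_tensor_eq0 (f : 'I_r -> vec -> R) :
  (forall i, smooth_on (@punctured R n) (f i)) -> (forall i, deg0 (f i)) ->
  (forall i u, A u -> f i u = 0) ->
  T (fun X => \prod_i f i (row i X)) = 0.
Proof.
move=> cf f0 fA.
have H i : exists eK : R * body, [/\ 0 < eK.1, smooth_positively_curved eK.2 &
    support_fun eK.2 =1 (fun x => enorm x + eK.1 * (f i x * enorm x))].
  by have [e [K HK]] := smooth_body (cf i) (f0 i); exists (e, K).
have [eK HeK] := choice H.
pose e i := (eK i).1; pose K i := (eK i).2.
pose mix (S : {set 'I_r}) i := if i \in S then ball_body R n else K i.
have smix S i : smooth_positively_curved (mix S i).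
  by rewrite /mix; case: ifP => _; [exact: ball_body_smooth|have [_ +] := HeK i].
have cmix S : sphere_smooth (support_tensor (mix S)).
  apply: (@sphere_smooth_tensor R r n (fun i => support_fun (mix S i))) => i.
  rewrite /mix; case: ifP => _.
    apply: smooth_on_ext (@smooth_enorm R n); first exact: open_punctured.
    by move=> x _; rewrite support_ball.
  have [_ _ hK] := HeK i; rewrite (funext hK).
  have oP := @open_punctured R n.
  apply: smooth_onD => //; first exact: smooth_enorm.
  by apply: smooth_onZ => //; apply: smooth_onM => //; exact: smooth_enorm.
have [cS ES] := distribution_sum (index_enum {set 'I_r}) (fun S => (-1) ^+ #|S|) cmix.
pose E := \prod_i e i.
have E0 : E != 0.
  by rewrite gt_eqF//; apply: prodr_gt0 => i _; have [] := HeK i.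
have key X : sphere_pow X -> \sum_(S : {set 'I_r}) (-1) ^+ #|S| * support_tensor (mix S) X =
    E * \prod_i f i (row i X).
  move=> HX; rewrite /E -big_split /=.
  transitivity (\prod_i (support_fun (K i) (row i X) + - enorm (row i X))); last first.
    apply: eq_bigr => i _; have [_ _ ->] := HeK i.
    by rewrite (HX i) mulr1 addrAC subrr add0r.
  under [RHS]eq_bigr do rewrite addrC.
  rewrite bigA_distr; apply: eq_bigr => S _.
  rewrite /support_tensor [RHS](bigID (fun i => i \in S)) /= [in LHS](bigID (fun i => i \in S)) /=.
  rewrite mulrA; congr (_ * _); last first.
    by apply: eq_bigr => i /negbTE iS; rewrite /mix iS.
  rewrite -prodr_const -big_split /=; apply: eq_bigr => i iS.
  by rewrite /mix iS mulN1r support_ball.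
have ct := sphere_smooth_tensor cf.
have c0 : sphere_smooth (fun _ : mat => 0 : R).
  by apply: smooth_on_cst; exact: open_rows_neq0.
have E1 : T (fun X => E * (\prod_i f i (row i X)) + 0) = 0.
  rewrite -(distribution_ext cS) => [||X HX]; last by rewrite key// addr0.
    rewrite ES -[RHS](psi_alt (P := K) (Q := fun=> ball_body R n)).
      apply: eq_bigr => S _; rewrite T_psi//.
      by rewrite rmorphXn /= rmorphN1.
    move=> i u Au; have [_ _ ->] := HeK i.
    by rewrite fA// mul0r mulr0 addr0 support_ball.
  exact: sphere_smoothD.
move: E1; rewrite T_lin// distribution0 addr0 => /eqP.
by rewrite mulf_eq0 => /orP[/eqP /complexI /eqP|/eqP//]; rewrite (negbTE E0).
Qed.

Lemma usphere_cap (u0 : vec) : closed A -> enorm u0 = 1 -> ~ A u0 ->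
  exists2 c : R, c < 1 & forall u, enorm u = 1 -> c < dotp u0 u -> ~ A u.
Proof.
move=> cA u01 nA.
have /nbhs_ballP[e /= e0 He] : nbhs u0 (~` A).
  by apply: open_nbhs_nbhs; split => //; exact: closed_openC.
(* For unit vectors, [|u0 - u| ^+ 2 = 2 - 2 dotp u0 u]. *)
exists (1 - e ^+ 2 / 2); first by rewrite ltrBlDr ltrDl divr_gt0// exprn_gt0.
move=> u u1 uc; apply: He; rewrite -ball_normE /ball_ /=.
apply: (le_lt_trans (ler_norm_enorm _)).
rewrite -ltr_sqr ?nnegrE ?enorm_ge0 ?(ltW e0)// enorm_sqr.
rewrite -[u]scale1r dotp_subZ -!enorm_sqr u01 u1 !expr1n; lra.
Qed.

Lemma distribution_eq0_near (u0 : vec) : closed A -> A `<=` @usphere R n ->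
  enorm u0 = 1 -> ~ A u0 ->
  exists O : set mat, [/\ open O, O (diag_embedding r u0) &
    forall f, sphere_smooth f -> closure [set Y | sphere_pow Y /\ f Y != 0] `<=` O -> T f = 0].
Proof.
move=> cA AS u01 nA; have [c c1 Hc] := usphere_cap cA u01 nA.
(* Two concentric caps: [f] is supported in the smaller one, of level [c'], and [beta] is positive
   on the larger one, of level [c]. The gap leaves room around each point outside the larger cap for
   a neighbourhood where the quotient is 0. *)
pose c' := (c + 1) / 2.
have cc' : c < c' by rewrite /c'; lra.
have c'1 : c' < 1 by rewrite /c'; lra.
have aff (a : R) : continuous (fun x : vec => dotp u0 x - a * enorm x).
  move=> x; apply: continuousB; first exact: dotp_continuous.
  by apply: continuousM; [exact: cst_continuous|exact: enorm_continuous].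
have oC (a : R) : open [set x : vec | 0 < dotp u0 x - a * enorm x].
  apply: (@open_comp _ _ (fun x : vec => dotp u0 x - a * enorm x) [set t : R | 0 < t]).
    by move=> x _; exact: aff.
  exact: open_gt.
pose O : set mat := [set X | forall i, 0 < dotp u0 (row i X) - c' * enorm (row i X)].
have oO : open O by apply: open_forall => i; exact: (open_row_preimage (i := i) (oC c')).
exists O; split => //.
  move=> i; rewrite (_ : row i _ = u0); last by apply/rowP => j; rewrite !mxE.
  by rewrite -enorm_sqr u01 expr1n mulr1 subr_gt0.
move=> f cf fO.
have oP := @open_punctured R n.
have oR := @open_rows_neq0 R r n.
pose beta (x : vec) : R := bump 0 (dotp u0 x / enorm x - c).
have cbeta : smooth_on (@punctured R n) beta.
  apply: smooth_on_bump => //; apply: smooth_onB => //; last exact: smooth_on_cst.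
  apply: smooth_onM => //; first exact: smooth_dotp.
  by apply: smooth_onV => //; [move=> x x0; rewrite enorm_eq0|exact: smooth_enorm].
have beta_deg0 : deg0 beta.
  move=> t x t0; rewrite /beta dotpZr enormZ gtr0_norm//.
  by rewrite invfM mulrACA mulfV ?mul1r// gt_eqF.
have beta_gt0 x : x != 0 -> 0 < dotp u0 x - c * enorm x -> 0 < beta x.
  move=> x0 h; apply: bump_gt0; rewrite subr_gt0 ltr_pdivlMr ?enorm_gt0//.
  by rewrite -subr_gt0.
have beta_A u : A u -> beta u = 0.
  move=> Au; apply: bump_le0; have u1 : enorm u = 1 := AS _ Au.
  by rewrite u1 divr1 subr_le0 leNgt; apply/negP => /Hc -/(_ u1).
(* A radial cutoff, constant on the sphere, that vanishes near the origin and for large vectors: it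
   makes the degree 0 extension smooth on the whole matrix space, with bounded support. *)
pose kap (x : vec) : R := bump 0 (dotp x x - 4^-1) * bump 0 (4 - dotp x x).
have ckap : smooth_on setT kap.
  apply: smooth_onM; [exact: openT| |]; apply: smooth_on_bump; [exact: openT| |exact: openT|].
    apply: smooth_onB; [exact: openT|exact: smooth_dotpxx openT|exact: (smooth_on_cst _ openT)].
  apply: smooth_onB; [exact: openT|exact: (smooth_on_cst _ openT)|exact: smooth_dotpxx openT].
pose k1 := bump 0 (1 - 4^-1 : R) * bump 0 (4 - 1 : R).
have k1_gt0 : 0 < k1 by rewrite /k1 mulr_gt0 ?bump_gt0//; lra.
have kap1 x : enorm x = 1 -> kap x = k1 by move=> x1; rewrite /kap -enorm_sqr x1 expr1n.
have kap_small x : enorm x < 2^-1 -> kap x = 0.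
  move=> x2; rewrite /kap bump_le0 ?mul0r// -enorm_sqr.
  have := enorm_ge0 x; rewrite expr2; nra.
have kap_big x : 2 < enorm x -> kap x = 0.
  move=> x2; rewrite /kap [bump 0 (4 - _)]bump_le0 ?mulr0// -enorm_sqr expr2; nra.
pose W : set mat := [set X | forall i, 0 < dotp u0 (row i X) - c * enorm (row i X)] `&` @rows_neq0 R r n.
have oW : open W.
  by apply: openI => //; apply: open_forall => i; exact: (open_row_preimage (i := i) (oC c)).
(* [F b] is proportional to [f] on the sphere; replacing [F] by a polynomial makes
   it a combination of tensor products whose factors vanish on [A]. *)
pose b X : R := \prod_i beta (row i X).
pose F X : R := radial_ext f X * (b X)^-1 * \prod_i kap (row i X).
have sphere_out X : sphere_pow X -> ~ O X -> f X = 0.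
  move=> HX nO; apply: contrapT => /eqP fX; apply: nO; apply: fO.
  by apply: subset_closure.
have F_small X i : enorm (row i X) < 2^-1 -> F X = 0.
  by move=> /kap_small k0; rewrite /F (bigD1 i) //= k0 mul0r mulr0.
have F_out X i : row i X != 0 -> dotp u0 (row i X) < c' * enorm (row i X) -> F X = 0.
  move=> Xi0 Xi; have [HX|nX] := pselect (rows_neq0 X); last first.
    have [j] : exists j, row j X == 0.
      by apply: contrapT => H; apply: nX => j; apply/negP => Xj; apply: H; exists j.
    by move=> /eqP Xj; apply: (F_small X j); rewrite Xj enorm0 invr_gt0.
  rewrite /F /radial_ext /= sphere_out ?mul0r//; first exact: normalize_sphere.
  move=> /(_ i); rewrite row_normalize enorm_unitv// mulr1 dotpZr.
  by rewrite subr_gt0 mulrC ltr_pdivlMr ?enorm_gt0// => /(lt_trans Xi); rewrite ltxx.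
have cF : smooth_on setT F.
  apply: smooth_on_local => X _; have [XW|XW] := pselect (W X).
    exists W => //; apply: smooth_onM => //.
      apply: smooth_onM => //; first exact: (smooth_on_sub (fun X => @proj2 _ _) cf).
      apply: smooth_onV => //.
        move=> Y [Y1 Y2]; rewrite gt_eqF//; apply: prodr_gt0 => i _.
        by apply: beta_gt0; [exact: Y2|exact: Y1].
      apply: smooth_on_prod => // i _.
      by apply: (smooth_row oP oW _ cbeta) => Y [_ ]; apply.
    apply: smooth_on_prod => // i _.
    by apply: (smooth_row openT oW _ ckap).
  have [i [Xi|[Xi0 Xi]]] : exists i, enorm (row i X) < 2^-1 \/
      (row i X != 0 /\ dotp u0 (row i X) < c' * enorm (row i X)).
    apply: contrapT => /forallNP H; apply: XW; split=> i; have /not_orP[h1 h2] := H i.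
      have x0 : row i X != 0.
        by apply/negP => /eqP x0; apply: h1; rewrite x0 enorm0 invr_gt0.
      rewrite subr_gt0; apply: (@lt_le_trans _ _ (c' * enorm (row i X))).
        by rewrite ltr_pM2r// enorm_gt0.
      by rewrite leNgt; apply/negP => h3; apply: h2.
    by apply/negP => /eqP x0; apply: h1; rewrite x0 enorm0 invr_gt0.
  - pose V : set mat := [set Y | enorm (row i Y) < 2^-1].
    have oV : open V.
      apply: (open_row_preimage (i := i) (O := [set x | enorm x < 2^-1])).
      apply: (@open_comp _ _ (@enorm R n) [set t : R | t < 2^-1]).
        by move=> x _; exact: enorm_continuous.
      exact: open_lt.
    exists V => //; apply: smooth_on_ext (smooth_on_cst 0 oV) => // Y VY.
    by rewrite (F_small Y i).
  - pose V : set mat := [set Y | 0 < dotp (- u0) (row i Y) - (- c') * enorm (row i Y)] `&`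
       [set Y | row i Y != 0].
    have oV : open V.
      apply: openI; last exact: (open_row_preimage (i := i) oP).
      apply: (open_row_preimage (i := i) (O := [set x | 0 < dotp (- u0) x - (- c') * enorm x])).
      rewrite (_ : [set x | _] = (fun x : vec => dotp u0 x - c' * enorm x) @^-1` [set t : R | t < 0]).
        by apply: open_comp => [x _|]; [exact: aff|exact: open_lt].
      by apply/seteqP; split => x /=; rewrite dotpNl mulNr opprK subr_lt0 addrC subr_gt0.
    exists V.
      by split => //=; rewrite dotpNl mulNr opprK addrC subr_gt0.
    apply: smooth_on_ext (smooth_on_cst 0 oV) => // Y [VY1 VY2].
    by rewrite (F_out Y i)//; move: VY1; rewrite /= dotpNl mulNr opprK addrC subr_gt0.
have F_big X : 2 < `|X| -> F X = 0.
  move=> X2; have [i Hi] : exists i, 2 < enorm (row i X).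
    apply: contrapT => /forallNP H; move: X2; rewrite ltNge => /negP; apply.
    apply: mx_norm_le => // i j; have := H i; move/negP; rewrite -leNgt; apply: le_trans.
    by have := ler_entry_enorm (row i X) j; rewrite mxE.
  by rewrite /F (bigD1 i) //= (kap_big _ Hi) mul0r mulr0.
pose k := k1 ^- r.
have fE X : sphere_pow X -> f X = k * (F X * b X) + 0.
  move=> HX; have kP : \prod_i kap (row i X) = k1 ^+ r.
    by rewrite (eq_bigr (fun=> k1)) ?prodr_const ?card_ord// => i _; exact: (kap1 _ (HX i)).
  have k1r : k1 ^+ r != 0 by rewrite expf_neq0// gt_eqF.
  rewrite addr0 /F kP /radial_ext /= normalize_id//.
  have [OX|nO] := pselect (O X); last by rewrite (sphere_out X)// !mul0r mulr0.
  have b0 : b X != 0.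
    rewrite gt_eqF//; apply: prodr_gt0 => i _; apply: beta_gt0; first exact: sphere_rows_neq0.
    have := OX i; rewrite HX !mulr1 !subr_gt0; exact: lt_trans.
  rewrite /k; move: (k1 ^+ r) k1r (b X) b0 => K K0 b' b'0.
  by field; rewrite K0 b'0.
have [_ [kk [C HC]]] := dT.
have cb : smooth_on (@rows_neq0 R r n) (fun X : mat => b (normalize_rows X)).
  apply: smooth_on_prod => // i _; exact: smooth_normalized_row.
have [B B0 HB] := iter_partial_normalize_bound kk cb.
have csm (G : mat -> R) : smooth_on setT G -> sphere_smooth (fun X => G X * b X).
  move=> cG; apply: smooth_onM => //.
  by apply: (smooth_on_comp_mx (@openT mat) oR _ cG) => // i j; exact: smooth_normalize.
have small e : 0 < e -> Normc.normc (T (fun X => F X * b X)) <= C * (B * e).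
  move=> e0.
  (* Every entry occurs [kk] times, so each iterated derivative of order at most [kk], the order of
     the distribution, is admissible. *)
  pose L := flatten (nseq kk (entries r n)).
  have [d Hd] := @Ck_weierstrass R r n 3 2 L F e (ltr_nat _ 2 3) (ltr0n _ 3) cF F_big e0.
  (* On the product of spheres, each monomial times [b] is the tensor product of the functions
     [mono]. Composition with [unitv] makes these of degree 0, and their factor [beta] vanishes on
     [A]. *)
  have tp0 : T (fun X => tensor_poly d X * b X) = 0.
    pose mono (e : R * ('I_r -> 'I_n -> {poly R})) i (x : vec) :=
      (\prod_j (e.2 i j).[unitv x 0 j]) * beta x.
    have cmono e' i : smooth_on (@punctured R n) (mono e' i).
      apply: smooth_onM => //; apply: smooth_on_prod => // j _.
      apply: (@smooth_on_comp_mx _ _ 1 n _ setT (fun y : vec => (e'.2 i j).[y 0 j]) (@unitv R n)) => //.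
      - exact: openT.
      - exact: (smooth_horner _ 0 j openT).
      - move=> a l; apply: (@smooth_on_ext _ _ _ (fun x : vec => (enorm x)^-1 * x a l)) => //.
          by move=> x _; rewrite mxE.
        apply: smooth_onM => //; last exact: smooth_on_coord.
        by apply: smooth_onV => //; [move=> x x0; rewrite enorm_eq0|exact: smooth_enorm].
    have mono0 e' i : deg0 (mono e' i).
      move=> t x t0; rewrite /mono beta_deg0//; congr (_ * _).
      rewrite (_ : unitv (t *: x) = unitv x)//.
      rewrite /unitv enormZ gtr0_norm// scalerA invfM mulrC mulrA mulfV ?mul1r//.
      by rewrite gt_eqF.
    have monoA e' i u : A u -> mono e' i u = 0 by move=> Au; rewrite /mono beta_A// mulr0.
    have [cs Es] := distribution_sum d (fun e' => e'.1) (fun e' => sphere_smooth_tensor (cmono e')).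
    rewrite (distribution_ext (csm _ (smooth_tensor_poly d openT)) cs).
      rewrite Es big1// => e' _.
      by rewrite distribution_tensor_eq0 ?mulr0//; exact: monoA.
    move=> X HX; rewrite /tensor_poly mulr_suml; apply: eq_bigr => e' _.
    rewrite -mulrA; congr (_ * _); rewrite /b -big_split /=; apply: eq_bigr => i _.
    rewrite /mono; congr (_ * _); apply: eq_bigr => j _.
    by rewrite mxE (HX i) invr1 mul1r mxE.
  pose D X := F X - tensor_poly d X.
  have cD : smooth_on setT D.
    by apply: smooth_onB => //; [exact: openT|exact: smooth_tensor_poly openT].
  have -> : T (fun X => F X * b X) = T (fun X => D X * b X).
    have -> : (fun X => F X * b X) = (fun X => 1 * (D X * b X) + tensor_poly d X * b X).
      by apply/funext => X; rewrite /D; ring.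
    rewrite T_lin ?tp0 ?addr0 ?mul1r//; [exact: csm|exact: csm (smooth_tensor_poly d openT)].
  apply: HC; first exact: csm.
  move=> s X sk HX; apply: (HB D e cD _ s X sk HX) => s' Y s'k HY; apply: Hd.
    move=> ij; apply: (leq_trans (count_size _ _)); apply: (leq_trans s'k).
    rewrite /L count_flatten map_nseq sumn_nseq.
    by rewrite /entries count_uniq_mem ?enum_uniq// mem_enum mul1n.
  apply: mx_norm_le => // i j; have := ler_entry_enorm (row i Y) j.
  rewrite mxE (HY i) => /le_trans; apply; lra.
have T0 : T (fun X => F X * b X) = 0.
  apply: Normc.eq0_normc; apply/eqP; rewrite eq_le normc_ge0 andbT.
  have CB1 : 0 < `|C * B| + 1 by rewrite ltr_wpDl.
  apply/ler_addgt0Pl => e e0; rewrite addr0.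
  apply: (le_trans (small (e / (`|C * B| + 1)) _)); first by rewrite divr_gt0.
  rewrite mulrA; apply: (le_trans (ler_wpM2r _ (ler_norm _))); first by rewrite divr_ge0 ?ltW.
  by rewrite mulrCA ger_pMr// ler_pdivrMr// mul1r lerDl.
have c0 : sphere_smooth (fun _ : mat => 0 : R) by apply: smooth_on_cst.
rewrite (distribution_ext cf (sphere_smoothD k (csm _ cF) c0) fE) T_lin ?T0//; last exact: csm.
by rewrite distribution0 mulr0 addr0.
Qed.

End distributions.

(** The polarization behind a Goodey-Weil distribution is existentially quantified, so the vanishing
    is asked of every polarization. *)
Lemma v_supp_hom_sub (R : realType) (n r : nat) (chi : convex_body R n -> R[i])
    (A : set 'rV[R]_n) : closed A -> A `<=` @usphere R n ->
  (forall psi : ('I_r -> convex_body R n) -> R[i], polarization chi psi -> forall P Q,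
    (forall i u, A u -> support_fun (P i) u = support_fun (Q i) u) ->
    alternating_sum psi P Q = 0) ->
  v_supp_hom r chi `<=` A.
Proof.
move=> cA AS hA u [u1 [T [dT [psi [pp Tpsi]]] [_ supp]]]; apply: contrapT => nA.
have [V [oV Vu HV]] := distribution_eq0_near dT Tpsi (hA psi pp) cA AS u1 nA.
have [f [cf fV]] := supp V oV Vu.
by rewrite (HV f cf fV) eqxx.
Qed.

(** * Multilinear maps and polarizations *)

Section multilinear_maps.
Context (R : realType) (E : lmodType R) (r : nat) (V : set E).
Implicit Types (f g h : E) (F G : 'I_r -> E) (M : ('I_r -> E) -> R[i]).

Definition slot F k g : 'I_r -> E := fun j => if j == k then g else F j.

Definition subspace := V 0 /\ forall (a : R) g h, V g -> V h -> V (a *: g + h).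

Definition multilinear M := forall k F (a : R) g h, (forall j, V (F j)) -> V g -> V h ->
  M (slot F k (a *: g + h)) = a%:C * M (slot F k g) + M (slot F k h).

Hypothesis HV : subspace.

Lemma subspaceZ a g : V g -> V (a *: g).
Proof. by case: HV => V0 HD Vg; rewrite -[a *: g]addr0; exact: HD. Qed.

Lemma subspaceD g h : V g -> V h -> V (g + h).
Proof. by case: HV => _ HD Vg Vh; rewrite -[g]scale1r; exact: HD. Qed.

Lemma subspaceB g h : V g -> V h -> V (g - h).
Proof. by case: HV => _ HD Vg Vh; rewrite addrC -scaleN1r; exact: HD. Qed.

Lemma subspace_sum I (s : seq I) (P : pred I) (F : I -> E) :
  (forall i, P i -> V (F i)) -> V (\sum_(i <- s | P i) F i).
Proof. by move=> VF; apply: big_ind => //; [case: HV|exact: subspaceD]. Qed.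

Section one_map.
Variable M : ('I_r -> E) -> R[i].
Hypothesis HM : multilinear M.

Lemma slot_id F k : slot F k (F k) = F.
Proof. by apply/funext => j; rewrite /slot; case: eqP => // ->. Qed.

Lemma multilinear0 F k : (forall j, V (F j)) -> F k = 0 -> M F = 0.
Proof.
move=> VF Fk; have [V0 _] := HV.
have := HM k (-1) VF V0 V0; rewrite scaler0 addr0 rmorphN1 mulN1r addNr.
by rewrite -{1}Fk slot_id.
Qed.

Lemma multilinear_slot_sum F k (L : Type) (s : seq L) (a : L -> R) (g : L -> E) :
  (forall j, V (F j)) -> (forall l, V (g l)) ->
  M (slot F k (\sum_(l <- s) a l *: g l)) = \sum_(l <- s) (a l)%:C * M (slot F k (g l)).
Proof.
move=> VF Vg; elim: s => [|l s IH].
  rewrite !big_nil (@multilinear0 _ k) ?/slot ?eqxx// => j.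
  by case: eqP => // _; case: HV.
rewrite !big_cons HM ?IH//; apply: subspace_sum => i _; exact: subspaceZ.
Qed.

Lemma multilinear_expansion (L : finType) (l0 : L) (a : 'I_r -> L -> R) (F : 'I_r -> L -> E) :
  (forall j l, V (F j l)) ->
  M (fun j => \sum_l a j l *: F j l) =
  \sum_(c : {ffun 'I_r -> L}) (\prod_j a j (c j))%:C * M (fun j => F j (c j)).
Proof.
move=> VF.
pose B j := \sum_l a j l *: F j l.
have VB j : V (B j) by apply: subspace_sum => l _; exact: subspaceZ.
(* Only the slots listed in [s] are expanded; the others are frozen at the choice [c0], which the
   induction updates slot by slot. *)
suff claim (s : seq 'I_r) (c0 : {ffun 'I_r -> L}) : uniq s ->
    M (fun j => if j \in s then B j else F j (c0 j)) =
    \sum_(c : {ffun 'I_r -> L} | [forall j, (j \in s) || (c j == c0 j)])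
       (\prod_(j <- s) a j (c j))%:C * M (fun j => F j (c j)).
  have := claim (index_enum 'I_r) [ffun=> l0] (index_enum_uniq _).
  under eq_fun do rewrite mem_index_enum.
  by move=> ->; apply: eq_bigl => c; apply/forallP => j; rewrite mem_index_enum.
elim: s c0 => [|k s IH] c0.
  move=> _; rewrite (big_pred1 c0) => [|c].
    by rewrite big_nil rmorph1 mul1r.
  rewrite /=; apply/forallP/eqP => [H|->]; last by move=> j; exact: eqxx.
  by apply/ffunP => j; exact/eqP/H.
rewrite cons_uniq => /andP[ks us].
pose G j := if j \in s then B j else F j (c0 j).
have VG j : V (G j) by rewrite /G; case: ifP.
have -> : (fun j => if j \in k :: s then B j else F j (c0 j)) = slot G k (B k).
  by apply/funext => j; rewrite /slot inE /G; case: eqP => [->|].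
rewrite /B multilinear_slot_sum// [RHS](partition_big (fun c : {ffun _ -> _} => c k) xpredT)//=.
apply: eq_bigr => l _.
pose cl := [ffun j => if j == k then l else c0 j].
have -> : slot G k (F k l) = fun j => if j \in s then B j else F j (cl j).
  apply/funext => j; rewrite /slot /G ffunE; case: (eqVneq j k) => [->|//].
  by rewrite (negbTE ks).
rewrite (IH cl us) mulr_sumr.
apply: congr_big => // [c|c Hc].
  apply/forallP/andP => [H|[/forallP H /eqP ck] j].
    split; last by have := H k; rewrite (negbTE ks) ffunE eqxx.
    apply/forallP => j; have := H j; rewrite inE ffunE.
    by case: (eqVneq j k).
  by have := H j; rewrite inE ffunE; case: (eqVneq j k) => [->|//]; rewrite ck eqxx orbT.
have /forallP/(_ k) := Hc; rewrite (negbTE ks) ffunE eqxx /= => /eqP ck.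
by rewrite big_cons ck rmorphM mulrA.
Qed.

Lemma multilinear_sub F G : (forall j, V (F j)) -> (forall j, V (G j)) ->
  M (fun j => F j - G j) =
  \sum_(S : {set 'I_r}) (-1) ^+ #|S| * M (fun j => if j \in S then G j else F j).
Proof.
move=> VF VG.
transitivity (M (fun j => \sum_(b : bool) (-1) ^+ b *: (if b then G j else F j))).
  by congr M; apply/funext => j; rewrite big_bool /= expr1 expr0 scaleN1r scale1r addrC.
rewrite (multilinear_expansion true); last by move=> j [].
rewrite (reindex (fun S : {set 'I_r} => [ffun j => j \in S])) /=; last first.
  exists (fun c : {ffun 'I_r -> bool} => [set j | c j]%SET) => [S _|c _].
    by apply/setP => j; rewrite inE ffunE.
  by apply/ffunP => j; rewrite ffunE inE.
apply: eq_bigr => S _; congr (_ * M _); last by apply/funext => j; rewrite ffunE.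
rewrite -sum1_card -prodrXr [RHS]big_mkcond rmorph_prod; apply: eq_bigr => j _.
by rewrite ffunE; case: (j \in S); rewrite /= ?expr0 ?expr1 ?rmorph1 ?rmorphN1.
Qed.

Lemma multilinear_diag_poly f g : V f -> V g ->
  exists p : {poly R[i]}, forall t : R, M (fun=> f + t *: g) = p.[t%:C].
Proof.
move=> Vf Vg.
pose F (b : bool) := if b then g else f.
exists (\sum_(c : {ffun 'I_r -> bool}) M (fun j => F (c j)) *: \prod_j (if c j then 'X else 1)).
move=> t; transitivity (M (fun=> \sum_(b : bool) (if b then t else 1) *: F b)).
  by congr M; apply/funext => j; rewrite big_bool /= scale1r addrC.
rewrite (multilinear_expansion true); last by move=> j [].
rewrite horner_sum; apply: eq_bigr => c _; rewrite hornerZ mulrC; congr (_ * _).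
rewrite horner_prod rmorph_prod; apply: eq_bigr => j _.
by case: (c j); rewrite ?hornerX ?hornerC.
Qed.

(** Inclusion-exclusion. After expansion, a choice function [c] has as weight the sum of
    [(-1) ^ #|~: S|] over the sets [S] containing its image, that is, the product over [i] of [1 -
    [i \notin codom c]]: it is 1 if [c] is onto, hence a permutation, and 0 otherwise. *)
Lemma polarization_identity (f : 'I_r -> E) : (0 < r)%N -> (forall i, V (f i)) ->
  \sum_(S : {set 'I_r}) (-1) ^+ #|~: S| * M (fun=> \sum_(i in S) f i) =
  \sum_(s : 'S_r) M (fun j => f (s j)).
Proof.
move=> r0 Vf.
transitivity (\sum_(S : {set 'I_r}) \sum_(c : {ffun 'I_r -> 'I_r})
    ((-1) ^+ #|~: S| * (\prod_j (c j \in S)%:R)) * M (fun j => f (c j))).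
  apply: eq_bigr => S _.
  transitivity ((-1) ^+ #|~: S| * M (fun=> \sum_i (i \in S)%:R *: f i)).
    congr (_ * M _); apply/funext => _; rewrite big_mkcond; apply: eq_bigr => i _.
    by case: (i \in S); rewrite ?scale1r ?scale0r.
  rewrite (multilinear_expansion (Ordinal r0))// mulr_sumr.
  apply: eq_bigr => c _; rewrite mulrA rmorph_prod; congr (_ * _ * _).
  by apply: eq_bigr => j _; rewrite rmorph_nat.
rewrite exchange_big /=.
transitivity (\sum_(c : {ffun 'I_r -> 'I_r} | injectiveb c) M (fun j => f (c j))).
  rewrite [RHS]big_mkcond; apply: eq_bigr => c _; rewrite -mulr_suml.
  have -> : \sum_(S : {set 'I_r}) (-1) ^+ #|~: S| * \prod_j (c j \in S)%:R =
            \prod_i (1 + - (i \notin codom c)%:R) :> R[i].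
    rewrite bigA_distr; apply: eq_bigr => S _.
    rewrite -sum1_card -prodrXr.
    have -> : \prod_j (c j \in S)%:R = \prod_i ((i \notin S) ==> (i \notin codom c))%:R :> R[i].
      case: (boolP [forall j, c j \in S]) => [/forallP H|/forallPn[j Hj]].
        rewrite !big1// => i _; last by rewrite H.
        have -> // : (i \notin S) ==> (i \notin codom c).
        by apply/implyP; apply: contra => /codomP[j ->].
      rewrite (bigD1 j)//= (negbTE Hj) mul0r (bigD1 (c j))//= Hj codom_f.
      by rewrite mul0r.
    rewrite [X in X * _]big_mkcond -big_split /=; apply: eq_bigr => i _.
    rewrite inE; case: (i \in S); case: (i \in codom c);
    by rewrite /= ?expr1 ?mul1r ?mulr1 ?mulr0 ?oppr0.
  case: ifPn => [/injectiveP ic|ic].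
    rewrite big1 ?mul1r// => i _.
    have -> : i \in codom c.
      by have /inj_card_onto := ic; apply.
    by rewrite oppr0 addr0.
  suff [i Hi] : exists i, i \notin codom c.
    by rewrite (bigD1 i)//= Hi subrr !mul0r.
  apply/existsP; rewrite -negb_forall; apply: contra ic => /forallP H.
  suff /image_injP ic : #|codom c| == #|'I_r| by apply/injectiveP => x y; exact: ic.
  by apply/eqP/eq_card => x; rewrite H.
rewrite (reindex (@pval _)) /=; last first.
  pose in_Sn := insubd (1%g : 'S_r).
  by exists in_Sn => /= g Ug; first apply: val_inj; apply: insubdK.
apply: eq_big => [s|s _]; first exact: (valP s).
by congr M; apply/funext => j; rewrite pvalE.
Qed.
End one_map.
End multilinear_maps.

(** * Extension of a polarization to differences of support functions *)

Section additive_rays.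
Context (R : realType) (n : nat).
Local Notation body := (convex_body R n).
Implicit Types (A B : body).

Lemma normcZ (t : R) (z : R[i]) : 0 <= t -> Normc.normc (t%:C * z) = t * Normc.normc z.
Proof.
move=> t0; rewrite Normc.normcM; congr (_ * _); rewrite -[t%:C]/(Complex t 0) /= expr0n addr0.
by transitivity `|t|; [exact: sqrtr_sqr|exact: ger0_norm].
Qed.

Lemma body_scaleDl (s t : R) A : 0 <= s -> 0 <= t ->
  body_scale (s + t) A = body_add (body_scale s A) (body_scale t A).
Proof.
move=> s0 t0; apply: support_inj => y.
by rewrite support_body_add !support_body_scale// ?addr_ge0// mulrDl.
Qed.

Lemma hausdorff_scale_point (A : body) : exists2 M : R, 0 <= M &
  forall t : R, 0 <= t -> hausdorff (point_body 0) (body_scale t A) <= t * M.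
Proof.
have [M M0 HM] := support_bound A; exists M => // t t0.
apply: hausdorff_le => [|y]; first exact: mulr_ge0.
rewrite support_point dotp0r sub0r normrN support_body_scale// normrM ger0_norm//.
by rewrite -mulrA ler_wpM2l.
Qed.

(** Cauchy's functional equation on a half-line. Smallness near 0 bounds [g] on [[0, 1)]. Writing
    [N t = k + s] with [s] in [[0, 1)], the defect at [t] times [N] equals the defect at [s], so it
    stays bounded in [N] and is 0. *)
Lemma additive_ray (g : R -> R[i]) : (forall s t : R, 0 <= s -> 0 <= t -> g (s + t) = g s + g t) ->
  (forall e : R, 0 < e -> exists2 d : R, 0 < d & forall t : R, 0 <= t -> t < d ->
     Normc.normc (g t) < e) ->
  forall t : R, 0 <= t -> g t = t%:C * g 1.
Proof.
move=> gD gc.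
have g0 : g 0 = 0.
  by have /eqP := gD 0 0 (lexx 0) (lexx 0); rewrite addr0 eq_sym -subr_eq0 addrK => /eqP.
have gM m t : 0 <= t -> g (t *+ m) = g t *+ m.
  move=> t0; elim: m => [|m IH]; first by rewrite !mulr0n.
  by rewrite !mulrS gD ?IH// mulrn_wge0.
have [d d0 Hd] := gc 1 ltr01.
have [m Hm] : exists m : nat, d^-1 < m.+1%:R.
  by exists (Num.truncn d^-1); exact: truncnS_gt.
have bounded s : 0 <= s -> s < 1 -> Normc.normc (g s) <= m.+1%:R.
  move=> s0 s1; have m0 : 0 < m.+1%:R :> R by rewrite ltr0n.
  have -> : g s = m.+1%:R%:C * g (s / m.+1%:R).
    rewrite -[in LHS](divfK (lt0r_neq0 m0) s) mulr_natr gM ?divr_ge0//.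
    by rewrite rmorph_nat mulr_natl.
  rewrite normcZ// -[leRHS]mulr1 ler_wpM2l// ltW// Hd// ?divr_ge0//.
  rewrite ltr_pdivrMr//; apply: (lt_trans s1).
  by rewrite -ltr_pdivrMl// mulr1.
move=> t t0; apply/eqP; rewrite -subr_eq0; apply/eqP/Normc.eq0_normc/eqP.
rewrite eq_le normc_ge0 andbT leNgt; apply/negP => X0.
set X := Normc.normc _ in X0.
pose b := m.+1%:R + Normc.normc (g 1).
have key N : N%:R * X <= b.
  have [k [s [s0 s1 E]]] : exists k s, [/\ 0 <= s, s < 1 & t *+ N = k%:R + s :> R].
    exists (Num.truncn (t *+ N)), (t *+ N - (Num.truncn (t *+ N))%:R).
    have tN : 0 <= t *+ N by rewrite mulrn_wge0.
    have /andP[H1 H2] := truncn_itv tN.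
    split; first by rewrite subr_ge0.
      by rewrite ltrBlDl natr1.
    by rewrite addrC subrK.
  have -> : N%:R * X = Normc.normc (g s - s%:C * g 1).
    rewrite /X -normcZ// rmorph_nat; congr Normc.normc.
    rewrite mulrBr mulr_natl -gM// E gD// -[k%:R]/(1 *+ k) gM//.
    have -> : N%:R * (t%:C * g 1) = (t *+ N)%:C * g 1 by rewrite rmorphMn /= mulrA mulr_natl.
    by rewrite E rmorphD rmorphMn /= mulrDl mulr_natl opprD addrACA subrr add0r.
  apply: (le_trans (le_normcD _ _)); rewrite normcN.
  apply: lerD; first exact: bounded.
  by rewrite normcZ// ler_piMl ?normc_ge0// ltW.
have [N HN] : exists N : nat, b / X < N.+1%:R.
  by exists (Num.truncn (b / X)); exact: truncnS_gt.
by have := key N.+1; rewrite leNgt -ltr_pdivrMr// HN.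
Qed.

End additive_rays.

Section polarization_extension.
Context (R : realType) (n r : nat).
Local Notation vec := 'rV[R]_n.
Local Notation body := (convex_body R n).
Implicit Types (A B : body) (K P Q : 'I_r -> body).

Definition dsupp : set (vec -> R) :=
  [set f | exists A B : body, f = support_fun A - support_fun B].

Lemma dsupp_support A : dsupp (support_fun A).
Proof.
exists A, (point_body 0); apply/funext => y.
by rewrite !fctE /= support_point dotp0r subr0.
Qed.

Lemma dsupp_comb (a : R) (A B A' B' : body) : exists A1 B1 : body,
  a *: (support_fun A - support_fun B) + (support_fun A' - support_fun B') =
  support_fun A1 - support_fun B1 :> (vec -> R).
Proof.
case: (leP 0 a) => a0.
  exists (body_add (body_scale a A) A'), (body_add (body_scale a B) B').
  apply/funext => y; rewrite !fctE /= !support_body_add !support_body_scale//.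
  by rewrite -[_ *: _]/(_ * _); ring.
have a0' : 0 <= - a by rewrite oppr_ge0 ltW.
exists (body_add (body_scale (- a) B) A'), (body_add (body_scale (- a) A) B').
apply/funext => y; rewrite !fctE /= !support_body_add !support_body_scale//.
by rewrite -[_ *: _]/(_ * _); ring.
Qed.

Lemma subspace_dsupp : subspace dsupp.
Proof.
split; first by exists (point_body 0), (point_body 0); rewrite subrr.
by move=> a _ _ [A [B ->]] [A' [B' ->]]; have [A1 [B1]] := dsupp_comb a A B A' B'; exists A1, B1.
Qed.

Lemma support_body_sum I (s : seq I) (P : pred I) (K : I -> body) :
  support_fun (\big[@body_add R n/point_body 0]_(i <- s | P i) K i) =
  \sum_(i <- s | P i) support_fun (K i).
Proof.
apply/funext => y; rewrite fct_sumE.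
apply: (big_ind2 (fun (B : body) a => support_fun B y = a)) => //.
  by rewrite support_point dotp0r.
by move=> B1 a1 B2 a2 <- <-; rewrite support_body_add.
Qed.

Variables (phi : body -> R[i]) (psi : ('I_r -> body) -> R[i]).
Hypothesis pol : polarization phi psi.

(** Minkowski additivity gives additivity in [t]; continuity at the point body turns it into
    homogeneity. *)
Lemma polarization_scale i K A (t : R) : 0 <= t ->
  psi (replace_at K i (body_scale t A)) = t%:C * psi (replace_at K i A).
Proof.
have [cpsi _ psiD _] := pol; move: t.
pose g (t : R) := psi (replace_at K i (body_scale t A)).
have gD (s t : R) : 0 <= s -> 0 <= t -> g (s + t) = g s + g t.
  by move=> s0 t0; rewrite /g body_scaleDl// psiD.
have scale0 : body_scale 0 A = point_body 0.
  by apply: support_inj => y; rewrite support_body_scale// support_point dotp0r mul0r.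
have g0 : g 0 = 0.
  by have /eqP := gD 0 0 (lexx 0) (lexx 0); rewrite addr0 eq_sym -subr_eq0 addrK => /eqP.
have scale1 : body_scale 1 A = A.
  by apply: support_inj => y; rewrite support_body_scale// mul1r.
move=> t t0; rewrite -{2}scale1; apply: (additive_ray gD) => // e e0.
have [d d0 Hd] := cpsi (replace_at K i (point_body 0)) e e0.
have [M M0 HM] := hausdorff_scale_point A.
exists (d / (M + 1)) => [|s s0 sd]; first by rewrite divr_gt0// ltr_wpDl.
rewrite -[g s]subr0 -{1}g0 {2}/g scale0; apply: Hd => j.
have hh (L : body) : hausdorff L L <= 0.
  by apply: hausdorff_le => // y; rewrite subrr normr0 mul0r.
rewrite /replace_at; case: eqP => _; last exact: le_lt_trans (hh _) d0.
apply: le_lt_trans (HM _ s0) _.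
rewrite ltr_pdivlMr ?ltr_wpDl// in sd; apply: le_lt_trans sd.
by rewrite ler_wpM2l// lerDl.
Qed.

(** [D] collects the subsets that avoid [k]; adding [k] to a subset flips the sign and replaces [A]
    by [B]. *)
Lemma alternating_sum_slot k P Q : exists D : body -> R[i],
  [/\ forall A B, D (body_add A B) = D A + D B,
      forall (t : R) A, 0 <= t -> D (body_scale t A) = t%:C * D A &
      forall A B, alternating_sum psi (replace_at P k A) (replace_at Q k B) = D A - D B].
Proof.
have [_ _ psiD _] := pol.
pose mix (S : {set 'I_r}) i := if i \in S then Q i else P i.
exists (fun A => \sum_(S : {set 'I_r} | k \notin S) (-1) ^+ #|S| * psi (replace_at (mix S) k A)).
split=> [A B|t A t0|A B].
- by rewrite -big_split /=; apply: eq_bigr => S _; rewrite psiD mulrDr.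
- rewrite mulr_sumr; apply: eq_bigr => S _; rewrite polarization_scale//.
  by rewrite mulrCA.
rewrite /alternating_sum (bigID (fun S : {set 'I_r} => k \notin S)) /=; congr (_ + _).
  apply: eq_bigr => S kS; congr (_ * psi _); apply/funext => i; rewrite /replace_at /mix.
  by case: (eqVneq i k) => [->|//]; rewrite (negbTE kS).
rewrite -sumrN (reindex_onto (fun S : {set 'I_r} => (k |: S)%SET) (fun S : {set 'I_r} => (S :\ k)%SET)) /=; last first.
  by move=> S; rewrite negbK => kS; rewrite finset.setD1K.
apply: eq_big => [S|S].
  rewrite setU11 /=; apply/eqP/idP => [<-|kS]; first by rewrite !inE eqxx.
  by rewrite setU1K.
rewrite setU11 /= => /eqP kS; have {}kS : k \notin S by rewrite -kS !inE eqxx.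
rewrite cardsU1 kS exprS mulN1r mulNr; congr (- (_ * psi _)); apply/funext => i.
by rewrite /replace_at /mix !inE; case: (eqVneq i k).
Qed.

(** The slots are exchanged one at a time. For one slot, equal differences mean that [A + B'] and
    [A' + B] are the same body, and [D] is additive. *)
Lemma alternating_sum_congr P Q P' Q' :
  (forall i, support_fun (P i) - support_fun (Q i) = support_fun (P' i) - support_fun (Q' i)
     :> (vec -> R)) ->
  alternating_sum psi P Q = alternating_sum psi P' Q'.
Proof.
move=> E.
pose mix (s : seq 'I_r) (P P' : 'I_r -> body) i := if i \in s then P' i else P i.
have -> : P' = mix (enum 'I_r) P P' by apply/funext => i; rewrite /mix mem_enum.
have -> : Q' = mix (enum 'I_r) Q Q' by apply/funext => i; rewrite /mix mem_enum.
elim: (enum _) => [|k s ->].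
  by congr alternating_sum; apply/funext => i.
have mixE (F F' : 'I_r -> body) : mix (k :: s) F F' = replace_at (mix s F F') k (F' k).
  by apply/funext => i; rewrite /mix /replace_at inE; case: (eqVneq i k) => [->|].
have mixE' (F F' : 'I_r -> body) : mix s F F' = replace_at (mix s F F') k (mix s F F' k).
  by apply/funext => i; rewrite /replace_at; case: (eqVneq i k) => [->|].
rewrite 2!mixE [in LHS](mixE' P) [in LHS](mixE' Q).
have [D [DD _ DE]] := alternating_sum_slot k (mix s P P') (mix s Q Q').
rewrite !DE; apply/eqP; rewrite subr_eq addrAC eq_sym subr_eq -!DD; apply/eqP; congr D.
apply: support_inj => y; rewrite !support_body_add /mix.
case: ifP => _; first by rewrite addrC.
have := congr1 (fun f : vec -> R => f y) (E k); rewrite !fctE => H.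
by lra.
Qed.

Lemma alternating_sum_comb k P Q (a : R) (A B A' B' A1 B1 : body) :
  a *: (support_fun A - support_fun B) + (support_fun A' - support_fun B') =
  support_fun A1 - support_fun B1 :> (vec -> R) ->
  alternating_sum psi (replace_at P k A1) (replace_at Q k B1) =
  a%:C * alternating_sum psi (replace_at P k A) (replace_at Q k B) +
  alternating_sum psi (replace_at P k A') (replace_at Q k B').
Proof.
move=> E; have [D [DD DZ DE]] := alternating_sum_slot k P Q; rewrite !DE.
have Ey y : a * (support_fun A y - support_fun B y) + (support_fun A' y - support_fun B' y) =
    support_fun A1 y - support_fun B1 y.
  by have := congr1 (fun f : vec -> R => f y) E; rewrite !fctE.
case: (leP 0 a) => a0.
  have : D (body_add A1 (body_add (body_scale a B) B')) =
         D (body_add B1 (body_add (body_scale a A) A')).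
    congr D; apply: support_inj => y.
    by rewrite !support_body_add !support_body_scale//; have := Ey y; lra.
  rewrite !DD !DZ// => /eqP; rewrite -subr_eq0 => /eqP H.
  apply/eqP; rewrite -subr_eq0 -H; apply/eqP; ring.
have a0' : 0 <= - a by rewrite oppr_ge0 ltW.
have : D (body_add A1 (body_add (body_scale (- a) A) B')) =
       D (body_add B1 (body_add (body_scale (- a) B) A')).
  congr D; apply: support_inj => y.
  by rewrite !support_body_add !support_body_scale//; have := Ey y; lra.
rewrite !DD !DZ// rmorphN /= => /eqP; rewrite -subr_eq0 => /eqP H.
apply/eqP; rewrite -subr_eq0 -H; apply/eqP; ring.
Qed.

Lemma polarization_extension : exists M : ('I_r -> (vec -> R)) -> R[i],
  [/\ multilinear dsupp M,
      forall (s : 'S_r) F, (forall j, dsupp (F j)) -> M (F \o s) = M F,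
      forall K, M (fun j => support_fun (K j)) = psi K &
      forall P Q, M (fun j => support_fun (P j) - support_fun (Q j)) = alternating_sum psi P Q].
Proof.
have [_ psiS psiD _] := pol.
(* A choice of representatives, with a default pair outside [dsupp]; [ME] shows that the choice is
   immaterial on [dsupp]. *)
have H (f : vec -> R) : exists AB : body * body, dsupp f -> f = support_fun AB.1 - support_fun AB.2.
  have [[A [B E]]|nf] := pselect (dsupp f); first by exists (A, B).
  by exists (point_body 0, point_body 0).
have [pn pnE] := choice H.
pose M F := alternating_sum psi (fun j => (pn (F j)).1) (fun j => (pn (F j)).2).
have ME F P Q : (forall j, F j = support_fun (P j) - support_fun (Q j)) ->
    M F = alternating_sum psi P Q.
  move=> E; apply: alternating_sum_congr => i; rewrite -E -pnE//.
  by exists (P i), (Q i).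
exists M; split.
- move=> k F a g h VF Vg Vh.
  pose P j := (pn (F j)).1; pose Q j := (pn (F j)).2.
  have mixE f A B : f = support_fun A - support_fun B ->
      M (slot F k f) = alternating_sum psi (replace_at P k A) (replace_at Q k B).
    move=> E; apply: ME => j; rewrite /slot /replace_at; case: eqP => // _.
    exact: pnE.
  have [A [B gE]] := Vg; have [A' [B' hE]] := Vh.
  have [A1 [B1 E]] := dsupp_comb a A B A' B'.
  rewrite (mixE _ _ _ gE) (mixE _ _ _ hE) (mixE _ A1 B1); last by rewrite gE hE.
  exact: alternating_sum_comb.
- move=> s F VF; rewrite /M /alternating_sum.
  rewrite (reindex_inj (imset_inj (@perm_inj _ s^-1)))/=.
  apply: eq_bigr => S _; rewrite card_imset; last exact: perm_inj.
  rewrite -[in RHS](psiS s); congr (_ * psi _); apply/funext => j /=.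
  suff -> : (j \in (s^-1)%g @: S)%SET = (s j \in S) by [].
  rewrite -{1}(permK s j) mem_imset; first by [].
  by move=> x y; exact: perm_inj.
- move=> K; rewrite (ME _ K (fun=> point_body 0)); last first.
    by move=> j; apply/funext => y; rewrite !fctE /= support_point dotp0r subr0.
  (* Additivity makes [psi] vanish as soon as one slot is the origin, so only the empty subset
     contributes. *)
  rewrite /alternating_sum (bigD1 finset.set0)//= big1 ?addr0 => [|S /set0Pn[k kS]].
    by rewrite cards0 mul1r; congr psi; apply/funext => j; rewrite inE.
  set G := (fun i => if _ then _ else _).
  have -> : G = replace_at G k (point_body 0).
    by apply/funext => j; rewrite /replace_at /G; case: eqP => // ->; rewrite kS.
  have := psiD k G (point_body 0) (point_body 0).
  have -> : body_add (point_body 0) (point_body 0) = point_body 0 :> body.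
    by apply: support_inj => y; rewrite support_body_add support_point dotp0r addr0.
  by move=> /eqP; rewrite eq_sym -subr_eq0 addrK => /eqP ->; rewrite mulr0.
- by move=> P Q; exact: ME.
Qed.

Lemma polarization_diag A : phi A = psi (fun=> A).
Proof.
have [_ _ _ H] := pol.
have := H 1%N (fun=> A) (fun=> 1) (fun=> ler01).
have -> : minkowski_comb (fun _ : 'I_1 => 1) (fun=> A) = A :> body.
  rewrite /minkowski_comb big_ord_recl big_ord0; apply: support_inj => y.
  by rewrite support_body_add support_body_scale// mul1r support_point dotp0r addr0.
move=> ->; rewrite (big_pred1 [ffun=> ord_max]) => [|rho /=]; last first.
  rewrite big_ord1; apply/eqP/eqP => [E|->]; last by rewrite ffunE.
  by apply/ffunP => i; rewrite ord1 ffunE; apply: val_inj.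
rewrite !big_ord1 ffunE expr1n divnn fact_gt0 rmorph1 !mul1r.
congr psi; apply/funext => j; rewrite /repeated /image_mem enum_ordSl.
by rewrite (size0nil (size_enum_ord 0)) /= ffunE cats0 nth_nseq ltn_ord.
Qed.

Lemma polarization_formula K : (0 < r)%N ->
  r`!%:R * psi K =
  \sum_(S : {set 'I_r}) (-1) ^+ #|~: S| * phi (\big[@body_add R n/point_body 0]_(i in S) K i).
Proof.
move=> r0; have [M [HM Msym MK _]] := polarization_extension.
transitivity (\sum_(s : 'S_r) M (fun j => support_fun (K (s j)))).
  rewrite -card_Sn -sum1_card natr_sum mulr_suml; apply: eq_bigr => s _.
  by rewrite mul1r -MK -(Msym s)//= => j; exact: dsupp_support.
rewrite -(polarization_identity subspace_dsupp HM r0 (f := fun i => support_fun (K i))); last first.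
  by move=> i; exact: dsupp_support.
apply: eq_bigr => S _; congr (_ * _).
by rewrite -support_body_sum (MK (fun=> _)) -polarization_diag.
Qed.

End polarization_extension.

Section poly_tools.
Context (R : realType).

Lemma poly_eq0_ray (p : {poly R[i]}) (c : R) :
  (forall t : R, c <= t -> p.[t%:C] = 0) -> p = 0.
Proof.
move=> H; pose rs := [seq (c + k%:R)%:C | k <- iota 0 (size p)].
apply: (@roots_geq_poly_eq0 _ p rs); last by rewrite size_map size_iota.
  by apply/allP => _ /mapP[k _ ->]; apply/rootP/H; rewrite lerDl.
rewrite map_inj_uniq ?iota_uniq// => i j /complexI /addrI /eqP.
by rewrite eqr_nat => /eqP.
Qed.

(** [None] stands for the factor 1: expanding around a translate picks in each slot either a
    coordinate or the untranslated body. *)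
Lemma mpoly_monomial n (s : seq (option 'I_n)) : exists p : mpoly.mpoly n R[i],
  (mpoly.msize p <= (size s).+1)%N /\
  forall v, mpoly.meval v p = \prod_(o <- s) (if o is Some l then v l else 1).
Proof.
suff [m [Hm mE]] : exists m : mpoly.multinom n, (mpoly.mdeg m <= size s)%N /\
    forall v, mpoly.meval v (mpoly.mpolyX R[i] m) = \prod_(o <- s) (if o is Some l then v l else 1).
  by exists (mpoly.mpolyX R[i] m); rewrite mpoly.msizeX.
elim: s => [|o s [m [Hm mE]]].
  exists mpoly.mnm0; rewrite mpoly.mdeg0; split=> // v.
  by rewrite big_nil mpoly.mpolyX0 mpoly.meval1.
case: o => [l|]; last first.
  by exists m; split=> [|v]; [exact: leqW|rewrite mE big_cons mul1r].
exists (mpoly.mnm_add (mpoly.mnm1 l) m); rewrite mpoly.mdegD mpoly.mdeg1; split=> // v.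
by rewrite mpoly.mpolyXD mpoly.mevalM mpoly.mevalXU big_cons mE.
Qed.
End poly_tools.

(** * Localized pieces of a valuation *)

Section cutoff_pieces.
Context (R : realType) (n r : nat).
Local Notation vec := 'rV[R]_n.
Local Notation body := (convex_body R n).
Implicit Types (A B K L : body) (f g : vec -> R) (w : vec -> R).

Definition cutoff w := [/\ smooth_on (@punctured R n) w, deg0 w & forall x, 0 <= w x].

Definition mulf w f : vec -> R := fun y => w y * f y.

Definition cut_body w (C : R) K : body := body_of (mulf w (support_fun K) + C *: @enorm R n).

(** The order of the quantifiers is the point: [C] depends on [K] only through the bound [b]. *)
Lemma support_cut_body w (b : R) : cutoff w -> 0 <= b -> exists2 C : R, 0 <= C &
  forall K, (forall y, `|support_fun K y| <= b * enorm y) -> forall C', C <= C' ->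
    support_fun (cut_body w C' K) = mulf w (support_fun K) + C' *: @enorm R n.
Proof.
move=> [cw w0 wp] b0; have [C C0 HC] := sublinear_cutoff cw w0 (fun x _ => wp x) b0.
exists C => // K HK C' CC'; apply/funext => y.
rewrite support_body_of//; exact: HC (support_sublinear K) HK _ CC'.
Qed.

Lemma mulf_linear w (a : R) f g : mulf w (a *: f + g) = a *: mulf w f + mulf w g.
Proof. by apply/funext => y; rewrite /mulf !fctE mulrDr; congr (_ + _); exact: mulrCA. Qed.

Lemma support_ballE : support_fun (ball_body R n) = @enorm R n.
Proof. by apply/funext => y; rewrite support_ball. Qed.

Lemma dsupp_cutoff w f : cutoff w -> dsupp f -> dsupp (mulf w f).
Proof.
move=> cw [A [B ->]].
have VZ := subspaceZ (@subspace_dsupp R n); have VB := subspaceB (@subspace_dsupp R n).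
have Vs K : dsupp (mulf w (support_fun K)).
  have [b b0 Hb] := support_bound K.
  have [C C0 HC] := support_cut_body cw b0.
  rewrite (_ : mulf _ _ = support_fun (cut_body w C K) - C *: @enorm R n).
    by apply: VB; [exact: dsupp_support|apply: VZ; rewrite -support_ballE; exact: dsupp_support].
  by rewrite (HC K Hb)// addrK.
rewrite (_ : mulf _ _ = mulf w (support_fun A) - mulf w (support_fun B)); first exact: VB.
by apply/funext => y; rewrite /mulf !fctE mulrBr.
Qed.

Lemma multilinear_cutoff (M : ('I_r -> (vec -> R)) -> R[i]) (w : 'I_r -> vec -> R) (s : 'S_r) :
  multilinear (@dsupp R n) M -> (forall j, cutoff (w j)) ->
  multilinear (@dsupp R n) (fun F => M (fun j => mulf (w j) (F (s j)))).
Proof.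
move=> HM cw k F a f g VF Vf Vg.
have E h : (fun j => mulf (w j) (slot F k h (s j))) =
    slot (fun j => mulf (w j) (F (s j))) ((s^-1)%g k) (mulf (w ((s^-1)%g k)) h).
  apply/funext => j; rewrite /slot; case: (eqVneq j ((s^-1)%g k)) => [->|jk].
    by rewrite permKV eqxx.
  by case: eqP => // sk; rewrite -sk permK eqxx in jk.
rewrite !E mulf_linear HM// => [j||]; exact: dsupp_cutoff.
Qed.

Lemma cutoff_bounded w : cutoff w -> exists2 W : R, 0 <= W & forall y, y != 0 -> `|w y| <= W.
Proof.
move=> [cw w0 _]; have [W W0 HW] := smooth_bounded_annulus cw.
exists W => // y y0; rewrite -(deg0_unitv w0 y0); apply: HW.
by apply: unit_annulus; exact: enorm_unitv.
Qed.

Lemma hausdorff_ge0 K L : 0 <= hausdorff K L.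
Proof.
rewrite /hausdorff; set S := (X in inf X).
have [->|/set0P[e Se]] := eqVneq S set0; first by rewrite inf0.
by apply: lb_le_inf; [exists e|move=> ? []].
Qed.

Lemma hausdorff_cut_body w (C W : R) K L :
  (forall y, y != 0 -> `|w y| <= W) -> 0 <= W ->
  support_fun (cut_body w C K) = mulf w (support_fun K) + C *: @enorm R n ->
  support_fun (cut_body w C L) = mulf w (support_fun L) + C *: @enorm R n ->
  hausdorff (cut_body w C K) (cut_body w C L) <= W * hausdorff K L.
Proof.
move=> HW W0 EK EL; have h0 := hausdorff_ge0 K L.
apply: hausdorff_le => [|y]; first exact: mulr_ge0.
rewrite EK EL !fctE opprD addrACA subrr addr0 /mulf -mulrBr normrM -mulrA.
have [->|y0] := eqVneq y 0; first by rewrite !support0 enorm0 subrr normr0 !mulr0.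
by rewrite ler_pM// ?HW// hausdorff_support.
Qed.

Lemma common_bound (I : finType) (K : I -> body) : exists2 b : R, 0 <= b &
  forall i y, `|support_fun (K i) y| <= b * enorm y.
Proof.
have H i : exists b : R, 0 <= b /\ forall y, `|support_fun (K i) y| <= b * enorm y.
  by have [b b0 Hb] := support_bound (K i); exists b.
have [b Hb] := choice H; exists (\sum_i b i) => [|i y].
  by apply: sumr_ge0 => i _; have [] := Hb i.
have [_ /(_ y) Hi] := Hb i; apply: (le_trans Hi); rewrite ler_wpM2r ?enorm_ge0//.
by rewrite (bigD1 i)//= lerDl; apply: sumr_ge0 => j _; have [] := Hb j.
Qed.
End cutoff_pieces.

Section pieces.
Context (R : realType) (n r : nat).
Local Notation vec := 'rV[R]_n.
Local Notation body := (convex_body R n).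
Local Notation dsupp := (@dsupp R n).
Implicit Types (A B K L : body).
Variables (phi : body -> R[i]) (psi : ('I_r -> body) -> R[i]) (M : ('I_r -> (vec -> R)) -> R[i]).
Hypotheses (phi_val : valuation phi) (pol : polarization phi psi) (HM : multilinear dsupp M).
Hypothesis M_sym : forall (s : 'S_r) F, (forall j, dsupp (F j)) -> M (F \o s) = M F.
Hypothesis M_support : forall K : 'I_r -> body, M (fun j => support_fun (K j)) = psi K.
Hypothesis M_sub : forall P Q : 'I_r -> body,
  M (fun j => support_fun (P j) - support_fun (Q j)) = alternating_sum psi P Q.
Let VH := @subspace_dsupp R n.

Lemma diag_cutoff_valuation (w : vec -> R) : cutoff w ->
  valuation (fun K => M (fun=> mulf w (support_fun K))).
Proof.
move=> cw K L U I HU HI.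
(* The four bodies are indexed together so as to share one bound and one constant [C]. *)
pose X (c : bool * bool) := if c.1 then if c.2 then U else I else if c.2 then K else L.
have [b b0 Hb] := common_bound X.
have [C C0 HC] := support_cut_body cw b0.
have Hcut t c : C <= t -> support_fun (cut_body w t (X c)) = mulf w (support_fun (X c)) + t *: @enorm R n.
  by move=> Ct; exact: HC.
have H c : exists p : {poly R[i]}, forall t : R,
    M (fun=> mulf w (support_fun (X c)) + t *: @enorm R n) = p.[t%:C].
  apply: (multilinear_diag_poly VH HM); first by apply: dsupp_cutoff => //; exact: dsupp_support.
  by rewrite -support_ballE; exact: dsupp_support.
have [p Hp] := choice H.
have pE t c : C <= t -> (p c).[t%:C] = phi (cut_body w t (X c)).
  move=> Ct; rewrite -Hp -Hcut// (polarization_diag pol).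
  by rewrite -(M_support (fun=> cut_body w t (X c))).
have p0 c : (p c).[0] = M (fun=> mulf w (support_fun (X c))).
  by rewrite -[0 in LHS](rmorph0 (real_complex R)) -Hp; congr M; apply/funext => _; rewrite scale0r addr0.
(* For [t >= C] the relation is the valuation property of [phi] at the cut bodies; a polynomial
   vanishing on a ray is 0, so the relation also holds at [t = 0]. *)
have E : p (true, true) + p (true, false) - (p (false, true) + p (false, false)) = 0.
  apply: (@poly_eq0_ray _ _ C) => t Ct; rewrite !hornerE !pE// /X /=.
  apply/eqP; rewrite subr_eq0; apply/eqP.
  have [_ _ wp] := cw.
  have cutE (c : bool * bool) y : support_fun (cut_body w t (X c)) y = w y * support_fun (X c) y + t * enorm y.
    by rewrite Hcut.
  have [SU SI] : body_set (cut_body w t U) = body_set (cut_body w t K) `|` body_set (cut_body w t L) /\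
      body_set (cut_body w t I) = body_set (cut_body w t K) `&` body_set (cut_body w t L).
    (* Multiplication by [w y] commutes with maxima and minima because [w y >= 0]. *)
    apply: support_lattice_sets => y.
      rewrite (cutE (true, true)) (cutE (false, true)) (cutE (false, false)) /X /=.
      by rewrite (union_support HU) maxr_pMr// addr_maxl.
    rewrite (cutE (true, false)) (cutE (false, true)) (cutE (false, false)) /X /=.
    by rewrite (inter_support HU HI) minr_pMr// addr_minl.
  exact: phi_val SU SI.
have := congr1 (fun q : {poly R[i]} => q.[0]) E.
rewrite !(hornerD, hornerN, horner0) !p0 => /eqP; rewrite subr_eq0 => /eqP.
exact.
Qed.

Variables (w : 'I_r -> vec -> R).
Hypothesis cw : forall j, cutoff (w j).

Definition piece K : R[i] := M (fun j => mulf (w j) (support_fun K)).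

(** In each slot [w_j h_L] is the support function of a cut body minus that of a ball of radius [C].
    The piece is therefore a fixed signed sum of values of [psi] at bodies that depend on [L] in a
    Lipschitz way. *)
Lemma piece_continuous : hausdorff_continuous piece.
Proof.
move=> K e e0; have [cpsi _ _ _] := pol.
have [b b0 Hb] := support_bound K.
(* The extra 1 lets the same constants serve every [L] with [hausdorff K L < 1]. *)
have b10 : 0 <= b + 1 by exact: addr_ge0.
have HC0 j : exists C : R, 0 <= C /\ forall L, (forall y, `|support_fun L y| <= (b + 1) * enorm y) ->
    forall C', C <= C' -> support_fun (cut_body (w j) C' L) = mulf (w j) (support_fun L) + C' *: @enorm R n.
  by have [C C0 HC] := support_cut_body (cw j) b10; exists C.
have [Cj HCj] := choice HC0.
pose C := \sum_j Cj j.
have HC L j : (forall y, `|support_fun L y| <= (b + 1) * enorm y) ->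
    support_fun (cut_body (w j) C L) = mulf (w j) (support_fun L) + C *: @enorm R n.
  move=> HL; have [_ H] := HCj j; apply: H HL _ _.
  rewrite /C (bigD1 j)//= lerDl; apply: sumr_ge0 => i _; by have [] := HCj i.
have C0 : 0 <= C by apply: sumr_ge0 => j _; have [] := HCj j.
have bK y : `|support_fun K y| <= (b + 1) * enorm y.
  by apply: (le_trans (Hb y)); rewrite ler_wpM2r ?enorm_ge0// lerDl.
have bL L : hausdorff K L < 1 -> forall y, `|support_fun L y| <= (b + 1) * enorm y.
  move=> KL y; rewrite -[support_fun L y](subrK (support_fun K y)) mulrDl mul1r addrC.
  apply: (le_trans (ler_normD _ _)); apply: lerD; first exact: Hb.
  rewrite distrC; apply: (le_trans (hausdorff_support _ _ _)).
  by rewrite ler_piMl ?enorm_ge0// ltW.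
pose cb := body_scale C (ball_body R n).
have hcb : support_fun cb = C *: @enorm R n.
  by apply/funext => y; rewrite support_body_scale// support_ball.
pose G L (S : {set 'I_r}) j := if j \in S then cb else cut_body (w j) C L.
have pieceE L : (forall y, `|support_fun L y| <= (b + 1) * enorm y) ->
    piece L = \sum_(S : {set 'I_r}) (-1) ^+ #|S| * psi (G L S).
  move=> HL; rewrite -[RHS](M_sub (fun j => cut_body (w j) C L) (fun=> cb)).
  by congr M; apply/funext => j; rewrite HC// hcb addrK.
have HW0 j : exists W : R, 0 <= W /\ forall y, y != 0 -> `|w j y| <= W.
  by have [W W0 HW] := cutoff_bounded (cw j); exists W.
have [Wj HWj] := choice HW0.
pose W := \sum_j Wj j.
have W0 : 0 <= W by apply: sumr_ge0 => j _; have [] := HWj j.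
have HW j y : y != 0 -> `|w j y| <= W.
  move=> y0; have [_ H] := HWj j; apply: (le_trans (H y y0)).
  rewrite /W (bigD1 j)//= lerDl; apply: sumr_ge0 => i _; by have [] := HWj i.
(* There are [N] terms of size at most [e / N.+1], hence a sum strictly below [e]. *)
pose N := #|{set 'I_r}|.
have N0 : 0 < N.+1%:R :> R by rewrite ltr0n.
have Hd S : exists d : R, 0 < d /\ forall L : 'I_r -> body,
    (forall i, hausdorff (G K S i) (L i) < d) -> Normc.normc (psi L - psi (G K S)) < e / N.+1%:R.
  by have [d d0 Hd] := cpsi (G K S) (e / N.+1%:R) (divr_gt0 e0 N0); exists d.
have [d0 Hd0] := choice Hd.
pose d := \big[Num.min/1]_S d0 S.
have dp : 0 < d by apply: lt_bigmin => // S _; have [] := Hd0 S.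
have dS S : d <= d0 S by exact: bigmin_le_cond.
exists (Num.min 1 (d / (W + 1))) => [|L].
  by rewrite lt_min ltr01 divr_gt0// ltr_wpDl.
rewrite lt_min => /andP[KL1 KLd]; rewrite (pieceE L (bL L KL1)) (pieceE K bK) -sumrB.
have hd : W * hausdorff K L < d.
  rewrite ltr_pdivlMr ?ltr_wpDl// in KLd; apply: le_lt_trans KLd.
  by rewrite mulrC ler_wpM2l ?hausdorff_ge0// lerDl.
have term (S : {set 'I_r}) : Normc.normc ((-1) ^+ #|S| * psi (G L S) - (-1) ^+ #|S| * psi (G K S)) <= e / N.+1%:R.
  rewrite -mulrBr -signr_odd; set z := psi _ - _.
  have -> : Normc.normc ((-1) ^+ odd #|S| * z) = Normc.normc z.
    by case: (odd _); rewrite ?expr0 ?mul1r// expr1 mulN1r normcN.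
  apply: ltW; have [_ H] := Hd0 S; apply: H => i; apply: lt_le_trans (dS S).
  rewrite /G; case: ifP => _.
    by apply: le_lt_trans dp; apply: hausdorff_le => // y; rewrite subrr normr0 mul0r.
  apply: le_lt_trans hd; apply: hausdorff_cut_body => // [y||]; first exact: HW.
    exact: HC.
  by apply: HC; exact: bL.
have sumb (s : seq {set 'I_r}) (F : {set 'I_r} -> R[i]) : (forall S, Normc.normc (F S) <= e / N.+1%:R) ->
    Normc.normc (\sum_(S <- s) F S) <= (size s)%:R * (e / N.+1%:R).
  move=> HF; elim: s => [|S s IH]; first by rewrite big_nil Normc.normc0 mul0r.
  rewrite big_cons /= -natr1 mulrDl mul1r; apply: (le_trans (le_normcD _ _)).
  by rewrite [leRHS]addrC; apply: lerD; [exact: HF|exact: IH].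
apply: (le_lt_trans (sumb _ _ term)).
have -> : size (index_enum {set 'I_r}) = N by rewrite /N cardT enumT.
by rewrite mulrCA -[ltRHS]mulr1 ltr_pM2l// ltr_pdivrMr// mul1r ltr_nat.
Qed.

Lemma piece_homogeneous (t : R) K : 0 <= t -> piece (body_scale t K) = t%:C ^+ r * piece K.
Proof.
(* A sum over the one-element type [unit] turns simultaneous scaling of all slots into an instance
   of the multilinear expansion. *)
move=> t0; have -> : piece (body_scale t K) =
    M (fun j => \sum_(l : unit) t *: mulf (w j) (support_fun K)).
  congr M; apply/funext => j; rewrite big_const card_unit /= addr0; apply/funext => y.
  by rewrite /mulf support_body_scale// !fctE mulrCA.
rewrite (multilinear_expansion VH HM tt (fun _ _ => t) (F := fun j _ => mulf (w j) (support_fun K))).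
  rewrite (big_pred1 [ffun=> tt]) => [|c]; last first.
    by rewrite /=; apply/esym/eqP/ffunP => j; rewrite ffunE; case: (c j).
  by rewrite prodr_const card_ord rmorphXn.
move=> j _; apply: dsupp_cutoff => //; exact: dsupp_support.
Qed.

Lemma multilinear_piece : multilinear dsupp (fun F => M (fun j => mulf (w j) (F j))).
Proof.
have := multilinear_cutoff 1 HM cw.
by under eq_fun do under eq_fun do rewrite perm1.
Qed.

Lemma cutoff_sum (S : {set 'I_r}) : cutoff (fun x => \sum_(i in S) w i x).
Proof.
split=> [|t x t0|x].
- by apply: smooth_on_sum; [exact: open_punctured|move=> i _; have [] := cw i].
- by apply: eq_bigr => i _; have [_ + _] := cw i; exact.
- by apply: sumr_ge0 => i _; have [_ _] := cw i.
Qed.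

Lemma piece_valuation : (0 < r)%N -> valuation piece.
Proof.
move=> r0 K L U I HU HI.
have E X : r`!%:R * piece X = \sum_(S : {set 'I_r}) (-1) ^+ #|~: S| *
    M (fun=> mulf (fun y => \sum_(i in S) w i y) (support_fun X)).
  transitivity (\sum_(s : 'S_r) M (fun j => mulf (w (s j)) (support_fun X))).
    rewrite -card_Sn -sum1_card natr_sum mulr_suml; apply: eq_bigr => s _.
    rewrite mul1r /piece -(M_sym s)//= => j; apply: dsupp_cutoff => //; exact: dsupp_support.
  rewrite -(polarization_identity VH HM r0 (f := fun i => mulf (w i) (support_fun X))); last first.
    by move=> i; apply: dsupp_cutoff => //; exact: dsupp_support.
  apply: eq_bigr => S _; congr (_ * M _); apply/funext => _; apply/funext => y.
  by rewrite fct_sumE /mulf mulr_suml.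
apply: (@mulfI _ r`!%:R); first by rewrite pnatr_eq0 -lt0n fact_gt0.
rewrite !mulrDr !E -!big_split /=; apply: eq_bigr => S _; rewrite -!mulrDr.
by congr (_ * _); apply: (diag_cutoff_valuation (cutoff_sum S)).
Qed.

(** The support function of [K + x] is [h_K + \sum_l x_l h_(e_l)], where [h_(e_l)] is the coordinate
    function. The multilinear expansion is then polynomial in [x] of degree at most the number of
    slots. The index [ord0] stands for [K], the others for the points [e_l]. *)
Lemma piece_polynomial : polynomial_of_degree_le r piece.
Proof.
move=> K.
pose F (o : 'I_n.+1) := if unlift ord0 o is Some l then support_fun (point_body (delta_mx 0 l))
  else support_fun K.
have VF o : dsupp (F o) by rewrite /F; case: (unlift _ _) => [l|]; exact: dsupp_support.
have H (c : {ffun 'I_r -> 'I_n.+1}) := mpoly_monomial R [seq unlift ord0 (c j) | j <- index_enum 'I_r].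
have [p Hp] := choice H.
exists (\sum_(c : {ffun 'I_r -> 'I_n.+1}) M (fun j => mulf (w j) (F (c j))) *: p c); split.
  apply: (leq_trans (mpoly.mmeasure_sum _ _ _ _)); apply/bigmax_leqP => c _.
  apply: (leq_trans (mpoly.msizeZ_le _ _)); have [+ _] := Hp c.
  by rewrite size_map -[index_enum _]enumT size_enum_ord.
move=> x.
pose a (o : 'I_n.+1) : R := if unlift ord0 o is Some l then x 0 l else 1.
transitivity (M (fun j => mulf (w j) (\sum_o a o *: F o))).
  congr M; apply/funext => j; congr mulf; rewrite big_ord_recl /a /F unlift_none scale1r.
  apply/funext => y; rewrite support_body_add support_point !fctE fct_sumE; congr (_ + _).
  rewrite dotpC; apply: eq_bigr => l _; by rewrite liftK /= !fctE support_point [in RHS]dotpC dotp_delta.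
have /= -> // := multilinear_expansion VH multilinear_piece ord0 (fun=> a) (F := fun=> F).
rewrite raddf_sum; apply: eq_bigr => c _; rewrite /= mpoly.mevalZ mulrC; congr (_ * _).
have [_ ->] := Hp c; rewrite big_map rmorph_prod; apply: eq_bigr => j _.
by rewrite /a; case: (unlift _ _) => // l; rewrite rmorph1.
Qed.

Lemma piece_PVal : (0 < r)%N -> PVal r piece.
Proof.
move=> r0; split=> [|t K t0]; last exact: piece_homogeneous.
exists r; split; [exact: piece_valuation|exact: piece_continuous|exact: piece_polynomial].
Qed.

(** The polarization of the piece is the symmetrization of [M] with cutoffs. In each of its terms
    the slot [j0] contains [w j0 * (h_P - h_Q)], which is 0: the difference vanishes on [A], the
    cutoff off [A]. *)
Lemma piece_alternating (A : set vec) (j0 : 'I_r) psi' (P Q : 'I_r -> body) :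
  (forall u, enorm u = 1 -> ~ A u -> w j0 u = 0) -> polarization piece psi' ->
  (forall i u, A u -> support_fun (P i) u = support_fun (Q i) u) ->
  alternating_sum psi' P Q = 0.
Proof.
move=> wA pol' PQ.
have r0 : (0 < r)%N by apply: leq_ltn_trans (ltn_ord j0).
have key (K : 'I_r -> body) : r`!%:R * psi' K =
    \sum_(s : 'S_r) M (fun j => mulf (w j) (support_fun (K (s j)))).
  rewrite (polarization_formula pol')//.
  rewrite -(polarization_identity VH multilinear_piece r0 (f := fun i => support_fun (K i))); last first.
    by move=> i; exact: dsupp_support.
  by apply: eq_bigr => S _; rewrite /piece support_body_sum.
apply: (@mulfI _ r`!%:R); first by rewrite pnatr_eq0 -lt0n fact_gt0.
rewrite mulr0 /alternating_sum mulr_sumr.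
under eq_bigr do rewrite mulrCA key mulr_sumr.
rewrite exchange_big big1//= => s _.
have Vs (K : 'I_r -> body) j : dsupp (support_fun (K j)) by exact: dsupp_support.
have := multilinear_sub VH (multilinear_cutoff s HM cw) (Vs P) (Vs Q).
rewrite (@multilinear0 _ _ _ _ VH _ HM _ j0) => [E||].
- rewrite [RHS]E; apply: eq_bigr => S _; congr (_ * M _); apply/funext => j.
  by case: ifP.
- by move=> j; apply: dsupp_cutoff => //; apply: (subspaceB VH).
apply/funext => y; rewrite /mulf !fctE.
have [->|y0] := eqVneq y 0; first by rewrite !support0 subrr mulr0.
have [_ w0 _] := cw j0.
rewrite -(deg0_unitv w0 y0); have y1 := enorm_unitv y0.
have [Au|nA] := pselect (A (unitv y)); last by rewrite wA// mul0r.
have hE (B : body) : support_fun B y = enorm y * support_fun B (unitv y).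
  by rewrite -(proj2 (support_sublinear B)) ?enorm_ge0// enorm_unitvK.
by rewrite !hE (PQ _ _ Au) subrr mulr0.
Qed.

End pieces.

(** * Partition of unity and decomposition *)

(** Bumps of the angle to finitely many centres, divided by their sum and extended with degree 0.
    [Al l] is the closed cap whose interior carries the bump. *)
Lemma sphere_partition (R : realType) (n : nat) (A : Type) (a0 : A) (U : A -> set 'rV[R]_n) :
  (forall a, sphere_open (U a)) -> \bigcup_(a in [set: A]) U a = @usphere R n ->
  exists (m : nat) (w : 'I_m -> 'rV[R]_n -> R) (Al : 'I_m -> set 'rV[R]_n),
    [/\ forall l, cutoff (w l),
        forall l, closed (Al l) /\ Al l `<=` @usphere R n,
        forall l, exists a, Al l `<=` U a,
        forall l u, enorm u = 1 -> ~ Al l u -> w l u = 0 &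
        forall x, x != 0 -> \sum_l w l x = 1].
Proof.
move=> Uo Uc.
have H (u : 'rV[R]_n) : exists p : A * R, p.2 < 1 /\ (enorm u = 1 ->
    forall v, enorm v = 1 -> p.2 <= dotp u v -> U p.1 v).
  have [u1|u1] := pselect (enorm u = 1); last by exists (a0, 0).
  have [a _ Uau] : (\bigcup_(a in [set: A]) U a) u by rewrite Uc.
  have [V oV UV] := Uo a; pose F := @usphere R n `&` ~` V.
  have cF : closed F by apply: closedI; [exact: closed_usphere|exact: open_closedC].
  have nF : ~ F u by move: Uau; rewrite UV => -[Ou _] [_]; exact.
  have [c c1 Hc] := usphere_cap cF u1 nF.
  (* A level strictly above [c], so that the closed cap still lies in the open set. *)
  exists (a, (c + 1) / 2); split=> [/=|_ v v1 /= cv]; first lra.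
  have := Hc v v1; rewrite UV => Hv; split=> //; apply: contrapT => nO; apply: Hv => //; lra.
have [p Hp] := choice H.
pose c u := (p u).2.
have oO u : open [set x : 'rV[R]_n | c u < dotp u x].
  apply: (@open_comp _ _ (fun x : 'rV[R]_n => dotp u x) [set t : R | c u < t]).
    by move=> x _; exact: dotp_continuous.
  exact: open_gt.
have := @compact_usphere R n; rewrite compact_cover => /(_ _ (@usphere R n) _ (fun u _ => oO u)).
case=> [u u1|D DS Dc].
  exists u => //=; have [c1 _] := Hp u.
  by rewrite -enorm_sqr u1 expr1n.
pose s := finmap.enum_fset D; pose m := size s.
pose v (l : 'I_m) := nth 0 s l.
have v1 l : enorm (v l) = 1.
  have vs : v l \in s by exact: mem_nth.
  by have := DS (v l) vs; rewrite inE.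
pose b (l : 'I_m) x := bump 0 ((enorm x)^-1 * dotp (v l) x - c (v l)).
have b_ge0 l x : 0 <= b l x.
  rewrite /b; set t := _ - _; have [t0|t0] := leP t 0; first by rewrite bump_le0.
  exact: ltW (bump_gt0 t0).
have oP := @open_punctured R n.
have cb l : smooth_on (@punctured R n) (b l).
  apply: smooth_on_bump => //; apply: smooth_onB => //; last exact: smooth_on_cst.
  apply: smooth_onM => //; last exact: smooth_dotp.
  apply: smooth_onV => //; last exact: smooth_enorm.
  by move=> x x0; rewrite enorm_eq0.
have b0 l : deg0 (b l).
  move=> t x t0; rewrite /b enormZ dotpZr gtr0_norm// invfM.
  by rewrite mulrACA mulVf ?mul1r// gt_eqF.
pose B x := \sum_l b l x.
have B0 x : x != 0 -> 0 < B x.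
  move=> x0; have [u uD /= cu] := Dc (unitv x) (enorm_unitv x0).
  have ui : (index u s < m)%N by rewrite index_mem.
  rewrite /B (bigD1 (Ordinal ui))//=; apply: ltr_pwDl; last by apply: sumr_ge0 => l _.
  apply: bump_gt0; rewrite /v/= nth_index// subr_gt0.
  by rewrite -dotpZr.
exists m, (fun l x => (B x)^-1 * b l x), (fun l => [set x | enorm x = 1 /\ c (v l) <= dotp (v l) x]).
split.
- move=> l; split=> [|t x t0|x].
  + apply: smooth_onM => //; apply: smooth_onV => // [x x0|]; first by rewrite gt_eqF// B0.
    by apply: smooth_on_sum => // i _.
  + by rewrite b0//; congr (_^-1 * _); apply: eq_bigr => i _; rewrite b0.
  + by rewrite mulr_ge0// invr_ge0 sumr_ge0.
- move=> l; split; last by move=> x [].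
  apply: closedI; first exact: closed_usphere.
  apply: (@preimage_closed _ _ (fun x : 'rV[R]_n => dotp (v l) x) [set t : R | c (v l) <= t]).
    by move=> x _; exact: dotp_continuous.
  exact: closed_ge.
- by move=> l; exists (p (v l)).1 => x [x1 cx]; have [_ /(_ (v1 l))] := Hp (v l); exact.
- move=> l u u1 nA; rewrite /b u1 invr1 mul1r bump_le0 ?mulr0// subr_le0.
  by rewrite leNgt; apply/negP => cu; apply: nA; split=> //; exact: ltW.
- by move=> x x0; rewrite -mulr_sumr mulVf// gt_eqF// B0.
Qed.

(** * Vertical supports of homogeneous valuations *)

Section uniqueness.
Context (R : realType) (n : nat).
Local Notation body := (convex_body R n).
Implicit Types (chi : body -> R[i]) (K : body).

(** Both sides at [t K] are polynomials in [t] that agree for [t >= 0], so their coefficients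
    agree. *)
Lemma homogeneous_component_unique r chi d (phis : nat -> body -> R[i]) :
  PVal r chi -> homogeneous_decomposition d chi phis -> forall s, (s <= d + n)%N ->
  phis s = if s == r then chi else fun=> 0.
Proof.
move=> [_ chir] [_ Hphis Hsum] s sd; apply/funext => K.
pose q := chi K *: 'X^r - \sum_(0 <= j < (d + n).+1) phis j K *: 'X^j : {poly R[i]}.
have q0 : q = 0.
  apply: (@poly_eq0_ray _ _ 0) => t t0; rewrite /q !hornerE horner_sum mulrC -chir// Hsum.
  apply/eqP; rewrite subr_eq0; apply/eqP/eq_big_nat => j; rewrite ltnS => /andP[_ jd].
  by have [_ ->] := Hphis j jd; rewrite // !hornerE mulrC.
have := congr1 (fun q : {poly R[i]} => q`_s) q0.
rewrite /q coefB coefZ coefXn coef0 coef_sum => /eqP; rewrite subr_eq0 => /eqP.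
rewrite big_mkord (bigD1 (Ordinal (sd : (s < (d + n).+1)%N)))//= coefZ coefXn eqxx mulr1.
rewrite big1 ?addr0 => [<-|j js].
  by case: eqP => _; rewrite ?mulr1 ?mulr0.
rewrite coefZ coefXn; case: eqP => [sj|_]; last by rewrite mulr0.
by case/eqP: js; apply: val_inj.
Qed.

Lemma v_supp_hom0 r : (0 < r)%N -> v_supp_hom r (fun _ : body => 0) = set0.
Proof.
move=> r0; apply/seteqP; split; last by move=> u.
apply: v_supp_hom_sub; [exact: closed0|by move=> u|move=> psi pol P Q _].
have psi0 (K : 'I_r -> body) : psi K = 0.
  apply: (@mulfI _ r`!%:R); first by rewrite pnatr_eq0 -lt0n fact_gt0.
  by rewrite (polarization_formula pol)// mulr0 big1// => S _; rewrite mulr0.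
by rewrite /alternating_sum big1// => S _; rewrite psi0 mulr0.
Qed.

(** [v_supp] ranges over all decompositions; by uniqueness each has [chi] in degree [r] and zero
    elsewhere, and zero has empty support. *)
Lemma v_supp_PVal r chi (A : set 'rV[R]_n) : PVal r chi ->
  ((0 < r)%N -> v_supp_hom r chi `<=` A) -> v_supp chi `<=` A.
Proof.
move=> Hchi HA u [d [phis [Hd [s /andP[s0 sd]]]]].
rewrite (homogeneous_component_unique Hchi Hd sd).
have [sr|_] := eqVneq s r; first by rewrite -sr in HA *; exact: HA.
by rewrite v_supp_hom0.
Qed.
End uniqueness.

(** * Finite sums of subordinate valuations *)

Section subordinate_sums.
Context (R : realType) (n : nat).
Local Notation body := (convex_body R n).
Variables (A : Type) (U : A -> set 'rV[R]_n).
Implicit Types (f g : body -> R[i]).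

Definition subordinate f := cont_poly_val f /\ exists a, v_supp f `<=` U a.

(** An arbitrary finite index type makes sums of decompositions disjoint unions; it is numbered only
    at the end. *)
Definition decomposable f := exists (I : finType) (F : I -> body -> R[i]),
  [/\ (0 < #|I|)%N, forall j, subordinate (F j) & forall K, f K = \sum_j F j K].

Lemma subordinate_decomposable f : subordinate f -> decomposable f.
Proof.
move=> sf; exists unit, (fun=> f); split=> //; first by rewrite card_unit.
by move=> K; rewrite (big_pred1 tt) => // -[].
Qed.

Lemma decomposableD f g h : decomposable f -> decomposable g -> (forall K, h K = f K + g K) ->
  decomposable h.
Proof.
move=> [I [F [I0 HF fE]]] [J [G [J0 HG gE]]] hE.
exists (I + J)%type, (fun k => match k with inl i => F i | inr j => G j end); split.
- by rewrite card_sum addn_gt0 I0.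
- by case.
- by move=> K; rewrite hE fE gE big_sumType.
Qed.

Lemma decomposable_sum (I : eqType) (s : seq I) (F : I -> body -> R[i]) :
  decomposable (fun=> 0) -> (forall i, i \in s -> decomposable (F i)) ->
  decomposable (fun K => \sum_(i <- s) F i K).
Proof.
move=> d0; elim: s => [_|i s IH HF].
  by rewrite (_ : (fun K => _) = fun=> 0)//; apply/funext => K; rewrite big_nil.
apply: (decomposableD (HF i _) (IH _)) => [|j js|K]; first by rewrite inE eqxx.
  by apply: HF; rewrite inE js orbT.
by rewrite big_cons.
Qed.
End subordinate_sums.

Lemma PVal_decomposable (R : realType) (n : nat) (A : Type) (U : A -> set 'rV[R]_n) (a0 : A)
    (r : nat) (chi : convex_body R n -> R[i]) : (0 < n)%N ->
  (forall a, sphere_open (U a)) -> \bigcup_(a in [set: A]) U a = @usphere R n ->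
  decomposable U (fun=> 0) -> PVal r chi -> decomposable U chi.
Proof.
move=> n0 Uo Uc dec0 Hchi; have [[d [chi_val _ _]] _] := Hchi.
have [r0|r0] := posnP r.
  apply: subordinate_decomposable; split; first by have [] := Hchi.
  by exists a0; apply: (v_supp_PVal Hchi); rewrite r0.
(* A Goodey-Weil distribution comes with a polarization. If there is none, the vertical support of
   [chi] is empty by definition and [chi] is a single piece. *)
have [[T [_ [psi [pol _]]]]|nT] := pselect (exists T, @goodey_weil R n r chi T); last first.
  apply: subordinate_decomposable; split; first by have [] := Hchi.
  exists a0; apply: (v_supp_PVal Hchi) => _ u [_ [T HT _]].
  by exfalso; apply: nT; exists T.
have [M [HM Msym MK Msub]] := polarization_extension pol.
have [m [w [Al [cw HAl AlU wA w1]]]] := sphere_partition a0 Uo Uc.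
have x0 : delta_mx 0 (Ordinal n0) != 0 :> 'rV[R]_n.
  by apply/eqP => /rowP/(_ (Ordinal n0)) /eqP; rewrite !mxE !eqxx oner_eq0.
(* The weights sum to 1 at the nonzero vector [delta_mx 0 (Ordinal n0)], so the partition is
   nonempty and its expansion has an initial choice. *)
have m0 : (0 < m)%N.
  rewrite lt0n; apply/eqP => m0; have := w1 _ x0; rewrite big1 => [/eqP|l _].
    by rewrite eq_sym oner_eq0.
  by have := ltn_ord l; rewrite {2}m0.
have -> : chi = fun K => \sum_(c : {ffun 'I_r -> 'I_m}) piece M (fun j => w (c j)) K.
  apply/funext => K; rewrite (polarization_diag pol) -(MK (fun=> K)).
  transitivity (M (fun j => \sum_l 1 *: mulf (w l) (support_fun K))).
    congr M; apply/funext => _; apply/funext => y; rewrite fct_sumE.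
    have [->|y0] := eqVneq y 0.
      by rewrite support0 big1// => l _; rewrite scale1r /mulf support0 mulr0.
    rewrite -[LHS]mul1r -{1}(w1 y y0) mulr_suml; apply: eq_bigr => l _.
    exact/esym/mul1r.
  rewrite (multilinear_expansion (@subspace_dsupp R n) HM (Ordinal m0) (fun _ _ => 1)
    (F := fun _ l => mulf (w l) (support_fun K))); last first.
    by move=> _ l; apply: dsupp_cutoff => //; exact: dsupp_support.
  by apply: eq_bigr => c _; rewrite big1// rmorph1 mul1r.
apply: decomposable_sum => // c _; apply: subordinate_decomposable.
have cwc j : cutoff (w (c j)) by exact: cw.
have Hc := piece_PVal chi_val pol HM Msym MK Msub cwc r0.
split; first by have [] := Hc.
have [a Ha] := AlU (c (Ordinal r0)); exists a; apply: (v_supp_PVal Hc) => _ u Hu.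
apply: Ha; have [cA sA] := HAl (c (Ordinal r0)); move: u Hu; apply: v_supp_hom_sub => //.
move=> psi' pol' P Q PQ.
exact: (piece_alternating HM cwc (j0 := Ordinal r0) (wA (c (Ordinal r0))) pol' PQ).
Qed.

Theorem theorem2 (R : realType) (n : nat) (hn : (0 < n)%N)
    (phi : convex_body R n -> R[i]) (hphi : cont_poly_val phi)
    (A : Type) (U : A -> set 'rV[R]_n)
    (hUopen : forall a, sphere_open (U a))
    (hUcover : \bigcup_(a in [set: A]) U a = @usphere R n) :
  exists (M : nat) (phis : 'I_M -> convex_body R n -> R[i]),
    [/\ (0 < M)%N,
        forall j, cont_poly_val (phis j),
        forall j, exists a, v_supp (phis j) `<=` U a &
        forall K, phi K = \sum_(j < M) phis j K].
Proof.
have [a0 _] : exists a0 : A, True.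
  have x1 : enorm (delta_mx 0 (Ordinal hn) : 'rV[R]_n) = 1.
    by rewrite /enorm dotp_delta mxE !eqxx sqrtr1.
  have : (\bigcup_(a in [set: A]) U a) (delta_mx 0 (Ordinal hn)) by rewrite hUcover.
  by case=> a _ _; exists a.
(* The zero valuation stands for the empty sum, since a decomposition must have at least one
   term. *)
have dec0 : decomposable U (fun=> 0).
  apply: subordinate_decomposable.
  have P0 : PVal 1 (fun _ : convex_body R n => 0 : R[i]).
    split; last by move=> t K _; rewrite mulr0.
    exists 0%N; split=> [K L V I _ _|K e e0|K]; first by rewrite !addr0.
      by exists 1 => // L _; rewrite subrr Normc.normc0.
    by exists 0; rewrite mpoly.mmeasure0; split=> // x; rewrite mpoly.meval0.
  split; first by have [] := P0.
  by exists a0; apply: (v_supp_PVal P0) => _; rewrite v_supp_hom0.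
suff [I [F [I0 HF phiE]]] : decomposable U phi.
  exists #|I|, (fun j => F (enum_val j)); split=> // [j|j|K].
  - by have [] := HF (enum_val j).
  - by have [_] := HF (enum_val j).
  - by rewrite phiE big_enum_val; apply: eq_bigr => i _.
(* If [phi] has no homogeneous decomposition, [v_supp phi] is empty by definition and [phi] itself
   is subordinate. *)
have [[d [phis Hd]]|nd] := pselect (exists d phis, homogeneous_decomposition d phi phis).
  have [_ Hphis phiE] := Hd.
  have -> : phi = fun K => \sum_(s <- index_iota 0 (d + n).+1) phis s K.
    by apply/funext => K; exact: phiE.
  apply: decomposable_sum => // s; rewrite mem_index_iota ltnS => /andP[_ sd].
  exact: (PVal_decomposable a0 hn hUopen hUcover dec0 (Hphis s sd)).
apply: subordinate_decomposable; split=> //; exists a0 => u [d [phis [Hd _]]].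
by exfalso; apply: nd; exists d, phis.
Qed.
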